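(* Let $S$ be a locally trivial (smooth) stratified space. Then the strata of $S$ are the orbits of the family $\mathcal{X}_s(S)$ of strongly stratified vector fields on $S$.
   Context: Differential spaces. A differential space is a topological space $R$ with a family $C^{\infty}(R)$ of functions $R\to\mathbb{R}$ such that: the sets $f^{-1}((a,b))$, $f\in C^\infty(R)$, $a,b\in\mathbb{R}$, form a sub-basis of the topology; $F(f_1,\dots,f_n)\in C^\infty(R)$ whenever $f_i\in C^\infty(R)$ and $F\in C^\infty(\mathbb{R}^n)$; and every function that locally coincides with functions in $C^\infty(R)$ belongs to $C^\infty(R)$. A continuous map is smooth if it pulls back smooth functions to smooth functions; a diffeomorphism is a homeomorphism that is smooth together with its inverse. Functions on a subset are smooth if they locally coincide with restrictions of functions in $C^\infty(R)$. A subcartesian space is a Hausdorff differential space locally diffeomorphic to subsets of Cartesian spaces $\mathbb{R}^n$. Differential spaces are assumed Hausdorff, second countable and paracompact. Stratified spaces. Let $S$ be a paracompact Hausdorff second countable space. A stratification of $S$ is a locally finite partition of $S$ into locally closed subspaces, called strata, such that: (Manifold Condition) every stratum is a smooth manifold in the induced topology; (Frontier Condition) if $M,N$ are strata and $\bar N\cap M\neq\emptyset$, then $M\subset\bar N$. A smooth chart on $S$ is a homeomorphism $\varphi$ of an open set $U\subseteq S$ onto a subspace of some $\mathbb{R}^n$ such that for every stratum $M$ the image $\varphi(U\cap M)$ is a smooth submanifold of $\mathbb{R}^n$ and $\varphi|U\cap M:U\cap M\to\varphi(U\cap M)$ is smooth. Charts $\varphi:U\to\mathbb{R}^n$, $\psi:V\to\mathbb{R}^m$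 are compatible if every $x\in U\cap V$ has an open neighbourhood $U_x\subseteq U\cap V$ for which there are $N\geq\max(n,m)$, open sets $O,O'\subseteq\mathbb{R}^N$ containing $\varphi(U_x)\times\{0\}$, $\psi(U_x)\times\{0\}$ respectively, and a diffeomorphism $H:O\to O'$ with $H(\varphi(y),0)=(\psi(y),0)$ for $y\in U_x$. A smooth structure is a maximal atlas of compatible smooth charts. All stratified spaces are assumed smooth. A continuous $f:S\to\mathbb{R}$ belongs to $C^{\infty}(S)$ if for every $x\in S$ and every chart $\varphi:U\to\mathbb{R}^n$ of the atlas with $x\in U$ there are a neighbourhood $U_x\subseteq U$ of $x$ and a smooth $g:\mathbb{R}^n\to\mathbb{R}$ with $f|U_x=g\circ\varphi|U_x$. With $C^\infty(S)$, $S$ is a subcartesian space. Local triviality. $S$ is locally trivial if for every $x\in S$, with $M$ the stratum containing $x$, there are an open neighbourhood $U$ of $x$ in $S$, a smooth stratified space $F$ with a distinguished point $o$ such that $\{o\}$ is a stratum of $F$, and a diffeomorphism of differential spaces $\varphi:U\to(M\cap U)\times F$ (the product having strata $(M\cap U)\times N$, $N$ a stratum of $F$, and the product smooth structure) which induces smooth diffeomorphisms of the corresponding strata and satisfies $\varphi(y)=(y,o)$ for $y\in M\cap U$. Vector fields. A derivation of $C^{\infty}(S)$ is a linear map $X:f\mapsto X\cdot f$ of $C^\infty(S)$ to itself satisfying Leibniz' rule. An integral curve of $X$ through $x$ is a smooth curve $c:I\to S$, $I$ an interval (possibly a single point) containing $0$, with $c(0)=x$ and $\frac{d}{dt}f(c(t))=(X\cdot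 f)(c(t))$ for all $f\in C^{\infty}(S)$, $t\in I$. Every derivation has a unique maximal integral curve through each $x$; $\varphi^X_t(x)$ denotes its value at $t$. A derivation $X$ is a vector field if for every $x\in S$ there are an open neighbourhood $U$ of $x$ and $\varepsilon>0$ such that for $|t|<\varepsilon$ the map $\varphi^X_t$ is defined on $U$ and restricts to a diffeomorphism of $U$ onto an open subset of $S$. A strongly stratified vector field on $S$ is a vector field $X$ on $S$ (in this sense) that restricts, for every stratum $M$ of $S$, to a smooth vector field on $M$. Orbits. The orbit through $x$ of a family $\mathcal{F}$ of vector fields is the set of all $y=(\varphi^{X^m}_{t_m}\circ\cdots\circ\varphi^{X^1}_{t_1})(x)$ with $m$ a positive integer, $X^i\in\mathcal{F}$, $t_i\in\mathbb{R}$, for which the expression is defined.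
   Formalization: The strata of S are assumed connected; without this the claim is false (two isolated points forming one 0-dimensional stratum have single points as orbits), and since orbits are always connected no case where the claim holds is lost. *)

(* Defs.v *)
From mathcomp Require Import all_boot all_order all_algebra.
From mathcomp Require Import all_classical all_reals all_analysis.

Set Implicit Arguments.
Unset Strict Implicit.
Unset Printing Implicit Defensive.

Import Order.TTheory GRing.Theory Num.Theory.
Import numFieldNormedType.Exports.

Local Open Scope classical_set_scope.
Local Open Scope ring_scope.

Section Calculus.
Context {R : realType}.

(* C^k on an open set [O]: all iterated partial derivatives of order at most
   [k] exist on [O] and those of order [k] are continuous there. *)
Fixpoint Ck (n k : nat) (O : set 'rV[R]_n) (f : 'rV[R]_n -> R) : Prop :=
  match k with
  | 0 => forall x, O x -> {for x, continuous f}
  | k'.+1 => forall i : 'I_n,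
      (forall x, O x -> derivable f x (delta_mx 0 i)) /\
      Ck k' O (fun x => 'D_(delta_mx 0 i) f x)
  end.

Definition smooth_fun n (O : set 'rV[R]_n) (f : 'rV[R]_n -> R) : Prop :=
  forall k, Ck k O f.

Definition smooth_on n m (O : set 'rV[R]_n) (f : 'rV[R]_n -> 'rV[R]_m) : Prop :=
  forall j : 'I_m, smooth_fun O (fun x => f x 0 j).

Definition diffeo_on n m (O : set 'rV[R]_n) (O' : set 'rV[R]_m)
    (H : 'rV[R]_n -> 'rV[R]_m) : Prop :=
  [/\ open O, open O', smooth_on O H & exists K,
    [/\ smooth_on O' K,
        forall x, O x -> O' (H x) /\ K (H x) = x &
        forall y, O' y -> O (K y) /\ H (K y) = y]].

Definition smooth1 (g : R -> R) : Prop :=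
  forall k t, derivable (derive1n k g) t 1.

(* [v] in R^n viewed as (v, 0) in R^N; only used for [n <= N]. *)
Definition pad n N (v : 'rV[R]_n) : 'rV[R]_N :=
  \row_(j < N) oapp (v 0) 0 (insub (val j)).

End Calculus.

(* Only the values of [cmap] on [cdom] are meaningful. *)
Record chart (R : realType) (T : Type) (n : nat) := Chart {
  cdom : set T;
  cmap : T -> 'rV[R]_n }.

Definition chart_comp (R : realType) (T T' : Type) n (i : T' -> T)
    (c : chart R T n) : chart R T' n :=
  Chart (i @^-1` cdom c) (cmap c \o i).

Definition chart_prod (R : realType) (T T' : Type) n m
    (c : chart R T n) (c' : chart R T' m) : chart R (T * T')%type (n + m) :=
  Chart (cdom c `*` cdom c') (fun p => row_mx (cmap c p.1) (cmap c' p.2)).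

Section Topology.

Definition locally_closed (T : topologicalType) (A : set T) : Prop :=
  exists U C, [/\ open U, closed C & A = U `&` C].

Definition locally_finite (T : topologicalType) (I : Type) (D : set I)
    (A : I -> set T) : Prop :=
  forall x : T, exists2 V, nbhs x V & finite_set [set i | D i /\ A i `&` V !=set0].

Definition paracompact (T : topologicalType) : Prop :=
  forall C : set (set T), C `<=` open -> cover C id = setT ->
    exists C' : set (set T),
      [/\ C' `<=` open, cover C' id = setT,
          forall A, C' A -> exists2 B, C B & A `<=` B &
          locally_finite C' id].

(* [f] restricts to a homeomorphism of [D] onto [f @` D]. *)
Definition homeo_onto_image (T T' : topologicalType) (D : set T) (f : T -> T')
    : Prop :=
  [/\ {within D, continuous f}, set_inj D f &
      forall V, open V -> exists2 W, open W & f @` (D `&` V) = W `&` f @` D].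

End Topology.

(* Throughout, a manifold is a subset [M] of a topological space [T] with the
   induced topology, and its charts are partial maps on [T] whose domains are
   relatively open subsets of [M]. *)
Section Manifolds.
Context {R : realType}.

Definition manifold_chart (T : topologicalType) (M : set T) d
    (c : chart R T d) : Prop :=
  [/\ exists2 V, open V & cdom c = M `&` V,
      homeo_onto_image (cdom c) (cmap c) &
      open (cmap c @` cdom c)].

Definition smooth_transition (T : Type) d (c c' : chart R T d) : Prop :=
  exists2 g : 'rV[R]_d -> 'rV[R]_d,
    smooth_on (cmap c @` (cdom c `&` cdom c')) g &
    forall y, cdom c y -> cdom c' y -> g (cmap c y) = cmap c' y.

Definition manifold_compatible (T : Type) d (c c' : chart R T d) : Prop :=
  smooth_transition c c' /\ smooth_transition c' c.

Definition manifold (T : topologicalType) (M : set T) d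
    (A : set (chart R T d)) : Prop :=
  [/\ A `<=` @manifold_chart T M d,
      M = \bigcup_(c in A) cdom c,
      forall c c', A c -> A c' -> manifold_compatible c c' &
      forall c, manifold_chart M c ->
        (forall c', A c' -> manifold_compatible c c') -> A c].

(* Smoothness of [f] on a (relatively open) subset [D] of the manifold with
   atlas [A], with values in the manifold with atlas [B]. *)
Definition manifold_smooth_map (T T' : Type) d e (D : set T)
    (A : set (chart R T d)) (B : set (chart R T' e)) (f : T -> T') : Prop :=
  forall x a b, D x -> A a -> B b -> cdom a x -> cdom b (f x) ->
    exists O (g : 'rV[R]_d -> 'rV[R]_e),
      [/\ open O, O (cmap a x), smooth_on O g &
          forall y, D y -> cdom a y -> O (cmap a y) ->
            cdom b (f y) /\ cmap b (f y) = g (cmap a y)].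

Definition manifold_Cinf (T : Type) (M : set T) d (A : set (chart R T d))
    : set (M -> R) :=
  [set f | forall (x : M) a, A a -> cdom a (val x) ->
    exists O (g : 'rV[R]_d -> R),
      [/\ open O, O (cmap a (val x)), smooth_fun O g &
          forall y : M, cdom a (val y) -> O (cmap a (val y)) ->
            f y = g (cmap a (val y))]].

(* Charts of a submanifold [P] of R^n: straightening diffeomorphisms
   [h : (O, O `&` P) -> (O', O' `&` (R^d x 0))], restricted to [P]. *)
Definition slice_chart n (P : set 'rV[R]_n) d : set (chart R 'rV[R]_n d) :=
  [set c | exists O O' (h : 'rV[R]_n -> 'rV[R]_n),
    [/\ diffeo_on O O' h,
        cdom c = P `&` O,
        forall y, P y -> O y -> h y = pad n (cmap c y) &
        forall y, O y -> (exists v : 'rV[R]_d, h y = pad n v) -> P y]].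
#[global] Arguments slice_chart {n} P d _.

Definition submanifold n (P : set 'rV[R]_n) d : Prop :=
  (d <= n)%N /\ forall p, P p -> exists2 c, slice_chart P d c & cdom c p.

End Manifolds.

(* Raw data; the axioms are in [stratification] and [smooth_structure] below.
   [satlas i] is the manifold atlas of the stratum of index [i]. *)
Record stratified (R : realType) := Stratified {
  carrier :> topologicalType;
  sindex : Type;
  stratum : sindex -> set carrier;
  sdim : sindex -> nat;
  satlas : forall i, set (chart R carrier (sdim i)) }.

#[global] Arguments stratum {R s} i _.
#[global] Arguments satlas {R s} i _.

Section Stratified.
Context {R : realType}.

Definition stratification (S : stratified R) : Prop :=
  [/\ hausdorff_space S, @second_countable S, paracompact S &
  [/\ partition setT (@stratum R S) setT /\ locally_finite setT (@stratum R S),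
      forall i : sindex S, locally_closed (stratum i),
      forall i : sindex S, manifold (stratum i) (satlas i) &
      forall i j : sindex S, closure (stratum i) `&` stratum j !=set0 ->
        stratum j `<=` closure (stratum i)]].

Definition smooth_chart (S : stratified R) n (c : chart R S n) : Prop :=
  [/\ open (cdom c), homeo_onto_image (cdom c) (cmap c) &
      forall i : sindex S, let P := cmap c @` (cdom c `&` stratum i) in
        exists2 d, submanifold P d &
          manifold_smooth_map (cdom c `&` stratum i) (satlas i)
            (slice_chart P d) (cmap c)].

Definition compatible (T : topologicalType) n m (c : chart R T n)
    (c' : chart R T m) : Prop :=
  forall x, cdom c x -> cdom c' x -> exists2 U, open_nbhs x U &
    U `<=` cdom c `&` cdom c' /\
    exists N O O' (H : 'rV[R]_N -> 'rV[R]_N),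
      [/\ (maxn n m <= N)%N, diffeo_on O O' H &
          forall y, U y ->
            [/\ O (pad N (cmap c y)), O' (pad N (cmap c' y)) &
                H (pad N (cmap c y)) = pad N (cmap c' y)]].

End Stratified.

Record smooth_stratified (R : realType) := SmoothStratified {
  strat :> stratified R;
  charts : forall n, set (chart R strat n) }.

#[global] Arguments charts {R} s n _.

Section SmoothStratified.
Context {R : realType}.

Definition smooth_structure (S : smooth_stratified R) : Prop :=
  [/\ forall n, charts S n `<=` @smooth_chart R S n,
      forall x : S, exists n, exists2 c, charts S n c & cdom c x,
      forall n m c c', charts S n c -> charts S m c' -> compatible c c' &
      forall n (c : chart R S n), smooth_chart c ->
        (forall m c', charts S m c' -> compatible c c') -> charts S n c].

Definition smooth_stratified_space (S : smooth_stratified R) : Prop :=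
  stratification S /\ smooth_structure S.

Definition Cinf (S : smooth_stratified R) : set (S -> R) :=
  [set f | continuous f /\
    forall (x : S) n (c : chart R S n), charts S n c -> cdom c x ->
      exists2 V, nbhs x V & V `<=` cdom c /\
        exists2 g : 'rV[R]_n -> R, smooth_fun setT g &
          forall y, V y -> f y = g (cmap c y)].

End SmoothStratified.

#[global] Arguments Cinf {R} S _.

Section DifferentialSpaces.
Context {R : realType}.

(* A differential structure on [T] is given by its set of smooth functions. *)
Definition smooth_map (T T' : topologicalType) (C : set (T -> R))
    (C' : set (T' -> R)) (f : T -> T') : Prop :=
  continuous f /\ forall h, C' h -> C (h \o f).

Definition diffeomorphism (T T' : topologicalType) (C : set (T -> R))
    (C' : set (T' -> R)) (f : T -> T') (g : T' -> T) : Prop :=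
  [/\ smooth_map C C' f, smooth_map C' C g, cancel f g & cancel g f].

Definition sub_Cinf (T : topologicalType) (C : set (T -> R)) (A : set T)
    : set (A -> R) :=
  [set f | forall x : A, exists V h,
    [/\ open_nbhs (val x) V, C h & forall y : A, V (val y) -> f y = h (val y)]].

End DifferentialSpaces.

Section LocalTriviality.
Context {R : realType}.

Definition sub_atlas (T : topologicalType) (A : set T) n
    (C : set (chart R T n)) : set (chart R A n) :=
  [set chart_comp (fun y : A => val y) c | c in C].

(* The open submanifold [stratum i `&` U], as a smooth stratified space with
   a single stratum. *)
Definition open_stratum_strat (S : stratified R) (i : sindex S) (U : set S) :=
  @Stratified R (stratum i `&` U : set S) unit (fun=> setT) (fun=> sdim i)
    (fun=> sub_atlas (satlas i)).

Definition open_stratum (S : stratified R) (i : sindex S) (U : set S) :=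
  @SmoothStratified R (open_stratum_strat i U)
    (fun n => [set c : chart R (open_stratum_strat i U) n | smooth_chart c /\
       forall c', @satlas R (open_stratum_strat i U) tt c' -> compatible c c']).

Definition prod_strat (S S' : stratified R) :=
  @Stratified R (S * S')%type (sindex S * sindex S')%type
    (fun ij => stratum ij.1 `*` stratum ij.2)
    (fun ij => (sdim ij.1 + sdim ij.2)%N)
    (fun ij => [set c | manifold_chart (stratum ij.1 `*` stratum ij.2) c /\
       forall a b, satlas ij.1 a -> satlas ij.2 b ->
         manifold_compatible c (chart_prod a b)]).

(* The maximal atlas generated by the products of charts. *)
Definition prod_stratified (S S' : smooth_stratified R) :=
  @SmoothStratified R (prod_strat S S')
    (fun n => [set c : chart R (prod_strat S S') n | smooth_chart c /\
       forall m m' a b, charts S m a -> charts S' m' b ->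
         compatible c (chart_prod a b)]).

Definition locally_trivial (S : smooth_stratified R) : Prop :=
  forall (x : S) (i : sindex S), stratum i x ->
  exists (U : set S) (F : smooth_stratified R) (o : F)
    (f : U -> prod_stratified (open_stratum i U) F)
    (g : prod_stratified (open_stratum i U) F -> U),
  [/\ open_nbhs x U,
      smooth_stratified_space F /\ exists k : sindex F, stratum k = [set o],
      diffeomorphism (@sub_Cinf R S (Cinf S) U) (Cinf _) f g,
      forall j : sindex S, stratum j `&` U !=set0 ->
        let D := [set y : U | stratum j (val y)] in
        let A := sub_atlas (satlas j) in
        exists k : sindex (prod_stratified (open_stratum i U) F),
          [/\ f @` D = stratum k,
              manifold_smooth_map D A (satlas k) f &
              manifold_smooth_map (stratum k) (satlas k) A g] &
      forall (y : U) (z : (stratum i `&` U : set S)),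
        val y = val z -> f y = (z, o)].

End LocalTriviality.

Section VectorFields.
Context {R : realType}.

(* Only the values of [X] on [C] are meaningful. *)
Definition derivation (T : Type) (C : set (T -> R)) (X : (T -> R) -> (T -> R))
    : Prop :=
  [/\ forall f, C f -> C (X f),
      forall (a : R) f h, C f -> C h -> X (a *: f + h) = a *: X f + X h &
      forall f h, C f -> C h -> X (f * h) = X f * h + f * X h].

(* The derivative is taken within [I], hence one-sided at an endpoint that
   belongs to [I]; when [I] is a point the condition on it is vacuous. *)
Definition integral_curve (T : topologicalType) (C : set (T -> R))
    (X : (T -> R) -> (T -> R)) (x : T) (I : set R) (c : R -> T) : Prop :=
  [/\ is_interval I, I 0, c 0 = x,
      {within I, continuous c} /\
      (forall f, C f -> forall t, I t -> exists2 V, nbhs t V &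
         exists2 g, smooth1 g & forall s, V s -> I s -> f (c s) = g s) &
      forall f, C f -> forall t, I t ->
        (s - t)^-1 * (f (c s) - f (c t))
          @[s --> within [set s | I s /\ s != t] (nbhs t)] --> X f (c t)].

Definition maximal_integral_curve (T : topologicalType) (C : set (T -> R))
    (X : (T -> R) -> (T -> R)) (x : T) (I : set R) (c : R -> T) : Prop :=
  integral_curve C X x I c /\
  forall I' c', integral_curve C X x I' c' -> I `<=` I' ->
    (forall t, I t -> c' t = c t) -> I' = I.

(* [flow C X t x y]: the flow of [X] at time [t] is defined at [x], with
   value [y]. *)
Definition flow (T : topologicalType) (C : set (T -> R))
    (X : (T -> R) -> (T -> R)) (t : R) (x y : T) : Prop :=
  exists I c, [/\ maximal_integral_curve C X x I c, I t & c t = y].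

Definition vector_field (T : topologicalType) (C : set (T -> R))
    (X : (T -> R) -> (T -> R)) : Prop :=
  derivation C X /\
  forall x, exists2 U, open_nbhs x U & exists2 e : R, 0 < e &
    forall t, `|t| < e -> exists2 V, open V &
      exists (f : U -> V) (g : V -> U),
        diffeomorphism (@sub_Cinf R T C U) (@sub_Cinf R T C V) f g /\
        forall y : U, flow C X t (val y) (val (f y)).

Definition strongly_stratified (S : smooth_stratified R)
    : set ((S -> R) -> (S -> R)) :=
  [set X | vector_field (Cinf S) X /\
    forall i : sindex S, exists2 Y : (stratum i -> R) -> (stratum i -> R),
      derivation (manifold_Cinf (satlas i)) Y &
      forall f, Cinf S f -> X f \o val = Y (f \o val)].

Fixpoint reach (T : topologicalType) (C : set (T -> R))
    (F : set ((T -> R) -> (T -> R))) (m : nat) (x y : T) : Prop :=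
  match m with
  | 0 => x = y
  | m'.+1 => exists X t z, [/\ F X, flow C X t x z & reach C F m' z y]
  end.

Definition vf_orbit (T : topologicalType) (C : set (T -> R))
    (F : set ((T -> R) -> (T -> R))) (x : T) : set T :=
  [set y | exists m, reach C F m.+1 x y].

End VectorFields.

#[global] Arguments strongly_stratified {R} S _.

(* Main.v *)
Require Import Defs.
From mathcomp Require Import all_boot all_order all_algebra.
From mathcomp Require Import all_classical all_reals all_analysis.
From mathcomp Require Import ring lra zify.
Set Implicit Arguments.
Unset Strict Implicit.
Unset Printing Implicit Defensive.
Import Order.TTheory GRing.Theory Num.Theory.
Import numFieldNormedType.Exports.
Local Open Scope classical_set_scope.
Local Open Scope ring_scope.

(** Two things have to be shown: a strongly stratified vector field never
    leaves a stratum, and the flows of these fields join any two points of the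
    same stratum.

    Invariance ([integral_curve_stratum]). Let [X] be strongly stratified. A
    slice chart at a point of a stratum provides smooth functions [F j] on the
    space whose common zeros are, near that point, the points of the stratum.
    As [X] is tangent to the stratum, the functions [X (F j)] vanish on it, and
    a smooth function that vanishes on a coordinate plane is bounded by a
    multiple of the transverse coordinates; so [`|X (F j)|] is at most
    [K * \sum_l `|F l|] ([tangent_bound]). Along an integral curve the function
    [w = \sum_j F j ^+ 2] then satisfies [`|w'| <= L * w], and a solution of
    this inequality with one zero vanishes identically ([gronwall]). Hence the
    times which an integral curve spends in each stratum form a relatively open
    set. An interval is not a disjoint union of two nonempty open subsets, so a
    single stratum takes all the times.

    Transitivity ([stratum_linked]). A connected stratum is linked by flows as
    soon as the points near [x] in the stratum are linked to and from [x]
    ([local_linked]): the points that can be reached from [x] form a clopen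
    subset. Near [x] one moves along one coordinate of a chart at a time, so it
    suffices to find, for each coordinate, a strongly stratified field that
    moves it ([local_action]). Local existence theorems for differential
    equations are avoided by writing the flow down first and differentiating
    it. The line acts on itself by [interval_flow], a smooth flow with orbit
    ]-1, 1[ and with all other points fixed: it is a translation transported to
    ]-1, 1[ by a diffeomorphism that grows so fast at the end points that the
    flow is tangent to the identity there to infinite order. In a box of a
    chart, [shift] moves one coordinate by this flow, at a speed that depends on
    the other coordinates and vanishes before they leave the box. Finally, local
    triviality identifies a neighbourhood of [x] with the product of an open
    subset of the stratum and a fibre; the flow acts on the first factor, at a
    speed cut off by a bump function on the fibre, and is extended by the
    identity ([lift_flow_action]). The result is an action of the line which is
    smooth, jointly in time and space, and preserves every stratum, because
    strata are products in the trivialization and only the first factor moves.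

    The generator of such an action is a derivation whose flow is the action
    ([act_flow]). It restricts to a derivation of the smooth functions of each
    stratum since those are locally restrictions of smooth functions of the
    space ([manifold_extend]), which is again a consequence of local triviality:
    a function of the first factor of a product is a function on the product. *)

(** * Differentiation of functions of several variables *)
Section Box.
Context {R : realType}.

Lemma nbhs_rVP n (x : 'rV[R]_n) (P : set 'rV[R]_n) :
  nbhs x P <->
  exists2 e : R, 0 < e & forall y : 'rV[R]_n, (forall j, `|y 0 j - x 0 j| < e) -> P y.
Proof.
split.
  move=> /nbhs_ballP[e /= e0 H]; exists e => // y yx; apply: H.
  split => // i j; rewrite (ord1 i) /ball /= distrC; exact: yx.
move=> [e e0 H]; apply/nbhs_ballP; exists e => //= y [_ yx]; apply: H => j.
by have := yx 0 j; rewrite /ball /= distrC.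
Qed.

Lemma cvg_rVP (T : Type) (F : set_system T) (FF : Filter F) n
    (f : T -> 'rV[R]_n) (x : 'rV[R]_n) :
  f @ F --> x <-> forall j, (fun t => f t 0 j) @ F --> x 0 j.
Proof.
split=> [H j|H].
  exact: (cvg_comp f (fun y : 'rV[R]_n => y 0 j) H (@coord_continuous R 1 n 0 j x)).
move=> P /nbhs_rVP[e e0 eP].
have : \forall t \near F, forall j, `|f t 0 j - x 0 j| < e.
  apply: filter_forall => j.
  by have /cvgr_dist_lt/(_ _ e0) := H j; apply: filterS => t; rewrite distrC.
by apply: filterS => t; exact: eP.
Qed.

Lemma continuous_rVP (T : topologicalType) n (f : T -> 'rV[R]_n) (x : T) :
  {for x, continuous f} <-> forall j, {for x, continuous (fun t => f t 0 j)}.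
Proof. exact: cvg_rVP. Qed.

Lemma derivable_line_at n (f : 'rV[R]_n -> R) x v t :
  (derivable f (t *: v + x) v <-> derivable (fun s : R => f (s *: v + x)) t 1) /\
  'D_v f (t *: v + x) = 'D_1 (fun s : R => f (s *: v + x)) t.
Proof.
rewrite /derivable /derive.
have -> : (fun h : R => h^-1 *: (((fun s : R => f (s *: v + x)) \o shift t)
      (h *: (1 : R)) - (fun s : R => f (s *: v + x)) t)) =
    (fun h : R => h^-1 *: ((f \o shift (t *: v + x)) (h *: v) - f (t *: v + x))).
  apply/funext => h /=.
  by congr (_ *: (f _ - _)); rewrite [h *: 1]mulr1 scalerDl addrA.
by [].
Qed.

Lemma derivable_line n (f : 'rV[R]_n -> R) x v :
  (derivable f x v <-> derivable (fun s : R => f (s *: v + x)) 0 1) /\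
  'D_v f x = 'D_1 (fun s : R => f (s *: v + x)) 0.
Proof. by have := derivable_line_at f x v 0; rewrite scale0r add0r. Qed.

Lemma cvg_sumr (T : Type) (F : set_system T) (FF : Filter F) n
    (f : 'I_n -> T -> R) (l : 'I_n -> R) :
  (forall j, f j @ F --> l j) ->
  (fun t => \sum_j f j t) @ F --> \sum_j l j.
Proof.
elim: n f l => [|n IH] f l H.
  rewrite big_ord0; apply: cvg_near_cst; apply: nearW => t.
  by rewrite big_ord0.
rewrite big_ord_recr /=.
under eq_fun do rewrite big_ord_recr /=.
by apply: cvgD; [apply: IH|exact: H].
Qed.

Lemma is_derive_affine (a b t : R) : is_derive t 1 (fun r : R => r * a + b) a.
Proof.
have H : is_derive t 1 ((id : R -> R) * cst a + cst b) (t *: 0 + a *: 1 + 0).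
  by apply: is_deriveD; apply: is_deriveM.
by apply: is_derive_eq H _; rewrite scaler0 add0r addr0 /GRing.scale /= mulr1.
Qed.

Lemma mvt_coord n (F : 'rV[R]_n -> R) z (j : 'I_n) (h : R) :
  (forall s : R, `|s| <= `|h| -> derivable F (z + s *: delta_mx 0 j) (delta_mx 0 j)) ->
  exists2 s : R, `|s| <= `|h| &
    F (z + h *: delta_mx 0 j) - F z =
    'D_(delta_mx 0 j) F (z + s *: delta_mx 0 j) * h.
Proof.
move=> dF.
(* the segment is parametrized by the unit interval because [h] may be negative *)
pose phi (u : R) := F (z + (u * h) *: delta_mx 0 j).
have dphi (u : R) : `|u| <= 1 ->
    is_derive u 1 phi ('D_(delta_mx 0 j) F (z + (u * h) *: delta_mx 0 j) * h).
  move=> u1.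
  have uh : `|u * h| <= `|h| by rewrite normrM ler_piMl.
  have [E1 E2] := derivable_line F (z + (u * h) *: delta_mx 0 j) (delta_mx 0 j).
  have e1 : is_derive (0 : R) (1 : R) (fun s : R => F (s *: delta_mx 0 j +
      (z + (u * h) *: delta_mx 0 j))) ('D_(delta_mx 0 j) F (z + (u * h) *: delta_mx 0 j)).
    exact: DeriveDef (E1.1 (dF _ uh)) (esym E2).
  have e2 : is_derive u 1 (fun r : R => r * h + (- u * h)) h.
    exact: is_derive_affine.
  have e1' : is_derive (u * h + - u * h) (1 : R) (fun s : R => F (s *: delta_mx 0 j +
      (z + (u * h) *: delta_mx 0 j))) ('D_(delta_mx 0 j) F (z + (u * h) *: delta_mx 0 j)).
    by rewrite mulNr subrr.
  have := @is_derive1_comp R _ (fun r : R => r * h + (- u * h)) _ _ _ e1' e2.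
  suff -> : (fun s : R => F (s *: delta_mx 0 j + (z + (u * h) *: delta_mx 0 j))) \o
     (fun r : R => r * h + (- u * h)) = phi by [].
  apply/funext => r /=; rewrite /phi; congr F.
  by rewrite addrCA -scalerDl; congr (_ + _ *: _); ring.
have [] := @MVT_segment R phi
    (fun u => 'D_(delta_mx 0 j) F (z + (u * h) *: delta_mx 0 j) * h) 0 1 ler01.
- move=> u; rewrite in_itv /= => /andP[u0 u1]; apply: dphi.
  by rewrite ger0_norm ltW.
- apply: derivable_within_continuous => u; rewrite in_itv /= => /andP[u0 u1].
  by have [] := dphi u; rewrite // ger0_norm.
move=> c; rewrite in_itv /= => /andP[c0 c1].
rewrite /phi mul1r mul0r scale0r addr0 subr0 mulr1 => ->.
exists (c * h) => //; rewrite normrM ler_piMl //.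
by rewrite ger0_norm.
Qed.

Definition in_box n (z z' xi : 'rV[R]_n) :=
  forall l, `|xi 0 l - z 0 l| <= `|z' 0 l - z 0 l|.

(** The mean value theorem, one coordinate at a time: the segments joining
    [z] to [z'] through the points that agree with [z'] on the first [k]
    coordinates stay in the box spanned by [z] and [z']. In contrast with the
    differential at [z], this needs partial derivatives only. *)
Lemma increment n (F : 'rV[R]_n -> R) (z z' : 'rV[R]_n) :
  (forall xi j, in_box z z' xi -> derivable F xi (delta_mx 0 j)) ->
  exists2 xi : 'I_n -> 'rV[R]_n, forall j, in_box z z' (xi j) &
    F z' - F z = \sum_j 'D_(delta_mx 0 j) F (xi j) * (z' 0 j - z 0 j).
Proof.
move=> dF.
(* [zk k] agrees with [z'] on the first [k] coordinates and with [z] on the others *)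
pose zk (k : nat) : 'rV[R]_n := \row_l (if (l < k)%N then z' 0 l else z 0 l).
have zkS (j : 'I_n) : zk j.+1 = zk j + (z' 0 j - z 0 j) *: delta_mx 0 j.
  apply/rowP => l; rewrite !mxE eqxx /= ltnS leq_eqVlt eq_sym.
  case: (altP (l =P j)) => [->|lj].
    by rewrite eqxx ltnn /= mulr1 addrCA subrr addr0.
  by rewrite (negbTE (_ : (j : nat) != l)) 1?eq_sym //= mulr0 addr0.
have box (j : 'I_n) (s : R) : `|s| <= `|z' 0 j - z 0 j| ->
    in_box z z' (zk j + s *: delta_mx 0 j).
  move=> sz l; rewrite !mxE eqxx /=.
  case: (altP (l =P j)) => [->|lj].
    by rewrite ltnn mulr1 addrAC subrr add0r.
  by rewrite mulr0 addr0; case: ifP => // _; rewrite subrr normr0.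
have H (j : 'I_n) : exists2 xi, in_box z z' xi &
    F (zk j.+1) - F (zk j) = 'D_(delta_mx 0 j) F xi * (z' 0 j - z 0 j).
  rewrite zkS.
  have [] := @mvt_coord n F (zk j) j (z' 0 j - z 0 j).
    by move=> s sz; apply: dF; exact: box.
  move=> s sz ->; exists (zk j + s *: delta_mx 0 j) => //; exact: box.
have [xi Hxi] := choice (fun j => let: ex_intro2 x a b := H j in
   ex_intro (fun x => in_box z z' x /\ F (zk j.+1) - F (zk j) =
      'D_(delta_mx 0 j) F x * (z' 0 j - z 0 j)) x (conj a b)).
exists xi => [j|]; first by case: (Hxi j).
under eq_bigr do rewrite -(Hxi _).2.
have -> : z' = zk n by apply/rowP => l; rewrite mxE ltn_ord.
have {1}-> : z = zk 0%N by apply/rowP => l; rewrite mxE.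
by rewrite -(big_mkord xpredT (fun k => F (zk k.+1) - F (zk k))) telescope_sumr.
Qed.

(** The chain rule along a curve, from continuous partial derivatives alone:
    write the increment of [F] by [increment] at points [xi h j], which tend to
    [g t] with [h] because they lie in the box spanned by [g t] and
    [g (h + t)]. *)
Lemma derive_curve m (F : 'rV[R]_m -> R) (g : R -> 'rV[R]_m) (t : R) :
  (\forall z \near g t, forall j, derivable F z (delta_mx 0 j)) ->
  (forall j, {for g t, continuous (fun z => 'D_(delta_mx 0 j) F z)}) ->
  (forall j, derivable (fun s => g s 0 j) t 1) ->
  is_derive t 1 (F \o g)
    (\sum_j 'D_(delta_mx 0 j) F (g t) * 'D_1 (fun s => g s 0 j) t).
Proof.
move=> /nbhs_rVP[e e0 eF] cF dg.
have cg j : (fun h : R => g (h + t) 0 j) @ 0^' --> g t 0 j.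
  have /derivable1_diffP/differentiable_continuous := dg j.
  move=> cgt; apply: (cvg_comp (fun h : R => h + t) (fun s => g s 0 j) _ cgt).
  have : (fun h : R => h + t) @ 0^' --> 0 + t.
    by apply: cvgD; [exact: cvg_within|exact: cvg_cst].
  by rewrite add0r.
have near_box (d : R) : 0 < d ->
    \forall h \near 0^', forall j, `|g (h + t) 0 j - g t 0 j| < d.
  move=> d0; apply: filter_forall => j.
  by have /cvgr_dist_lt/(_ _ d0) := cg j; apply: filterS => h; rewrite distrC.
have H (h : R) : exists xi : 'I_m -> 'rV[R]_m,
    (forall j, `|g (h + t) 0 j - g t 0 j| < e) ->
    (forall j, in_box (g t) (g (h + t)) (xi j)) /\
    F (g (h + t)) - F (g t) =
    \sum_j 'D_(delta_mx 0 j) F (xi j) * (g (h + t) 0 j - g t 0 j).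
  have [he|] := pselect (forall j, `|g (h + t) 0 j - g t 0 j| < e); last first.
    by move=> nh; exists (fun=> 0).
  have [] := @increment m F (g t) (g (h + t)).
    by move=> xi j xib; apply: eF => l; apply: le_lt_trans (xib l) (he l).
  by move=> xi x1 x2; exists xi.
have {H}[xi Hxi] := choice H.
have cxi j : (fun h => xi h j) @ 0^' --> g t.
  move=> P /nbhs_rVP[d d0 dP].
  suff : \forall h \near 0^', P (xi h j) by [].
  apply: filterS (filterI (near_box e e0) (near_box d d0)) => h [he hd].
  apply: dP => l.
  by have [/(_ j l) /le_lt_trans + _] := Hxi h he; apply.
have C : h^-1 *: ((F \o g \o shift t) (h *: (1 : R)) - (F \o g) t) @[h --> 0^'] -->
    \sum_j 'D_(delta_mx 0 j) F (g t) * 'D_1 (fun s => g s 0 j) t.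
  have : \sum_j ('D_(delta_mx 0 j) F (xi h j) *
       (h^-1 *: (((fun s => g s 0 j) \o shift t) (h *: (1 : R)) - g t 0 j))) @[h --> 0^'] -->
    \sum_j 'D_(delta_mx 0 j) F (g t) * 'D_1 (fun s => g s 0 j) t.
    apply: cvg_sumr => j; apply: cvgM.
      exact: (cvg_comp (fun x => xi x j) _ (cxi j) (cF j)).
    exact: dg.
  apply: cvg_trans; apply: near_eq_cvg.
  near=> h.
  have [] := Hxi h; first by near: h; exact: near_box.
  rewrite /= => _; rewrite [h *: 1]mulr1 => ->.
  rewrite scaler_sumr; apply: eq_bigr => j _.
  by rewrite /GRing.scale /=; ring.
split; first by apply/cvg_ex; eexists; exact: C.
exact: cvg_lim C.
Unshelve. all: by end_near. Qed.

End Box.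

(** * Smooth functions on open subsets of R^n *)
Section Smooth.
Context {R : realType}.

(** The conditions that define [Ck] bear on each point of [O] separately,
    although the derivatives are computed in the ambient space. Hence
    smoothness restricts to subsets and is local. *)
Lemma Ck_pt n k (O : set 'rV[R]_n) f :
  Ck k O f <-> forall x, O x -> Ck k [set x] f.
Proof.
elim: k f => [|k IH] f /=.
  by split=> [H x Ox y ->|H x Ox]; [exact: H|exact: (H x Ox)].
split=> [H x Ox i|H i].
  have [Hd /IH Hk] := H i; split; first by move=> y ->; exact: Hd.
  exact: Hk.
split=> [x Ox|]; first by have [+ _] := H x Ox i; apply.
by apply/IH => x Ox; have [_] := H x Ox i.
Qed.

Lemma Ck_eq n k (O : set 'rV[R]_n) f g : open O ->
  (forall x, O x -> f x = g x) -> Ck k O f -> Ck k O g.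
Proof.
move=> oO; elim: k f g => [|k IH] f g fg /=;
  (have near_fg x : O x -> \forall y \near x, f y = g y by
    move=> Ox; apply: filterS (open_nbhs_nbhs (conj oO Ox)) => y; exact: fg).
  move=> cf x Ox; have : f @ x --> g x by rewrite -fg //; exact: cf.
  by move=> Hx; apply: cvg_trans Hx; exact: near_eq_cvg (near_fg x Ox).
move=> H i; have [dH kH] := H i; split.
  move=> x Ox; apply: near_eq_derivable (dH x Ox); exact: near_fg.
apply: IH kH => x Ox; apply: near_eq_derive; exact: near_fg.
Qed.

Lemma smooth_fun_sub n (O O' : set 'rV[R]_n) f :
  O' `<=` O -> smooth_fun O f -> smooth_fun O' f.
Proof. by move=> sO sf k; apply/Ck_pt => x /sO; apply: (Ck_pt _ _ _).1. Qed.

Lemma smooth_fun_eq n (O : set 'rV[R]_n) f g : open O ->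
  (forall x, O x -> f x = g x) -> smooth_fun O f -> smooth_fun O g.
Proof. by move=> oO fg sf k; apply: (Ck_eq oO fg). Qed.

Lemma smooth_fun_loc n (O : set 'rV[R]_n) f :
  (forall x, O x -> exists2 O', O' x & smooth_fun O' f) -> smooth_fun O f.
Proof.
move=> H k; apply/Ck_pt => x /H[V Vx sf].
exact: (Ck_pt _ _ _).1 (sf k) x Vx.
Qed.

Lemma smooth_funP n (O : set 'rV[R]_n) f : smooth_fun O f <->
  (forall x, O x -> {for x, continuous f}) /\
  (forall i, (forall x, O x -> derivable f x (delta_mx 0 i)) /\
     smooth_fun O (fun x => 'D_(delta_mx 0 i) f x)).
Proof.
split=> [H|[c H] [|k] //= i]; last by have [? ?] := H i; split.
split=> [|i]; first exact: (H 0%N).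
split=> [|k]; first by have [] := H 1%N i.
by have [] := H k.+1 i.
Qed.

Lemma smooth_cont n (O : set 'rV[R]_n) f x :
  smooth_fun O f -> O x -> {for x, continuous f}.
Proof. by move=> /smooth_funP[+ _]; apply. Qed.

Lemma smooth_derivable n (O : set 'rV[R]_n) f x i :
  smooth_fun O f -> O x -> derivable f x (delta_mx 0 i).
Proof. by move=> /smooth_funP[_ /(_ i)[+ _]]; apply. Qed.

Lemma smooth_derive n (O : set 'rV[R]_n) f i :
  smooth_fun O f -> smooth_fun O (fun x => 'D_(delta_mx 0 i) f x).
Proof. by move=> /smooth_funP[_ /(_ i)[]]. Qed.

(** Coinduction: a class of functions which is stable under partial
    derivatives consists of smooth functions. *)
Lemma smooth_coind n (O : set 'rV[R]_n) (P : ('rV[R]_n -> R) -> Prop) : open O ->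
  (forall f, P f -> (forall x, O x -> {for x, continuous f}) /\
    forall i, exists2 g, P g & forall x, O x -> is_derive x (delta_mx 0 i) f (g x)) ->
  forall f, P f -> smooth_fun O f.
Proof.
move=> oO H f Pf k; elim: k f Pf => [|k IH] f Pf; first exact: (H f Pf).1.
move=> i; have [g Pg fg] := (H f Pf).2 i; split=> [x Ox|].
  exact: (@ex_derive _ _ _ _ _ _ _ (fg x Ox)).
apply: (Ck_eq (f := g) oO) (IH g Pg) => x Ox.
by rewrite (@derive_val _ _ _ _ _ _ _ (fg x Ox)).
Qed.

Lemma smooth_cst n (O : set 'rV[R]_n) (c : R) : smooth_fun O (fun=> c).
Proof.
apply: (@smooth_fun_sub _ setT) => //.
apply: (@smooth_coind _ setT (fun f => exists c, f = fun=> c)); [exact: openT| |by exists c].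
move=> _ [a ->]; split=> [x _|i]; first exact: cst_continuous.
exists (fun=> 0); first by exists 0.
move=> x _; exact: is_derive_cst.
Qed.

Lemma is_derive_coord n (x v : 'rV[R]_n) (j : 'I_n) :
  is_derive x v (fun y : 'rV[R]_n => y 0 j) (v 0 j).
Proof.
have [E1 E2] := derivable_line (fun y : 'rV[R]_n => y 0 j) x v.
have D : is_derive (0 : R) (1 : R) (fun s : R => (s *: v + x) 0 j) (v 0 j).
  have -> : (fun s : R => (s *: v + x) 0 j) = (fun s => s * v 0 j + x 0 j).
    by apply/funext => s; rewrite !mxE.
  exact: is_derive_affine.
have D1 := @ex_derive _ _ _ _ _ _ _ D.
have D2 := @derive_val _ _ _ _ _ _ _ D.
exact: DeriveDef (E1.2 D1) (etrans E2 D2).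
Qed.

Lemma smooth_coord n (O : set 'rV[R]_n) (j : 'I_n) :
  smooth_fun O (fun x => x 0 j).
Proof.
apply/smooth_funP; split=> [x _|i]; first exact: coord_continuous.
split=> [x _|]; first exact: (@ex_derive _ _ _ _ _ _ _ (is_derive_coord x _ j)).
have -> : (fun x : 'rV[R]_n => 'D_(delta_mx 0 i) (fun y : 'rV[R]_n => y 0 j) x) =
   fun=> (delta_mx 0 i : 'rV[R]_n) 0 j.
  by apply/funext => x; exact: (@derive_val _ _ _ _ _ _ _ (is_derive_coord x _ j)).
exact: smooth_cst.
Qed.

Lemma CkD n k (O : set 'rV[R]_n) (f g : 'rV[R]_n -> R) : open O ->
  Ck k O f -> Ck k O g -> Ck k O (fun x => f x + g x).
Proof.
move=> oO; elim: k f g => [|k IH] f g /= cf cg.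
  move=> x Ox; exact: (cvgD (cf x Ox) (cg x Ox)).
move=> i; have [df kf] := cf i; have [dg kg] := cg i; split=> [x Ox|].
  exact: derivableD (df x Ox) (dg x Ox).
apply: (Ck_eq oO) (IH _ _ kf kg) => x Ox.
by rewrite -(deriveD (df x Ox) (dg x Ox)).
Qed.

(** The induction on [k] needs all the lower orders: the derivative of the
    product involves [f] itself together with the derivatives of [g]. *)
Lemma CkM n k (O : set 'rV[R]_n) (f g : 'rV[R]_n -> R) : open O ->
  (forall j, (j <= k)%N -> Ck j O f) -> (forall j, (j <= k)%N -> Ck j O g) ->
  Ck k O (fun x => f x * g x).
Proof.
move=> oO; elim: k f g => [|k IH] f g cf cg.
  move=> x Ox; exact: (cvgM (cf 0%N (leqnn _) x Ox) (cg 0%N (leqnn _) x Ox)).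
move=> i; have [df kf] := cf k.+1 (leqnn _) i; have [dg kg] := cg k.+1 (leqnn _) i.
split=> [x Ox|].
  exact: derivableM (df x Ox) (dg x Ox).
have cf' j : (j <= k)%N -> Ck j O (fun x => 'D_(delta_mx 0 i) f x).
  by move=> jk; have [] := cf j.+1 jk i.
have cg' j : (j <= k)%N -> Ck j O (fun x => 'D_(delta_mx 0 i) g x).
  by move=> jk; have [] := cg j.+1 jk i.
have cf0 j : (j <= k)%N -> Ck j O f by move=> jk; apply: cf; exact: leqW.
have cg0 j : (j <= k)%N -> Ck j O g by move=> jk; apply: cg; exact: leqW.
have := CkD oO (IH _ _ cf0 cg') (IH _ _ cg0 cf').
apply: (Ck_eq oO) => x Ox.
by rewrite -[X in _ = X](esym (deriveM (df x Ox) (dg x Ox))).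
Qed.

Lemma smoothD n (O : set 'rV[R]_n) (f g : 'rV[R]_n -> R) : open O ->
  smooth_fun O f -> smooth_fun O g -> smooth_fun O (fun x => f x + g x).
Proof. by move=> oO sf sg k; apply: CkD. Qed.

Lemma smoothM n (O : set 'rV[R]_n) (f g : 'rV[R]_n -> R) : open O ->
  smooth_fun O f -> smooth_fun O g -> smooth_fun O (fun x => f x * g x).
Proof. by move=> oO sf sg k; apply: CkM. Qed.

Lemma smoothN n (O : set 'rV[R]_n) (f : 'rV[R]_n -> R) : open O ->
  smooth_fun O f -> smooth_fun O (fun x => - f x).
Proof.
move=> oO sf; have := smoothM oO (smooth_cst O (-1)) sf.
by apply: (smooth_fun_eq oO) => x _; rewrite mulN1r.
Qed.

Lemma smoothB n (O : set 'rV[R]_n) (f g : 'rV[R]_n -> R) : open O ->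
  smooth_fun O f -> smooth_fun O g -> smooth_fun O (fun x => f x - g x).
Proof. by move=> oO sf sg; apply: smoothD => //; apply: smoothN. Qed.

Lemma smooth_sum n (O : set 'rV[R]_n) (I : Type) (r : seq I) (P : pred I)
    (f : I -> 'rV[R]_n -> R) : open O ->
  (forall i, P i -> smooth_fun O (f i)) ->
  smooth_fun O (fun x => \sum_(i <- r | P i) f i x).
Proof.
move=> oO H; elim: r => [|i r IH].
  by under eq_fun do rewrite big_nil; exact: smooth_cst.
under eq_fun do rewrite big_cons.
by case: (P i) (H i) => // /(_ isT) Hi; exact: smoothD.
Qed.

Section Comp.
Variables (n m : nat) (O : set 'rV[R]_n) (O' : set 'rV[R]_m).
Variable g : 'rV[R]_n -> 'rV[R]_m.
Hypotheses (oO : open O) (oO' : open O') (sg : smooth_on O g).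
Hypothesis gO : forall x, O x -> O' (g x).

Lemma smooth_on_cont x : O x -> {for x, continuous g}.
Proof. by move=> Ox; apply/continuous_rVP => j; apply: smooth_cont Ox; exact: sg. Qed.

(** [derive_curve] applied to the image under [g] of a coordinate line. *)
Lemma derive_comp (F : 'rV[R]_m -> R) x i : smooth_fun O' F -> O x ->
  is_derive x (delta_mx 0 i) (F \o g)
   (\sum_j 'D_(delta_mx 0 j) F (g x) * 'D_(delta_mx 0 i) (fun y => g y 0 j) x).
Proof.
move=> sF Ox; set v := delta_mx 0 i.
have [E1 E2] := derivable_line (F \o g) x v.
have D : is_derive (0 : R) (1 : R) (F \o (fun s : R => g (s *: v + x)))
    (\sum_j 'D_(delta_mx 0 j) F (g (0 *: v + x)) *
       'D_1 (fun s : R => g (s *: v + x) 0 j) 0).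
  have e0 : 0 *: v + x = x by rewrite scale0r add0r.
  apply: derive_curve.
  - rewrite e0; apply: filterS (open_nbhs_nbhs (conj oO' (gO Ox))) => z O'z j.
    exact: smooth_derivable O'z.
  - by move=> j; rewrite e0; apply: (smooth_cont (O := O')) (gO Ox); exact: smooth_derive.
  - move=> j; have [E _] := derivable_line (fun y => g y 0 j) x v.
    exact: (E.1 (smooth_derivable (sg j) Ox)).
have D1 := @ex_derive _ _ _ _ _ _ _ D.
have D2 := @derive_val _ _ _ _ _ _ _ D.
apply: DeriveDef (E1.2 D1) _; rewrite E2 {E1 E2}.
rewrite D2.
apply: eq_bigr => j _; rewrite scale0r add0r.
by have [_ ->] := derivable_line (fun y => g y 0 j) x v.
Qed.

(** By the chain rule a derivative of [F \o g] is a sum of products of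
    functions [F' \o g], of the same form, with derivatives of [g]. *)
Lemma smooth_comp (F : 'rV[R]_m -> R) : smooth_fun O' F -> smooth_fun O (F \o g).
Proof.
move=> sF k.
suff : forall k F, smooth_fun O' F -> forall j, (j <= k)%N -> Ck j O (F \o g).
  by move=> /(_ k F sF k (leqnn _)).
elim=> {k F sF} [|k IH] F sF j.
  rewrite leqn0 => /eqP -> x Ox; apply: continuous_comp.
    exact: smooth_on_cont.
  exact: smooth_cont sF (gO Ox).
case: j => [_|j]; first exact: (IH F sF 0%N).
rewrite ltnS => jk i; split=> [x Ox|].
  exact: (@ex_derive _ _ _ _ _ _ _ (derive_comp i sF Ox)).
apply: (@Ck_eq _ _ _ (fun x => \sum_l ('D_(delta_mx 0 l) F \o g) x *
          'D_(delta_mx 0 i) (fun y => g y 0 l) x)) => // [x Ox|].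
  by rewrite (@derive_val _ _ _ _ _ _ _ (derive_comp i sF Ox)).
have : forall l : 'I_m, Ck j O (fun x => ('D_(delta_mx 0 l) F \o g) x *
          'D_(delta_mx 0 i) (fun y => g y 0 l) x).
  move=> l; apply: CkM => // [j' jj'|j' _].
    by apply: IH; [exact: smooth_derive|exact: leq_trans jk].
  exact: smooth_derive.
elim: (index_enum _) => [|l r IHr] H.
  by under eq_fun do rewrite big_nil; exact: smooth_cst.
under eq_fun do rewrite big_cons.
by apply: CkD => //; exact: IHr.
Qed.
End Comp.

Lemma smooth_on_comp n m p (O : set 'rV[R]_n) (O' : set 'rV[R]_m)
    (g : 'rV[R]_n -> 'rV[R]_m) (F : 'rV[R]_m -> 'rV[R]_p) :
  open O -> open O' -> smooth_on O g -> (forall x, O x -> O' (g x)) ->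
  smooth_on O' F -> smooth_on O (F \o g).
Proof. by move=> oO oO' sg gO sF j; apply: (smooth_comp oO oO' sg gO (sF j)). Qed.

Lemma smooth_on_sub n m (O O' : set 'rV[R]_n) (g : 'rV[R]_n -> 'rV[R]_m) :
  O' `<=` O -> smooth_on O g -> smooth_on O' g.
Proof. by move=> sO sg j; apply: smooth_fun_sub sO (sg j). Qed.

Lemma smooth_on_id n (O : set 'rV[R]_n) : smooth_on O id.
Proof. by move=> j; exact: smooth_coord. Qed.

Lemma open_preim n m (O : set 'rV[R]_n) (O' : set 'rV[R]_m)
    (g : 'rV[R]_n -> 'rV[R]_m) : open O -> open O' ->
  (forall x, O x -> {for x, continuous g}) -> open (O `&` g @^-1` O').
Proof.
move=> oO oO' cg; rewrite openE => x [Ox O'x]; rewrite /interior.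
apply: filterI; first exact: open_nbhs_nbhs.
exact: cg Ox _ (open_nbhs_nbhs (conj oO' O'x)).
Qed.

End Smooth.
(** * Elementary functions of one variable *)
Section OneVar.
Context {R : realType}.

(** Stated on R^1 so that the composition lemma for maps between the spaces
    R^n applies; the elementary functions below are composed with functions of
    several variables. *)
Definition smooth1_on (D : set R) (g : R -> R) : Prop :=
  smooth_fun [set v : 'rV[R]_1 | D (v 0 0)] (fun v => g (v 0 0)).

Lemma open_coord n (D : set R) (i : 'I_n) : open D -> open [set v : 'rV[R]_n | D (v 0 i)].
Proof. by move=> oD; apply: (@open_comp _ _ (fun v : 'rV[R]_n => v 0 i)) => // v _; exact: coord_continuous. Qed.

Lemma smooth1_coind (D : set R) (P : (R -> R) -> Prop) : open D ->
  (forall f, P f -> exists2 g, P g & forall x, D x -> is_derive x 1 f (g x)) ->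
  forall f, P f -> smooth1_on D f.
Proof.
move=> oD H f Pf.
apply: (@smooth_coind R 1 _ (fun F => exists2 f, P f & F = fun v => f (v 0 0))).
- exact: open_coord.
- move=> {f Pf} _ [f Pf ->]; have [g Pg fg] := H f Pf; split=> [v Dv|i].
    have /= fc : {for v 0 0, continuous f}.
      by apply: differentiable_continuous; apply/derivable1_diffP;
         exact: (@ex_derive _ _ _ _ _ _ _ (fg _ Dv)).
    by apply: (@continuous_comp _ _ _ (fun v : 'rV[R]_1 => v 0 0) f) => //; exact: coord_continuous.
  exists (fun v => g (v 0 0)); first by exists g.
  move=> v /= Dv; rewrite (ord1 i).
  have [E1 E2] := derivable_line (fun v : 'rV[R]_1 => f (v 0 0)) v (delta_mx 0 0).
  have D0 : is_derive (0 * 1 + v 0 0) (1 : R) f (g (v 0 0)).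
    by rewrite mul0r add0r; exact: fg.
  have D1 := @is_derive1_comp R f (fun r : R => r * 1 + v 0 0) _ _ _ D0
              (is_derive_affine 1 (v 0 0) 0).
  have E : (fun s : R => f ((s *: delta_mx 0 0 + v : 'rV[R]_1) 0 0)) =
      f \o (fun r : R => r * 1 + v 0 0).
    by apply/funext => s /=; rewrite !mxE !eqxx.
  rewrite E in E1 E2.
  apply: DeriveDef (E1.2 (@ex_derive _ _ _ _ _ _ _ D1)) _.
  by rewrite E2 (@derive_val _ _ _ _ _ _ _ D1) mulr1.
- by exists f.
Qed.

Lemma smooth1_comp (D : set R) (g : R -> R) n (O : set 'rV[R]_n) (f : 'rV[R]_n -> R) :
  open D -> smooth1_on D g -> open O -> smooth_fun O f ->
  (forall x, O x -> D (f x)) -> smooth_fun O (fun x => g (f x)).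
Proof.
move=> oD sg oO sf fD.
pose h (x : 'rV[R]_n) : 'rV[R]_1 := \row_(_ < 1) f x.
have -> : (fun x => g (f x)) = (fun v : 'rV[R]_1 => g (v 0 0)) \o h.
  by apply/funext => x /=; rewrite /h mxE.
apply: smooth_comp sg => //; first exact: open_coord.
  by move=> j; apply: (smooth_fun_eq oO) sf => x _; rewrite /h mxE.
by move=> x Ox; rewrite /= /h mxE; exact: fD.
Qed.

Lemma smooth_open_gt n (O : set 'rV[R]_n) (f : 'rV[R]_n -> R) a :
  open O -> smooth_fun O f -> open [set x | O x /\ a < f x].
Proof.
move=> oO sf; rewrite openE => x [Ox ax]; rewrite /interior.
apply: filterI; first exact: open_nbhs_nbhs.
exact: (smooth_cont sf Ox (lt_nbhsr ax)).
Qed.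

Lemma smooth_open_lt n (O : set 'rV[R]_n) (f : 'rV[R]_n -> R) a :
  open O -> smooth_fun O f -> open [set x | O x /\ f x < a].
Proof.
move=> oO sf; rewrite openE => x [Ox ax]; rewrite /interior.
apply: filterI; first exact: open_nbhs_nbhs.
exact: (smooth_cont sf Ox (lt_nbhsl ax)).
Qed.

Lemma smooth1_expR : smooth1_on setT (@expR R).
Proof.
apply: (@smooth1_coind _ (fun f => f = @expR R)) => //; first exact: openT.
by move=> _ ->; exists expR => // x _; exact: is_derive_expR.
Qed.

(** The functions [c / x ^+ k] are the class to which [smooth1_coind] is
    applied, both for the inverse and for the logarithm. *)
Lemma is_derive_invX (c : R) k (x : R) : x != 0 ->
  is_derive x 1 (fun x : R => c * x^-1 ^+ k) ((- c *+ k) * x^-1 ^+ k.+1).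
Proof.
move=> x0.
have D0 : is_derive x (1 : R) (fun x : R => x^-1) (- x ^- 2).
  apply: (is_derive_eq (@is_deriveV R id x 1 1 x0 (is_derive_id x 1))).
  by rewrite /GRing.scale /= mulr1.
have D1 := is_deriveM (is_derive_cst c x 1) (is_deriveX k D0).
have -> : (fun x : R => c * x^-1 ^+ k) = (cst c * (fun x : R => x^-1) ^+ k).
  by apply/funext => y; rewrite -[RHS]/(c * ((fun x : R => x^-1) ^+ k) y) fctE.
apply: (is_derive_eq D1).
rewrite scaler0 addr0 /GRing.scale /=.
clear D1; case: k => [|k] /=; first by rewrite mulr0n !mul0r mulr0.
rewrite -exprVn -[_ *+ k.+1]mulr_natl !exprS expr0; move: (x^-1) => y; ring.
Qed.

Lemma smooth1_inv : smooth1_on [set x | x != 0] (fun x : R => x^-1).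
Proof.
apply: (@smooth1_coind _ (fun f => exists c k, f = fun x => c * x^-1 ^+ k)).
- exact: open_neq.
- move=> _ [c [k ->]]; exists (fun x => (- c *+ k) * x^-1 ^+ k.+1).
    by exists (- c *+ k), k.+1.
  by move=> x x0; exact: is_derive_invX.
- by exists 1, 1%N; apply/funext => x; rewrite mul1r.
Qed.

Lemma smooth1_ln : smooth1_on [set x | 0 < x] (@ln R).
Proof.
apply: (@smooth1_coind _ (fun f => f = @ln R \/ exists c k, f = fun x => c * x^-1 ^+ k)).
- exact: open_gt.
- move=> _ [->|[c [k ->]]].
    exists (fun x => 1 * x^-1 ^+ 1); first by right; exists 1, 1%N.
    by move=> x x0; rewrite mul1r expr1; exact: is_derive1_ln.
  exists (fun x => (- c *+ k) * x^-1 ^+ k.+1).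
    by right; exists (- c *+ k), k.+1.
  by move=> x x0; apply: is_derive_invX; rewrite gt_eqF.
- by left.
Qed.

(** All its derivatives vanish at [0], so that it is smooth, and it turns a pole
    at [0] into an infinitely small term. *)
Definition flat (x : R) : R := if 0 < x then expR (- x^-1) else 0.

Lemma flat_ge0 x : 0 <= flat x.
Proof. by rewrite /flat; case: ifP => // _; exact: expR_ge0. Qed.

Lemma flat_le0 x : x <= 0 -> flat x = 0.
Proof. by rewrite /flat leNgt => /negbTE ->. Qed.

Lemma flat_gt0 x : 0 < x -> 0 < flat x.
Proof. by rewrite /flat => ->; exact: expR_gt0. Qed.

(** At most linear growth at [0], whatever the pole: [expR (1 / x)] exceeds
    the term of order [k + 1] of its power series. *)
Lemma flat_small k (x : R) : `|x^-1 ^+ k * flat x| <= k.+1`!%:R * `|x|.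
Proof.
rewrite /flat; case: ifPn => [x0|_]; last first.
  by rewrite mulr0 normr0 mulr_ge0.
have E : 1 + x^-1 ^+ k.+1 / k.+1`!%:R <= expR (x^-1).
  by apply: expR_ge1Dxn; rewrite invr_ge0 ltW.
rewrite ger0_norm; last first.
  by rewrite mulr_ge0 ?expR_ge0 // exprn_ge0 // invr_ge0 ltW.
rewrite (gtr0_norm x0) expRN ler_pdivrMr ?expR_gt0 //.
have f0 : (0 : R) < k.+1`!%:R by rewrite ltr0n fact_gt0.
have x1 : 0 < x^-1 ^+ k by rewrite exprn_gt0 // invr_gt0.
have E' : x^-1 ^+ k.+1 / k.+1`!%:R <= expR (x^-1).
  by apply: le_trans E; rewrite lerDr.
have -> : x^-1 ^+ k = k.+1`!%:R * x * (x^-1 ^+ k.+1 / k.+1`!%:R).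
  rewrite exprS; field; by rewrite gt_eqF // gt_eqF.
by rewrite ler_pM2l // mulr_gt0.
Qed.

Lemma is_derive_flat k (x : R) : is_derive x 1 (fun x : R => x^-1 ^+ k * flat x)
  (- k%:R * (x^-1 ^+ k.+1 * flat x) + 1 * (x^-1 ^+ k.+2 * flat x)).
Proof.
have [x0|x0|x0] := ltgtP x 0.
- rewrite flat_le0 ?ltW // !mulr0 addr0.
  apply: (near_eq_is_derive _ (is_derive_cst (0 : R) x 1)).
  near=> y; rewrite flat_le0 ?mulr0 //.
  by apply: ltW; near: y; exact: lt_nbhsl.
- rewrite /flat x0.
  apply: (@near_eq_is_derive _ _ _ ((fun x => 1 * x^-1 ^+ k) * (fun x => expR (- 1 * x^-1 ^+ 1)))).
  + near=> y.
    have -> : 0 < y by near: y; exact: lt_nbhsr.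
    by rewrite fctE /= mul1r mulN1r expr1.
  have xn0 : x != 0 by rewrite gt_eqF.
  have D1 := is_derive_invX 1 k xn0.
  have D2 := is_derive_invX (-1) 1 xn0.
  have D3 := @is_derive1_comp R expR (fun x => - 1 * x^-1 ^+ 1) x _ _ (is_derive_expR _) D2.
  apply: (is_derive_eq (is_deriveM D1 D3)).
  rewrite /GRing.scale /= mulN1r expr1 opprK mulr1n mul1r.
  rewrite -mulNrn -mulr_natl !exprS expr0; move: (x^-1) => y; ring.
- rewrite x0 flat_le0 // !mulr0 addr0.
  have C : h^-1 *: (((fun x : R => x^-1 ^+ k * flat x) \o shift 0) (h *: (1 : R)) -
       (fun x : R => x^-1 ^+ k * flat x) 0) @[h --> 0^'] --> (0 : R).
    apply/cvgrPdist_le => /= e e0.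
    have f0 : (0 : R) < k.+2`!%:R by rewrite ltr0n fact_gt0.
    near=> h.
    rewrite /= [h *: 1]mulr1 sub0r normrN addr0 (flat_le0 (lexx 0)) mulr0 subr0 /GRing.scale /=.
    rewrite mulrA -exprS; apply: le_trans (flat_small _ _) _.
    rewrite -ler_pdivlMl // mulrC.
    near: h; apply: dnbhs0_le; exact: divr_gt0.
  by split; [apply/cvg_ex; eexists; exact: C|exact: cvg_lim C].
Unshelve. all: by end_near. Qed.

(** The derivatives of [flat] are combinations of functions
    [x^-1 ^+ k * flat x]. As [0^-1 = 0], these functions vanish at [0], where
    the pole would be. *)
Inductive flat_comb : (R -> R) -> Prop :=
| FlatPole k : flat_comb (fun x => x^-1 ^+ k * flat x)
| FlatLin a f b g : flat_comb f -> flat_comb g -> flat_comb (fun x => a * f x + b * g x).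

Lemma smooth1_flat : smooth1_on setT flat.
Proof.
apply: (@smooth1_coind _ flat_comb); first exact: openT.
- move=> f; elim=> [k|a {}f b g _ [f' Pf' ff'] _ [g' Pg' gg']].
    exists (fun x => - k%:R * (x^-1 ^+ k.+1 * flat x) + 1 * (x^-1 ^+ k.+2 * flat x)).
      by apply: FlatLin; exact: FlatPole.
    by move=> x _; exact: is_derive_flat.
  exists (fun x => a * f' x + b * g' x); first exact: FlatLin.
  move=> x _; have Df := ff' x I; have Dg := gg' x I.
  have Da : is_derive x 1 (a *: f + b *: g) (a *: f' x + b *: g' x).
    by apply: is_deriveD; exact: is_deriveZ.
  exact: Da.
- have -> : flat = (fun x => x^-1 ^+ 0 * flat x) by apply/funext => x; rewrite expr0 mul1r.
  exact: FlatPole.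
Qed.

Section Comps.
Variables (n : nat) (O : set 'rV[R]_n) (f : 'rV[R]_n -> R).
Hypotheses (oO : open O) (sf : smooth_fun O f).

Lemma smooth_expR : smooth_fun O (fun x => expR (f x)).
Proof. by apply: smooth1_comp smooth1_expR _ _ _ => //; exact: openT. Qed.

Lemma smooth_flat : smooth_fun O (fun x => flat (f x)).
Proof. by apply: smooth1_comp smooth1_flat _ _ _ => //; exact: openT. Qed.

Lemma smooth_inv : (forall x, O x -> f x != 0) -> smooth_fun O (fun x => (f x)^-1).
Proof. by move=> f0; apply: smooth1_comp smooth1_inv _ _ _ => //; exact: open_neq. Qed.

Lemma smooth_ln : (forall x, O x -> 0 < f x) -> smooth_fun O (fun x => ln (f x)).
Proof. by move=> f0; apply: smooth1_comp smooth1_ln _ _ _ => //; exact: open_gt. Qed.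

End Comps.

Lemma sqrt_expR (x : R) : 0 < x -> Num.sqrt x = expR (ln x * 2^-1).
Proof.
move=> x0; have {1}-> : x = expR (ln x * 2^-1) ^+ 2.
  by rewrite -expRM_natr -mulrA mulVf // mulr1 lnK.
by rewrite sqrtr_sqr ger0_norm // expR_ge0.
Qed.

Lemma smooth_sqrt n (O : set 'rV[R]_n) (f : 'rV[R]_n -> R) : open O ->
  smooth_fun O f -> (forall x, O x -> 0 < f x) -> smooth_fun O (fun x => Num.sqrt (f x)).
Proof.
move=> oO sf f0.
have : smooth_fun O (fun x => expR (ln (f x) * 2^-1)).
  by apply: smooth_expR => //; apply: smoothM => //; [exact: smooth_ln|exact: smooth_cst].
by apply: (smooth_fun_eq oO) => x Ox; rewrite sqrt_expR // f0.
Qed.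

End OneVar.

(** * A flow on the line with orbit ]-1, 1[ *)
Section Flow1.
Context {R : realType}.

(** [exp_arsinh z] is the exponential of the inverse hyperbolic sine of [z], in
    closed form; [sinh_ln] is its inverse, the hyperbolic sine of the
    logarithm. *)
Definition exp_arsinh (z : R) : R := z + Num.sqrt (1 + z ^+ 2).
Definition sinh_ln (E : R) : R := (E - E^-1) / 2.

Lemma sqr1_gt0 (z : R) : 0 < 1 + z ^+ 2.
Proof. by rewrite ltr_pwDl // sqr_ge0. Qed.

Lemma sqrt_ge_norm (a b : R) : 0 <= b -> `|a| <= Num.sqrt (b + a ^+ 2).
Proof. by move=> b0; rewrite -sqrtr_sqr ler_wsqrtr // lerDr. Qed.

Lemma sqrt_gt_norm (a b : R) : 0 < b -> `|a| < Num.sqrt (b + a ^+ 2).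
Proof. by move=> b0; rewrite -sqrtr_sqr ltr_sqrt ?ltrDr // ltr_pwDl // sqr_ge0. Qed.

Lemma exp_arsinh_gt0 z : 0 < exp_arsinh z.
Proof.
rewrite /exp_arsinh -ltrBlDl sub0r; apply: le_lt_trans (@sqrt_gt_norm z 1 ltr01).
by rewrite -normrN ler_norm.
Qed.

Lemma exp_arsinhK E : 0 < E -> exp_arsinh (sinh_ln E) = E.
Proof.
move=> E0; rewrite /exp_arsinh /sinh_ln.
have -> : 1 + ((E - E^-1) / 2) ^+ 2 = ((E + E^-1) / 2) ^+ 2.
  by field; rewrite gt_eqF.
rewrite sqrtr_sqr ger0_norm; last first.
  by rewrite divr_ge0 // addr_ge0 // ?invr_ge0; exact: ltW.
by field; rewrite gt_eqF.
Qed.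

Lemma sqr_sqrt1 (z : R) : Num.sqrt (1 + z ^+ 2) ^+ 2 = 1 + z ^+ 2.
Proof. by rewrite sqr_sqrtr // ltW // sqr1_gt0. Qed.

Lemma exp_arsinhN z : exp_arsinh (- z) = (exp_arsinh z)^-1.
Proof.
have A0 := exp_arsinh_gt0 z.
apply: (mulfI (lt0r_neq0 A0)); rewrite mulfV ?gt_eqF //.
rewrite /exp_arsinh sqrrN -[RHS](_ : Num.sqrt (1 + z ^+ 2) ^+ 2 - z ^+ 2 = 1).
  ring.
by rewrite sqr_sqrt1 addrK.
Qed.

Lemma sinh_lnK z : sinh_ln (exp_arsinh z) = z.
Proof. by rewrite /sinh_ln -exp_arsinhN /exp_arsinh sqrrN; field. Qed.

(** A diffeomorphism of ]-1, 1[ onto the line, with inverse [Phi]: the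
    hyperbolic sine of [2 y / (1 - y ^+ 2)]. The rational function is a
    diffeomorphism already; the exponential growth added by the hyperbolic sine
    makes translations, read in ]-1, 1[, infinitely close to the identity at
    the end points. *)
Definition Psi (y : R) : R := sinh_ln (expR (2 * y / (1 - y ^+ 2))).
Definition Phi (s : R) : R :=
  let u := ln (exp_arsinh s) in u / (1 + Num.sqrt (1 + u ^+ 2)).

Lemma norm_lt1 (y : R) : `|y| < 1 -> 0 < 1 - y ^+ 2.
Proof. by move=> y1; rewrite subr_gt0 -(real_normK (num_real y)) expr_lt1. Qed.

Lemma PsiK y : `|y| < 1 -> Phi (Psi y) = y.
Proof.
move=> /norm_lt1 y1; rewrite /Phi /Psi exp_arsinhK ?expR_gt0 // expRK.
have y0 : 1 - y ^+ 2 != 0 by rewrite gt_eqF.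
have -> : 1 + (2 * y / (1 - y ^+ 2)) ^+ 2 = ((1 + y ^+ 2) / (1 - y ^+ 2)) ^+ 2.
  by field.
rewrite sqrtr_sqr ger0_norm; last by rewrite divr_ge0 ?(ltW y1) // ltW // sqr1_gt0.
field; rewrite y0 /=; apply/eqP => H.
by move: H; lra.
Qed.

Lemma den_gt0 (u : R) : 0 < 1 + Num.sqrt (1 + u ^+ 2).
Proof. by rewrite ltr_pwDl // sqrtr_ge0. Qed.

Lemma Phi_lt1 s : `|Phi s| < 1.
Proof.
rewrite /Phi; set u := ln _; rewrite normrM normfV (gtr0_norm (den_gt0 _)).
rewrite ltr_pdivrMr ?den_gt0 // mul1r.
by apply: le_lt_trans (@sqrt_ge_norm u 1 ler01) _; rewrite ltrDr.
Qed.

Lemma PhiK s : Psi (Phi s) = s.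
Proof.
rewrite /Psi /Phi; set u := ln _.
set q := Num.sqrt _; have q2 : q ^+ 2 = 1 + u ^+ 2 by exact: sqr_sqrt1.
have q0 : 1 + q != 0 by rewrite gt_eqF // den_gt0.
have -> : 2 * (u / (1 + q)) / (1 - (u / (1 + q)) ^+ 2) = u.
  have -> : 1 - (u / (1 + q)) ^+ 2 = 2 / (1 + q).
    have -> : (u / (1 + q)) ^+ 2 = (q ^+ 2 - 1) / (1 + q) ^+ 2.
      by rewrite q2 expr_div_n; congr (_ / _); ring.
    by field.
  by field; rewrite q0.
by rewrite lnK ?sinh_lnK // posrE exp_arsinh_gt0.
Qed.

Definition interval_flow (t y : R) : R := if `|y| < 1 then Phi (Psi y + t) else y.

Lemma interval_flow_0 y : interval_flow 0 y = y.
Proof. by rewrite /interval_flow; case: ifP => // y1; rewrite addr0 PsiK. Qed.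

Lemma interval_flow_lt1 t y : (`|interval_flow t y| < 1) = (`|y| < 1).
Proof. by rewrite /interval_flow; case: ifP => // y1; rewrite Phi_lt1. Qed.

Lemma interval_flowD s t y : interval_flow (s + t) y = interval_flow s (interval_flow t y).
Proof.
rewrite {2}/interval_flow interval_flow_lt1; rewrite /interval_flow; case: ifP => // y1.
by rewrite PhiK addrAC addrA.
Qed.

Lemma interval_flow_ge1 t y : 1 <= `|y| -> interval_flow t y = y.
Proof. by rewrite /interval_flow leNgt => /negbTE ->. Qed.

Lemma interval_flow_le1 t y : `|y| <= 1 -> `|interval_flow t y| <= 1.
Proof.
rewrite le_eqVlt => /orP[/eqP y1|y1]; first by rewrite interval_flow_ge1 ?y1.
by apply: ltW; rewrite interval_flow_lt1.
Qed.

Lemma interval_flow_trans a b : `|a| < 1 -> `|b| < 1 -> exists t, interval_flow t a = b.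
Proof.
by move=> a1 b1; exists (Psi b - Psi a); rewrite /interval_flow a1 addrC subrK PsiK.
Qed.

Lemma PhiN s : Phi (- s) = - Phi s.
Proof. by rewrite /Phi exp_arsinhN lnV ?posrE ?exp_arsinh_gt0 // sqrrN mulNr. Qed.

Lemma PsiN s : Psi (- s) = - Psi s.
Proof.
rewrite /Psi sqrrN mulrN mulNr expRN /sinh_ln invrK; field.
by rewrite gt_eqF // expR_gt0.
Qed.

Lemma interval_flowN t y : interval_flow t (- y) = - interval_flow (- t) y.
Proof.
rewrite /interval_flow normrN; case: ifP => // y1.
by rewrite PsiN -PhiN opprD opprK.
Qed.

Section Smooth.
Variables (n : nat) (O : set 'rV[R]_n).
Hypothesis oO : open O.
Implicit Types f t : 'rV[R]_n -> R.

Lemma smooth_exp_arsinh f : smooth_fun O f -> smooth_fun O (fun x => exp_arsinh (f x)).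
Proof.
move=> sf; apply: smoothD => //; apply: smooth_sqrt => //.
  by apply: smoothD => //; [exact: smooth_cst|exact: smoothM].
by move=> x _; exact: sqr1_gt0.
Qed.

Lemma smooth_sinh_ln f : smooth_fun O f -> (forall x, O x -> f x != 0) ->
  smooth_fun O (fun x => sinh_ln (f x)).
Proof.
move=> sf f0; apply: smoothM => //; last exact: smooth_cst.
by apply: smoothB => //; exact: smooth_inv.
Qed.

Lemma smooth_Psi f : smooth_fun O f -> (forall x, O x -> `|f x| < 1) ->
  smooth_fun O (fun x => Psi (f x)).
Proof.
move=> sf f1; apply: smooth_sinh_ln; last by move=> x _; rewrite gt_eqF // expR_gt0.
apply: smooth_expR => //; apply: smoothM => //.
  by apply: smoothM => //; exact: smooth_cst.
apply: smooth_inv => //; last by move=> x Ox; rewrite gt_eqF // norm_lt1 // f1.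
by apply: smoothB => //; [exact: smooth_cst|exact: smoothM].
Qed.

Lemma smooth_Phi f : smooth_fun O f -> smooth_fun O (fun x => Phi (f x)).
Proof.
move=> sf.
have su : smooth_fun O (fun x => ln (exp_arsinh (f x))).
  by apply: smooth_ln => //; [exact: smooth_exp_arsinh|move=> x _; exact: exp_arsinh_gt0].
apply: smoothM => //; apply: smooth_inv => //.
apply: smoothD => //; first exact: smooth_cst.
apply: smooth_sqrt => //; last by move=> x _; exact: sqr1_gt0.
by apply: smoothD => //; [exact: smooth_cst|exact: smoothM].
Qed.

End Smooth.

(** The smooth form of the flow near the end point [1]. Put [v] for
    [sinh_ln y^-1], which is [(1 - y ^+ 2) / (2 y)], a smooth coordinate which
    vanishes at [y = 1], and [e] for [flat v], so that [Psi y] is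
    [sinh_ln e^-1] for [0 < y < 1]. A translation by [t] of [Psi y] multiplies
    [e^-1] by [end_factor e t], which is a smooth function of [e] up to [e = 0],
    with the value [1] there. *)
Definition end_factor (e t : R) : R :=
  let a := (1 - e ^+ 2) / 2 + t * e in a + Num.sqrt (e ^+ 2 + a ^+ 2).

Lemma end_radicand (e t : R) : 0 < e ^+ 2 + ((1 - e ^+ 2) / 2 + t * e) ^+ 2.
Proof.
have [->|e0] := eqVneq e 0.
  by rewrite mulr0 addr0 expr0n subr0 /= add0r exprn_gt0 // divr_gt0.
by rewrite ltr_pwDl ?sqr_ge0 // exprn_even_gt0.
Qed.

Lemma end_factor_gt0 (e t : R) : 0 < end_factor e t.
Proof.
rewrite /end_factor /=.
have [->|e0] := eqVneq e 0.
  by rewrite mulr0 addr0 expr0n subr0 /= add0r ltr_pwDl ?sqrtr_ge0.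
rewrite -ltrBlDl sub0r; set a := (_ / 2 + t * e).
have e20 : 0 < e ^+ 2 by rewrite exprn_even_gt0.
by apply: le_lt_trans (sqrt_gt_norm a e20); rewrite -normrN ler_norm.
Qed.

Lemma end_factorE (e t : R) : 0 < e ->
  end_factor e t = exp_arsinh (sinh_ln e^-1 + t) * e.
Proof.
move=> e0; rewrite /end_factor /exp_arsinh /sinh_ln /=.
have E : (1 - e ^+ 2) / 2 + t * e = e * ((e^-1 - e^-1^-1) / 2 + t).
  by field; rewrite gt_eqF.
rewrite E; set z := ((_ - _) / 2 + t).
have -> : e ^+ 2 + (e * z) ^+ 2 = e ^+ 2 * (1 + z ^+ 2) by ring.
by rewrite sqrtrM ?sqr_ge0 // sqrtr_sqr gtr0_norm //; ring.
Qed.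

Lemma end_factor0 t : end_factor 0 t = 1.
Proof.
rewrite /end_factor /= mulr0 addr0 expr0n subr0 /= add0r sqrtr_sqr.
by rewrite ger0_norm ?divr_ge0 // mul1r; field.
Qed.

(** The flow divides the coordinate [v] by this number, which is [1] at the
    end point [y = 1]. *)
Definition end_correction (t y : R) : R :=
  1 + sinh_ln y^-1 * ln (end_factor (flat (sinh_ln y^-1)) t).

(** On both sides of the end point [1] the flow is given by one formula, in
    which only smooth functions occur: beyond [1] the coordinate [v] is
    nonpositive, so that [flat v] is [0] and the formula reduces to the
    identity. *)
Lemma interval_flow_end t y : 0 < y -> 0 < end_correction t y ->
  interval_flow t y = (exp_arsinh (sinh_ln y^-1 / end_correction t y))^-1.
Proof.
move=> y0; rewrite /end_correction; set v := sinh_ln y^-1.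
have [v0|v0] := leP v 0.
  have y1 : 1 <= y.
    rewrite leNgt; apply/negP => y1.
    have : v > 0 by rewrite /v /sinh_ln invrK divr_gt0 // subr_gt0 (lt_trans y1) // invf_gt1.
    by rewrite ltNge v0.
  rewrite flat_le0 // end_factor0 ln1 mulr0 addr0 divr1 => _.
  rewrite interval_flow_ge1; last by rewrite ger0_norm // ltW.
  by rewrite /v exp_arsinhK ?invr_gt0 // invrK.
have y1 : y < 1.
  rewrite ltNge; apply/negP => y1.
  have : v <= 0.
    rewrite /v /sinh_ln invrK pmulr_lle0 ?invr_gt0 // subr_le0.
    by apply: (le_trans _ y1); rewrite invf_le1.
  by rewrite leNgt v0.
set L := ln _ => D0.
have ny1 : `|y| < 1 by rewrite gtr0_norm.
rewrite /interval_flow ny1 /Phi /Psi.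
have -> : 2 * y / (1 - y ^+ 2) = v^-1.
  rewrite /v /sinh_ln invrK; field.
  have y2 := norm_lt1 ny1.
  by rewrite mulNr -expr2 gt_eqF //= gt_eqF.
have eE : flat v = (expR v^-1)^-1 by rewrite /flat v0 expRN.
have LE : ln (exp_arsinh (sinh_ln (expR v^-1) + t)) = v^-1 + L.
  rewrite /L eE end_factorE ?invr_gt0 ?expR_gt0 // invrK.
  by rewrite ln_div ?posrE ?exp_arsinh_gt0 ?expR_gt0 // expRK [RHS]addrC subrK.
rewrite LE; set u := v^-1 + L.
have uE : u = (1 + v * L) / v by rewrite /u; field; rewrite gt_eqF.
have u0 : 0 < u by rewrite uE divr_gt0.
have -> : v / (1 + v * L) = u^-1 by rewrite uE invf_div.
rewrite /exp_arsinh.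
have -> : 1 + u^-1 ^+ 2 = u^-1 ^+ 2 * (1 + u ^+ 2).
  by field; rewrite gt_eqF.
rewrite sqrtrM ?sqr_ge0 // sqrtr_sqr gtr0_norm ?invr_gt0 //.
have q0 := den_gt0 u.
by field; rewrite gt_eqF // gt_eqF.
Qed.

Lemma smooth_interval_flow_end n (O : set 'rV[R]_n) (t f : 'rV[R]_n -> R) x : open O ->
  smooth_fun O t -> smooth_fun O f -> O x -> 1 <= f x ->
  exists2 V, open_nbhs x V & smooth_fun V (fun x => interval_flow (t x) (f x)).
Proof.
move=> oO st sf Ox fx1.
pose O1 := [set x | O x /\ 0 < f x].
have oO1 : open O1 by exact: smooth_open_gt.
have sO1 : O1 `<=` O by move=> z [].
have sf1 : smooth_fun O1 f by exact: smooth_fun_sub sf.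
have st1 : smooth_fun O1 t by exact: smooth_fun_sub st.
have sv : smooth_fun O1 (fun x => sinh_ln (f x)^-1).
  have f0 z : O1 z -> f z != 0 by move=> [_ z0]; rewrite gt_eqF.
  apply: smooth_sinh_ln => //; first exact: smooth_inv.
  by move=> z Oz; rewrite invr_eq0 f0.
have se : smooth_fun O1 (fun x => flat (sinh_ln (f x)^-1)) by exact: smooth_flat.
have sa : smooth_fun O1 (fun x => (1 - flat (sinh_ln (f x)^-1) ^+ 2) / 2 +
     t x * flat (sinh_ln (f x)^-1)).
  apply: smoothD => //; last exact: smoothM.
  apply: smoothM => //; last exact: smooth_cst.
  by apply: smoothB => //; [exact: smooth_cst|exact: smoothM].
have sD : smooth_fun O1 (fun x => end_correction (t x) (f x)).
  apply: smoothD => //; first exact: smooth_cst.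
  apply: smoothM => //; apply: smooth_ln => //; last by move=> z _; exact: end_factor_gt0.
  apply: smoothD => //; apply: smooth_sqrt => //; last by move=> z _; exact: end_radicand.
  by apply: smoothD => //; apply: smoothM.
pose O2 := [set x | O1 x /\ 0 < end_correction (t x) (f x)].
have oO2 : open O2 by exact: smooth_open_gt.
have sO2 : O2 `<=` O1 by move=> z [].
exists O2.
  split => //; split; first by split => //; apply: lt_le_trans fx1.
  rewrite /end_correction flat_le0 ?end_factor0 ?ln1 ?mulr0 ?addr0 //.
  rewrite /sinh_ln invrK pmulr_lle0 ?invr_gt0 // subr_le0.
  by apply: (le_trans _ fx1); rewrite invf_le1 // (lt_le_trans ltr01).
apply: (@smooth_fun_eq _ _ _ (fun x => (exp_arsinh (sinh_ln (f x)^-1 / end_correction (t x) (f x)))^-1)) => //.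
  by move=> z [[_ z0] z1]; rewrite interval_flow_end.
apply: smooth_inv => //; last by move=> z _; rewrite gt_eqF // exp_arsinh_gt0.
apply: smooth_exp_arsinh => //; apply: smoothM => //; first exact: smooth_fun_sub sv.
apply: smooth_inv => //; first exact: smooth_fun_sub sD.
by move=> z [_ z0]; rewrite gt_eqF.
Qed.

(** Inside ]-1, 1[ the flow is a translation conjugated by [Psi]; near [1] and
    beyond it is given by [interval_flow_end]; near [-1] one uses the symmetry
    [interval_flowN]. *)
Lemma smooth_interval_flow n (O : set 'rV[R]_n) (t f : 'rV[R]_n -> R) : open O ->
  smooth_fun O t -> smooth_fun O f -> smooth_fun O (fun x => interval_flow (t x) (f x)).
Proof.
move=> oO st sf; apply: smooth_fun_loc => x Ox.
have [fx1|fx1] := ltP `|f x| 1.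
  pose O1 := [set x | [set x | O x /\ -1 < f x] x /\ f x < 1].
  have oO0 : open [set x | O x /\ -1 < f x] by exact: smooth_open_gt.
  have oO1 : open O1.
    by apply: smooth_open_lt => //; apply: smooth_fun_sub sf => z [].
  have sO1 : O1 `<=` O by move=> z [[]].
  have f1 z : O1 z -> `|f z| < 1 by move=> [[_ z1] z2]; rewrite ltr_norml z1.
  exists O1; first by move: fx1; rewrite ltr_norml => /andP[].
  apply: (@smooth_fun_eq _ _ _ (fun x => Phi (Psi (f x) + t x))) => //.
    by move=> z Oz; rewrite /interval_flow f1.
  apply: smooth_Phi => //; apply: smoothD => //; last exact: smooth_fun_sub st.
  by apply: smooth_Psi => //; exact: smooth_fun_sub sf.
have [f0|f0] := leP 0 (f x).
  rewrite ger0_norm // in fx1.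
  by have [V [_ Vx] sV] := smooth_interval_flow_end oO st sf Ox fx1; exists V.
rewrite ltr0_norm // in fx1.
have [V [oV Vx] sV] := smooth_interval_flow_end oO (smoothN oO st) (smoothN oO sf) Ox fx1.
exists V => //; apply: smooth_fun_eq (smoothN oV sV) => // z _.
by rewrite interval_flowN !opprK.
Qed.

End Flow1.

(** * Bump functions and extension of smooth functions *)
Section Bump.
Context {R : realType}.

(** A smooth transition from [0] to [1]: the denominator does not vanish because
    [s] or [1 - s] is positive. *)
Definition step (s : R) : R := flat s / (flat s + flat (1 - s)).

Lemma step_den (s : R) : 0 < flat s + flat (1 - s).
Proof.
have [s0|s0] := ltP 0 s; first by rewrite ltr_pwDl ?flat_gt0 ?flat_ge0.
by rewrite ltr_wpDl ?flat_ge0 // flat_gt0 // subr_gt0 (le_lt_trans s0).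
Qed.

Lemma step0 s : s <= 0 -> step s = 0.
Proof. by move=> s0; rewrite /step (flat_le0 s0) mul0r. Qed.

Lemma step1 s : 1 <= s -> step s = 1.
Proof.
move=> s1; rewrite /step (@flat_le0 _ (1 - s)) ?subr_le0 // addr0 mulfV //.
by rewrite gt_eqF // flat_gt0 // (lt_le_trans ltr01).
Qed.

Lemma smooth_step n (O : set 'rV[R]_n) (f : 'rV[R]_n -> R) : open O ->
  smooth_fun O f -> smooth_fun O (fun x => step (f x)).
Proof.
move=> oO sf; apply: smoothM => //; first exact: smooth_flat.
apply: smooth_inv => //; last by move=> x _; rewrite gt_eqF // step_den.
apply: smoothD => //; first exact: smooth_flat.
by apply: smooth_flat => //; apply: smoothB => //; exact: smooth_cst.
Qed.

Lemma smooth_sqdist n (O : set 'rV[R]_n) (P : pred 'I_n) (p : 'rV[R]_n) : open O ->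
  smooth_fun O (fun v => \sum_(j | P j) (v 0 j - p 0 j) ^+ 2).
Proof.
move=> oO; apply: smooth_sum => // j _.
have s1 : smooth_fun O (fun v => v 0 j - p 0 j).
  by apply: smoothB => //; [exact: smooth_coord|exact: smooth_cst].
exact: smoothM.
Qed.

Lemma bump_fun n (p : 'rV[R]_n) (O : set 'rV[R]_n) : nbhs p O ->
  exists rho C, [/\ smooth_fun setT rho, \forall v \near p, rho v = 1,
    closed C, C `<=` O & forall v, ~ C v -> rho v = 0].
Proof.
move=> /nbhs_rVP[e e0 eO].
pose r := (e / 2) ^+ 2; have r0 : 0 < r by rewrite exprn_gt0 // divr_gt0.
(* the Euclidean distance is used because the norm of row vectors, a maximum,
   is not smooth *)
pose q (v : 'rV[R]_n) := \sum_j (v 0 j - p 0 j) ^+ 2.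
have sq : smooth_fun setT q by apply: smooth_sqdist; exact: openT.
have cq : continuous q by move=> v; exact: (smooth_cont sq).
exists (fun v => step (2 - q v / r)), [set v | q v <= 2 * r]; split.
- apply: smooth_step; first exact: openT.
  apply: smoothB; [exact: openT|exact: smooth_cst|].
  by apply: smoothM; [exact: openT|exact: sq|exact: smooth_cst].
- have qp : q p < r by rewrite /q big1 // => j _; rewrite subrr expr0n.
  have qr : \forall v \near p, q v < r := cq p _ (lt_nbhsl qp).
  apply: filterS qr => v qv.
  rewrite step1 // lerBrDr -lerBrDl (_ : 2 - 1 = 1); last by ring.
  by rewrite ler_pdivrMr // mul1r ltW.
- have -> : [set v | q v <= 2 * r] = ~` [set v | setT v /\ 2 * r < q v].
    by apply/seteqP; split=> v /=; [move=> ? [_]; rewrite ltNge => /negP|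
      move=> /not_andP[//|/negP]; rewrite -leNgt].
  by apply: open_closedC; apply: smooth_open_gt => //; exact: openT.
- move=> v /= qv; apply: eO => j.
  have : (v 0 j - p 0 j) ^+ 2 < e ^+ 2.
    apply: le_lt_trans (_ : 2 * r < _).
      apply: le_trans qv; rewrite /q (bigD1 j) //= lerDl.
      by apply: sumr_ge0 => i _; rewrite sqr_ge0.
    have -> : 2 * r = e ^+ 2 / 2 by rewrite /r; field.
    by rewrite ltr_pdivrMr // ltr_pMr ?exprn_gt0 // ltr1n.
  by rewrite -(real_normK (num_real (_ - _))) ltr_pXn2r // ?nnegrE // ltW.
- move=> v /= /negP; rewrite -ltNge => qv; rewrite step0 // subr_le0.
  by rewrite ler_pdivlMr // ltW.
Qed.

(** [rho] vanishes off a closed subset of [O], so that the product is smooth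
    also at the boundary of [V], where [f] need not be. *)
Lemma smooth_cutoff n (O : set 'rV[R]_n) (p : 'rV[R]_n) :
  nbhs p O -> exists2 rho : 'rV[R]_n -> R,
    (\forall v \near p, rho v = 1) /\ (forall v, ~ O v -> rho v = 0) &
    forall f V, open V -> O `<=` V -> smooth_fun V f ->
      smooth_fun setT (fun v => rho v * f v).
Proof.
move=> pO; have [rho [C [srho rho1 cC CO rho0]]] := bump_fun pO.
exists rho; first by split=> // v nOv; apply: rho0 => /CO.
move=> f V oV OV sf.
apply: smooth_fun_loc => v _; have [Cv|nCv] := pselect (C v).
  exists V; first exact/OV/CO.
  by apply: smoothM => //; exact: smooth_fun_sub srho.
exists (~` C) => //; have oC : open (~` C) by rewrite openC.
apply: (@smooth_fun_eq _ _ _ (fun=> 0)) => //; last exact: smooth_cst.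
by move=> x Cx; rewrite rho0 // mul0r.
Qed.

Lemma smooth_extend n (O : set 'rV[R]_n) (f : 'rV[R]_n -> R) p :
  open O -> smooth_fun O f -> O p ->
  exists2 g, smooth_fun setT g & \forall v \near p, g v = f v.
Proof.
move=> oO sf Op.
have [rho [rho1 rho0] H] := smooth_cutoff (open_nbhs_nbhs (conj oO Op)).
exists (fun v => rho v * f v); first exact: H sf.
by apply: filterS rho1 => v ->; rewrite mul1r.
Qed.

Lemma smooth1_line n (G : 'rV[R]_n -> R) (x : 'rV[R]_n) (i : 'I_n) :
  smooth_fun setT G -> smooth1 (fun s : R => G (s *: delta_mx 0 i + x)).
Proof.
move=> sG k.
suff [F sF ->] : exists2 F, smooth_fun setT F &
  derive1n k (fun s : R => G (s *: delta_mx 0 i + x)) =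
     fun s : R => F (s *: delta_mx 0 i + x).
  move=> t; have [E1 _] := derivable_line_at F x (delta_mx 0 i) t.
  exact: (E1.1 (smooth_derivable sF I)).
elim: k => [|k [F sF E]]; first by exists G.
exists (fun v => 'D_(delta_mx 0 i) F v); first exact: smooth_derive.
rewrite derive1nS E; apply/funext => t; rewrite derive1E.
by have [_ ->] := derivable_line_at F x (delta_mx 0 i) t.
Qed.

(** Compare [u] with its projection to the plane where the coordinates in [P]
    vanish. By [increment] the difference of the values of [G], which is [G u],
    is a sum of partial derivatives, bounded near [u0], times the coordinates of
    [u] in [P]. *)
Lemma vanish_lipschitz n (P : pred 'I_n) (O : set 'rV[R]_n) (G : 'rV[R]_n -> R) u0 :
  open O -> smooth_fun O G -> O u0 -> (forall l, P l -> u0 0 l = 0) ->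
  (forall u, O u -> (forall l, P l -> u 0 l = 0) -> G u = 0) ->
  exists2 e : R, 0 < e & exists2 K : R, 0 <= K &
    forall u : 'rV[R]_n, (forall j, `|u 0 j - u0 0 j| < e) ->
    `|G u| <= K * \sum_(l | P l) `|u 0 l|.
Proof.
move=> oO sG Ou0 u00 G0.
have Kj (j : 'I_n) : \forall u \near u0, `|'D_(delta_mx 0 j) G u| <= `|'D_(delta_mx 0 j) G u0| + 1.
  have c : {for u0, continuous (fun u => 'D_(delta_mx 0 j) G u)}.
    exact: smooth_cont (smooth_derive j sG) Ou0.
  have /cvgr_dist_le/(_ _ ltr01) := c; apply: filterS => u; rewrite distrC => H.
  by rewrite -lerBlDl; apply: le_trans H; exact: lerB_dist.
have : \forall u \near u0, O u /\ forall j, `|'D_(delta_mx 0 j) G u| <= `|'D_(delta_mx 0 j) G u0| + 1.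
  apply: filterI; first exact: open_nbhs_nbhs.
  exact: (@filter_forall _ 'I_n (fun j u => `|'D_(delta_mx 0 j) G u| <=
     `|'D_(delta_mx 0 j) G u0| + 1) (nbhs u0) _ Kj).
move=> /nbhs_rVP[e e0 eH]; exists e => //.
exists (\sum_j (`|'D_(delta_mx 0 j) G u0| + 1)); first by apply: sumr_ge0 => j _; rewrite addr_ge0.
move=> u ue; pose z : 'rV[R]_n := \row_l (if P l then 0 else u 0 l).
have zbox xi : in_box z u xi -> forall j, `|xi 0 j - u0 0 j| < e.
  move=> xib j; have := xib j; have := ue j; rewrite mxE; case: ifP => Pj.
    by rewrite u00 // !subr0 => ? /le_lt_trans; apply.
  by rewrite subrr normr0 normr_le0 subr_eq0 => + /eqP ->.
have [|xi xib E] := @increment _ _ G z u.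
  by move=> xi j xib; have [Ox _] := eH xi (zbox xi xib); exact: smooth_derivable Ox.
have Gz : G z = 0.
  apply: G0 => [|l Pl]; last by rewrite mxE Pl.
  apply: (eH _ _).1; apply: zbox => l; rewrite subrr normr0; exact: normr_ge0.
rewrite Gz subr0 in E; rewrite E; apply: le_trans (ler_norm_sum _ _ _) _.
rewrite mulr_suml; apply: ler_sum => j _; rewrite normrM.
apply: ler_pM => //; first by have [_] := eH _ (zbox _ (xib j)); apply.
rewrite mxE; case: ifP => Pj; last first.
  by rewrite subrr normr0; apply: sumr_ge0.
by rewrite subr0 (bigD1 j) //= lerDl; apply: sumr_ge0.
Qed.

End Bump.
(** * Topological preliminaries *)
Section Topo.

Lemma nbhsI (T : topologicalType) (x : T) (A B : set T) :
  nbhs x A -> nbhs x B -> nbhs x (A `&` B).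
Proof. exact: filterI. Qed.

Lemma nbhs_open (T : topologicalType) (x : T) (A : set T) :
  nbhs x A -> exists2 W, open_nbhs x W & W `<=` A.
Proof. by rewrite nbhsE => -[W]; exists W. Qed.

Lemma filter_finite (T : Type) (F : set_system T) (FF : Filter F) (I : eqType)
    (D : set I) (P : I -> set T) : finite_set D ->
  (forall i, D i -> F (P i)) -> F [set x | forall i, D i -> P i x].
Proof.
move=> /finite_seqP[s ->]; elim: s => [|i s IH] H.
  by apply: filterS filterT => x _ i.
have Pi : F (P i) by apply: H; rewrite /= inE eqxx.
have Ps : F [set x | forall j, j \in s -> P j x].
  by apply: IH => j js; apply: H; rewrite /= inE js orbT.
by apply: filterS2 Pi Ps => x Pix Psx j /=; rewrite inE => /orP[/eqP ->|/Psx].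
Qed.

(** Cover the space by the open sets that are contained in [V] or disjoint from
    some neighbourhood of [x]; by the Hausdorff property this is a cover. In a
    locally finite refinement, the union of the members that are not contained
    in [V] is open, misses a neighbourhood of [x], since only finitely many of
    them come near [x], and has its complement contained in [V]. *)
Lemma paracompact_regular (T : topologicalType) (x : T) (V : set T) :
  hausdorff_space T -> paracompact T -> nbhs x V ->
  exists N, [/\ closed N, nbhs x N & N `<=` V].
Proof.
move=> hT pT xV.
pose C := [set A : set T | open A /\ (A `<=` V \/ exists B, [/\ open B, B x & A `&` B = set0])].
have [] := pT C.
- by move=> A [].
- apply/seteqP; split=> // y _.
  have [->|/eqP yx] := pselect (y = x).
    move: xV; rewrite nbhsE => -[B [oB Bx] BV].
    by exists B => //; split => //; left.
  move: hT; rewrite open_hausdorff => /(_ y x yx)[[A B] /= [yA xB] [oA oB /eqP AB]].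
  exists A; last by rewrite inE in yA.
  by split => //; right; exists B; rewrite inE in xB.
move=> C' [oC' covC' refC' lfC'].
pose W := \bigcup_(A in [set A | C' A /\ ~ (A `<=` V)]) A.
exists (~` W); split.
- by apply: open_closedC; apply: bigcup_open => A [/oC'].
- have [V0 V0x fin] := lfC' x.
  have := @filter_finite T (nbhs x) _ _ _ (fun A y => ~ (A `<=` V) -> ~ A y) fin.
  move=> H; have {}H : nbhs x [set y | forall A, C' A /\ id A `&` V0 !=set0 -> ~ A `<=` V -> ~ A y].
    apply: H => A [C'A _].
    have [B [oB]] := refC' A C'A.
    move=> [BV|[D [oD Dx BD0]]] AB.
      by apply: nearW => y nAV; exfalso; apply: nAV; exact: subset_trans BV.
    apply: filterS (open_nbhs_nbhs (conj oD Dx)) => y Dy _ Ay.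
    have : (B `&` D) y by split => //; exact: AB.
    by rewrite BD0.
  apply: filterS (filterI V0x H) => y [V0y Hy] [A [C'A nAV] Ay].
  by apply: (Hy A _ nAV Ay); split => //; exists y.
- move=> y nWy; have : cover C' id y by rewrite covC'.
  move=> [A C'A Ay]; have [AV|nAV] := pselect (A `<=` V); first exact: AV.
  by exfalso; apply: nWy; exists A.
Qed.

Section Homeo.
Variables (T T' : topologicalType) (D : set T) (f : T -> T').

Lemma within_contP : {within D, continuous f} <->
  forall x W, D x -> nbhs (f x) W -> \forall y \near x, D y -> W (f y).
Proof.
rewrite subspace_continuousP; split=> H x; [move=> W Dx fW|move=> Dx W fW].
  by have := H x Dx W fW; rewrite /= nbhs_simpl /= /within.
by rewrite /= nbhs_simpl /within /=; exact: H.
Qed.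

Lemma homeo_open_cont x : homeo_onto_image D f -> open D -> D x -> {for x, continuous f}.
Proof.
move=> [/within_contP cf _ _] oD Dx W fW.
by apply: filterS2 (open_nbhs_nbhs (conj oD Dx)) (cf x W Dx fW) => y Dy; apply.
Qed.

Lemma homeo_nbhs x V : homeo_onto_image D f -> D x -> nbhs x V ->
  exists2 W, open_nbhs (f x) W & forall y, D y -> W (f y) -> V y.
Proof.
move=> [_ fI fo] Dx; rewrite nbhsE => -[V' [oV' V'x] V'V].
have [W oW fW] := fo V' oV'; exists W.
  split => //; have : (f @` (D `&` V')) (f x) by exists x.
  by rewrite fW => -[].
move=> y Dy Wy; have : (W `&` f @` D) (f y) by split => //; exists y.
rewrite -fW => -[z [Dz V'z] fzy]; apply: V'V.
by rewrite -(fI z y) // inE.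
Qed.

(** The criterion by neighbourhoods is easier to check for restrictions and
    products of charts than the one by open images. *)
Lemma homeo_intro :
  (forall x W, D x -> nbhs (f x) W -> \forall y \near x, D y -> W (f y)) ->
  (forall x y, D x -> D y -> f x = f y -> x = y) ->
  (forall x V, D x -> nbhs x V ->
     exists2 W, open_nbhs (f x) W & forall y, D y -> W (f y) -> V y) ->
  homeo_onto_image D f.
Proof.
move=> cf fI fo; split; first exact/within_contP.
  by move=> x y; rewrite !inE; exact: fI.
move=> V oV.
exists (\bigcup_(W in [set W | open W /\ forall y, D y -> W (f y) -> V y]) W).
  by apply: bigcup_open => W [].
apply/seteqP; split=> [_ [x [Dx Vx] <-]|].
  split; last by exists x.
  have [W [oW Wx] WV] := fo x V Dx (open_nbhs_nbhs (conj oV Vx)).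
  by exists W.
move=> z [[W [oW WV] Wz] [x Dx xz]]; exists x => //; split => //.
by apply: WV => //; rewrite xz.
Qed.

End Homeo.
End Topo.

(** * Compatible charts and germs of smooth functions *)
Section Pad.
Context {R : realType}.

Lemma pad_lt n N (v : 'rV[R]_n) (j : 'I_N) (jn : (j < n)%N) :
  pad N v 0 j = v 0 (Ordinal jn).
Proof. by rewrite mxE insubT. Qed.

Lemma pad_ge n N (v : 'rV[R]_n) (j : 'I_N) : (n <= j)%N -> pad N v 0 j = 0.
Proof. by move=> jn; rewrite mxE insubF // ltnNge jn. Qed.

Lemma pad_id n (v : 'rV[R]_n) : pad n v = v.
Proof. by apply/rowP => j; rewrite pad_lt; congr (v 0 _); exact: val_inj. Qed.

Lemma padK n N (v : 'rV[R]_n) : (n <= N)%N -> pad n (pad N v) = v.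
Proof.
move=> nN; apply/rowP => j.
have jN : (j < N)%N by exact: leq_trans nN.
rewrite (pad_lt (pad N v) jN) (pad_lt v (ltn_ord j : Ordinal jN < n)%N).
by congr (v 0 _); exact: val_inj.
Qed.

Lemma pad_pad n N (u : 'rV[R]_N) :
  (forall l : 'I_N, (n <= l)%N -> u 0 l = 0) -> pad N (pad n u) = u.
Proof.
move=> u0; apply/rowP => j; have [nj|jn] := leqP n j; first by rewrite pad_ge // u0.
rewrite (pad_lt (pad n u) jn) (pad_lt u (ltn_ord j : Ordinal jn < N)%N).
by congr (u 0 _); exact: val_inj.
Qed.

Lemma smooth_pad n N (O : set 'rV[R]_n) : smooth_on O (@pad R n N).
Proof.
move=> j; have [nj|jn] := leqP n j.
  have -> : (fun x : 'rV[R]_n => pad N x 0 j) = fun=> 0.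
    by apply/funext => x; rewrite pad_ge.
  exact: smooth_cst.
have -> : (fun x : 'rV[R]_n => pad N x 0 j) = fun x => x 0 (Ordinal jn).
  by apply/funext => x; rewrite (pad_lt _ jn).
exact: smooth_coord.
Qed.

Lemma pad_continuous n N : continuous (@pad R n N).
Proof. by move=> x; apply: (smooth_on_cont (@smooth_pad n N setT)). Qed.

End Pad.

Section Compat.
Context {R : realType}.

Lemma diffeo_sym n m (O : set 'rV[R]_n) (O' : set 'rV[R]_m) H : diffeo_on O O' H ->
  exists K, [/\ diffeo_on O' O K, forall x, O x -> O' (H x) /\ K (H x) = x &
        forall y, O' y -> O (K y) /\ H (K y) = y].
Proof. by move=> [oO oO' sH [K [sK HK KH]]]; exists K; split => //; split => //; exists H. Qed.

Lemma compatible_sym (T : topologicalType) n m (c : chart R T n) (c' : chart R T m) :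
  compatible c c' -> compatible c' c.
Proof.
move=> H x c'x cx; have [U Ux [UU [N [V [V' [h [nm dh hU]]]]]]] := H x cx c'x.
exists U => //; split; first by move=> y /UU[].
have [K [dK hK Kh]] := diffeo_sym dh.
exists N, V', V, K; split => //; first by rewrite maxnC.
move=> y Uy; have [Vy V'y hy] := hU y Uy; split => //.
by rewrite -hy; have [] := hK _ Vy.
Qed.

(** Compatibility compares the two charts in a larger R^N. A function of the
    first chart is read in the second one by padding, applying the comparison
    diffeomorphism, and forgetting the coordinates that were added. *)
Lemma compatible_transfer (T : topologicalType) n m (c : chart R T n)
    (c' : chart R T m) x (O : set 'rV[R]_n) (g : 'rV[R]_n -> R) :
  compatible c c' -> cdom c x -> cdom c' x -> {for x, continuous (cmap c')} ->
  open O -> smooth_fun O g -> O (cmap c x) ->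
  exists2 g', smooth_fun setT g' &
    \forall y \near x, cdom c' y /\ g (cmap c y) = g' (cmap c' y).
Proof.
move=> cc cx c'x cc' oO sg Ocx.
have [U [oU Ux] [UU [N [VH [VH' [h [nm dh hU]]]]]]] := cc x cx c'x.
have nN : (n <= N)%N by apply: leq_trans nm; exact: leq_maxl.
have mN : (m <= N)%N by apply: leq_trans nm; exact: leq_maxr.
have [K [[oVH' oVH sK _] hK Kh]] := diffeo_sym dh.
pose O1 := setT `&` @pad R m N @^-1` VH'.
have oO1 : open O1.
  by apply: open_preim => //; [exact: openT|move=> v _; exact: pad_continuous].
pose k := fun v : 'rV[R]_m => pad n (K (pad N v)).
have sk : smooth_on O1 k.
  apply: (@smooth_on_comp _ _ _ _ O1 VH (K \o @pad R m N)) => //.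
  - apply: (@smooth_on_comp _ _ _ _ O1 VH') => //; first exact: smooth_pad.
    by move=> v [].
  - by move=> v [_ /Kh []].
  - exact: smooth_pad.
pose O2 := O1 `&` k @^-1` O.
have oO2 : open O2.
  by apply: open_preim => // v O1v; exact: smooth_on_cont sk _ O1v.
have kE y : U y -> O1 (cmap c' y) /\ k (cmap c' y) = cmap c y.
  move=> Uy; have [Vy V'y hy] := hU y Uy; split => //.
  rewrite /k -hy; have [_ ->] := hK _ Vy; exact: padK.
have sg' : smooth_fun O2 (g \o k).
  apply: smooth_comp sg => //; first by apply: smooth_on_sub sk => v [].
  by move=> v [].
have [Wx kx] := kE x Ux.
have O2x : O2 (cmap c' x) by split => //; rewrite /= kx.
have [g' sg'T g'E] := smooth_extend oO2 sg' O2x.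
exists g' => //.
apply: filterS2 (open_nbhs_nbhs (conj oU Ux)) (cc' _ g'E) => y Uy /= ->.
by have [_ ->] := kE y Uy; split => //; have [] := UU y Uy.
Qed.

End Compat.

Section SmoothAt.
Context {R : realType}.

(** The functions of [Cinf S] are defined by a condition at each point; the
    pointwise notion lets one work with functions that are smooth in a
    neighbourhood only, such as the coordinates of a chart. *)
Definition smooth_at (S : smooth_stratified R) (u : S -> R) (x : S) : Prop :=
  {for x, continuous u} /\
  forall n (c : chart R S n), charts S n c -> cdom c x ->
    exists2 g, smooth_fun setT g & \forall y \near x, cdom c y /\ u y = g (cmap c y).

Lemma CinfP (S : smooth_stratified R) (u : S -> R) :
  Cinf S u <-> forall x, smooth_at u x.
Proof.
split=> [[cu su] x|H].
  split=> [|n c Cc cx]; first exact: cu.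
  have [V Vx [Vc [g sg ug]]] := su x n c Cc cx.
  by exists g => //; apply: filterS Vx => y Vy; split; [exact: Vc|exact: ug].
split=> [x|x n c Cc cx]; first by have [] := H x.
have [_ /(_ n c Cc cx)[g sg ug]] := H x.
exists [set y | cdom c y /\ u y = g (cmap c y)] => //; split; first by move=> y [].
by exists g => // y [].
Qed.

Lemma smooth_at_eq (S : smooth_stratified R) (u w : S -> R) x :
  (\forall y \near x, u y = w y) -> smooth_at u x -> smooth_at w x.
Proof.
move=> uw [cu su]; split.
  have uwx : u x = w x by exact: nbhs_singleton uw.
  have : u @ x --> w x by rewrite -uwx; exact: cu.
  by move=> H; apply: cvg_trans H; exact: near_eq_cvg uw.
move=> n c Cc cx; have [g sg ug] := su n c Cc cx; exists g => //.
by apply: filterS2 uw ug => y <-.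
Qed.

(** The axiom of a smooth structure on which the calculus of germs relies. It
    is isolated here because the products of an open subset of a stratum with a
    fibre satisfy it by construction of their charts. *)
Definition charts_smooth (S : smooth_stratified R) : Prop :=
  forall n (c : chart R S n), charts S n c -> smooth_chart c.

Lemma smooth_structure_charts (S : smooth_stratified R) :
  smooth_stratified_space S -> charts_smooth S.
Proof. by move=> [_ [H _ _ _]] n c; exact: H. Qed.

Lemma smooth_chart_cont (S : stratified R) n (c : chart R S n) x :
  smooth_chart c -> cdom c x -> {for x, continuous (cmap c)}.
Proof. by move=> [oc hc _] cx; exact: homeo_open_cont hc oc cx. Qed.

(** Charts need not have open images, so [h] is first represented in a chart
    by a map [G] defined on all of R^n, and [F \o G] is then extended from the
    open set where it makes sense. *)
Lemma smooth_at_comp (S : smooth_stratified R) k (h : S -> 'rV[R]_k)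
    (O : set 'rV[R]_k) (F : 'rV[R]_k -> R) (u : S -> R) x : charts_smooth S ->
  (forall j, smooth_at (fun y => h y 0 j) x) -> open O -> smooth_fun O F -> O (h x) ->
  (\forall y \near x, u y = F (h y)) -> smooth_at u x.
Proof.
move=> gS sh oO sF Ohx uF; apply: (@smooth_at_eq _ (F \o h)).
  by apply: filterS uF => y ->.
have ch : {for x, continuous h} by apply/continuous_rVP => j; have [] := sh j.
split=> [|n c Cc cx].
  by apply: continuous_comp ch _; exact: smooth_cont sF Ohx.
have cc : {for x, continuous (cmap c)} by apply: smooth_chart_cont cx; exact: gS.
have oc : open (cdom c) by have [] := gS _ _ Cc.
have [g Hg] := choice (fun j => let: ex_intro2 g a b := (sh j).2 n c Cc cx in
  ex_intro (fun g => smooth_fun setT g /\ \forall y \near x, cdom c y /\ h y 0 j = g (cmap c y))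
   g (conj a b)).
pose G (v : 'rV[R]_n) : 'rV[R]_k := \row_j g j v.
have sG : smooth_on setT G.
  move=> j; have -> : (fun v => G v 0 j) = g j by apply/funext => v; rewrite mxE.
  by have [] := Hg j.
have hG : \forall y \near x, h y = G (cmap c y).
  suff : \forall y \near x, forall j, cdom c y /\ h y 0 j = g j (cmap c y).
    by apply: filterS => y H; apply/rowP => j; rewrite mxE; have [] := H j.
  apply: (@filter_forall _ 'I_k (fun j y => cdom c y /\ h y 0 j = g j (cmap c y)) (nbhs x)).
  by move=> j; have [] := Hg j.
pose O1 := setT `&` G @^-1` O.
have oO1 : open O1.
  by apply: open_preim => //; [exact: openT|move=> v _; exact: (smooth_on_cont sG)].
have [f sf fE] := @smooth_extend _ _ O1 (F \o G) (cmap c x) oO1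
   (smooth_comp oO1 oO (smooth_on_sub (@subsetT _ O1) sG) (fun v => @proj2 _ _) sF)
   (conj I (eq_ind _ (fun v => O v) Ohx _ (nbhs_singleton hG))).
exists f => //.
apply: filterS2 (filterI (open_nbhs_nbhs (conj oc cx)) hG) (cc _ fE) => y [cy hy] /= fy.
by rewrite fy /= hy.
Qed.

(** The germ is transferred from [c0] to any other chart by
    [compatible_transfer]; so [c0] may be any chart that is compatible with the
    atlas, for instance a product of charts. *)
Lemma smooth_at_chart (S : smooth_stratified R) n (c0 : chart R S n) x
    (O : set 'rV[R]_n) (g : 'rV[R]_n -> R) u : charts_smooth S ->
  (forall m c, charts S m c -> compatible c0 c) ->
  cdom c0 x -> {for x, continuous (cmap c0)} ->
  open O -> smooth_fun O g -> O (cmap c0 x) ->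
  (\forall y \near x, u y = g (cmap c0 y)) -> smooth_at u x.
Proof.
move=> gS comp0 c0x cc0 oO sg Ox ug; apply: (@smooth_at_eq _ (g \o cmap c0)).
  by apply: filterS ug => y ->.
split=> [|m c Cc cx].
  by apply: continuous_comp cc0 _; exact: smooth_cont sg Ox.
have cc : {for x, continuous (cmap c)} by apply: smooth_chart_cont cx; exact: gS.
exact: compatible_transfer (comp0 _ _ Cc) c0x cx cc oO sg Ox.
Qed.

Lemma smooth_at_cst (S : smooth_stratified R) (a : R) (x : S) : charts_smooth S ->
  smooth_at (fun=> a) x.
Proof.
move=> gS; apply: (@smooth_at_comp S 0 (fun=> 0) setT (fun=> a)) => //.
- by move=> [].
- exact: openT.
- exact: smooth_cst.
- exact: nearW.
Qed.

Definition row2 (a b : R) : 'rV[R]_2 := \row_j (if j == 0 then a else b).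

Lemma row20 a b : row2 a b 0 0 = a. Proof. by rewrite mxE. Qed.
Lemma row21 a b : row2 a b 0 1 = b. Proof. by rewrite mxE. Qed.

Lemma smooth_atM (S : smooth_stratified R) (u w : S -> R) x : charts_smooth S ->
  smooth_at u x -> smooth_at w x -> smooth_at (fun y => u y * w y) x.
Proof.
move=> gS su sw.
apply: (@smooth_at_comp S 2 (fun y => row2 (u y) (w y)) setT (fun v => v 0 0 * v 0 1)) => //.
- by move=> j; under eq_fun do rewrite mxE; case: (j == 0).
- exact: openT.
- by apply: smoothM; [exact: openT|exact: smooth_coord|exact: smooth_coord].
- by apply: nearW => y; rewrite row20 row21.
Qed.

Section Bumps.
Variable S : smooth_stratified R.
Hypothesis hS : smooth_stratified_space S.

Let gS := smooth_structure_charts hS.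

Lemma chart_compatible n m (c : chart R S n) (c' : chart R S m) :
  charts S n c -> charts S m c' -> compatible c c'.
Proof. by case: hS => _ [_ _ H _]; exact: H. Qed.

Lemma exists_chart (x : S) : exists n, exists2 c : chart R S n, charts S n c & cdom c x.
Proof. by case: hS => _ [_ H _ _]. Qed.

Lemma space_regular (x : S) V : nbhs x V -> exists N, [/\ closed N, nbhs x N & N `<=` V].
Proof. by case: hS => [[hh _ pp _] _]; exact: paracompact_regular. Qed.

Definition ext0 n (c : chart R S n) (g : 'rV[R]_n -> R) : S -> R :=
  fun y => if pselect (cdom c y) then g (cmap c y) else 0.

Lemma ext0E n (c : chart R S n) g y : cdom c y -> ext0 c g y = g (cmap c y).
Proof. by move=> cy; rewrite /ext0; case: pselect. Qed.

(** The support of [ext0 c g] must be closed in the whole space, and not only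
    in the domain of the chart, for the extension by [0] to be smooth; this is
    where the regularity of the space is used. The set [W] is chosen so that [W]
    pulls back into a closed neighbourhood [N] contained in the domain. *)
Lemma ext0_smooth n (c : chart R S n) x V : charts S n c -> cdom c x -> nbhs x V ->
  exists W N, [/\ nbhs (cmap c x) W, closed N, N `<=` V &
   forall g, smooth_fun setT g -> (forall v, ~ W v -> g v = 0) ->
     Cinf S (ext0 c g) /\ forall y, ~ N y -> ext0 c g y = 0].
Proof.
move=> Cc cx Vx; have [oc hc _] := gS Cc.
have [N [cN Nx NV]] := space_regular (filterI Vx (open_nbhs_nbhs (conj oc cx))).
have [W Wx WN] := homeo_nbhs hc cx Nx.
exists W, N; split=> //; first exact: open_nbhs_nbhs.
  by move=> y /NV[].
move=> g sg gW.
have gN y : ~ N y -> ext0 c g y = 0.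
  move=> nNy; rewrite /ext0; case: pselect => // cy; apply: gW => Wy.
  by apply: nNy; exact: WN.
split=> //; apply/CinfP => y.
have [cy|ncy] := pselect (cdom c y); last first.
  apply: (@smooth_at_eq _ (fun=> 0)); last exact: smooth_at_cst.
  have nNy : (~` N) y by move=> /NV[].
  have oN : open (~` N) by rewrite openC.
  by apply: filterS (open_nbhs_nbhs (conj oN nNy)) => z /gN ->.
apply: (@smooth_at_chart _ _ c _ setT g) => //.
- by move=> m c' Cc'; exact: chart_compatible.
- exact: homeo_open_cont hc oc cy.
- exact: openT.
- by apply: filterS (open_nbhs_nbhs (conj oc cy)) => z cz; rewrite ext0E.
Qed.

Lemma smooth_bump (x : S) V : nbhs x V -> exists chi N, [/\ Cinf S chi,
  \forall y \near x, chi y = 1, closed N, N `<=` V & forall y, ~ N y -> chi y = 0].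
Proof.
move=> Vx; have [n [c Cc cx]] := exists_chart x.
have [oc hc _] := gS Cc.
have [W [N [Wx cN NV H]]] := ext0_smooth Cc cx Vx.
have [rho [C [srho rho1 cC CW rho0]]] := bump_fun Wx.
have [|CS S0] := H rho srho; first by move=> v nWv; apply: rho0 => /CW.
exists (ext0 c rho), N; split=> //.
apply: filterS2 (open_nbhs_nbhs (conj oc cx)) (homeo_open_cont hc oc cx rho1) => y cy /= <-.
by rewrite ext0E.
Qed.

(** A neighbourhood of [f t] contains the points where some bump function is
    positive. *)
Lemma continuous_Cinf (T : topologicalType) (f : T -> S) (t : T) :
  (forall u, Cinf S u -> {for t, continuous (u \o f)}) -> {for t, continuous f}.
Proof.
move=> H V Vf; have [chi [N [Cchi chi1 cN NV chi0]]] := smooth_bump Vf.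
have c1 : chi (f t) = 1 by exact: nbhs_singleton chi1.
have : \forall s \near t, 0 < (chi \o f) s.
  have p0 : 0 < (chi \o f) t by rewrite /= c1.
  exact: (H chi Cchi _ (lt_nbhsr p0)).
apply: filterS => s /= fs; apply: NV; apply: contrapT => /chi0 E.
by rewrite E ltxx in fs.
Qed.

End Bumps.
End SmoothAt.

(** * Strongly stratified fields do not leave strata *)
Section Quotient.
Context {R : realType}.

Lemma shift_nbhs (t : R) (P : set R) : nbhs t P <-> nbhs (0 : R) (fun h => P (h + t)).
Proof.
split=> [tP|].
  have c : (fun h : R => h + t) @ (0 : R) --> 0 + t.
    by apply: cvgD; [exact: cvg_id|exact: cvg_cst].
  by rewrite add0r in c; exact: (c _ tP).
move=> HP; have c : (fun s : R => s - t) @ t --> t - t.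
  by apply: cvgB; [exact: cvg_id|exact: cvg_cst].
rewrite subrr in c.
have cP : nbhs t (fun s => P (s - t + t)) := c _ HP.
apply: filterS cP => s /=.
by rewrite subrK.
Qed.

(** Integral curves are defined through difference quotients within the
    interval of definition; at interior times these are ordinary
    derivatives. *)
Lemma quotient_is_derive (I : set R) (t : R) (f : R -> R) (d : R) : nbhs t I ->
  ((s - t)^-1 * (f s - f t)) @[s --> within [set s | I s /\ s != t] (nbhs t)] --> d <->
  is_derive t 1 f d.
Proof.
move=> tI.
have E : (((s - t)^-1 * (f s - f t)) @[s --> within [set s | I s /\ s != t] (nbhs t)] --> d)
    <-> (h^-1 *: ((f \o shift t) (h *: (1 : R)) - f t) @[h --> 0^'] --> d).
  split=> H P dP.
    have := H P dP; rewrite /= !nbhs_simpl /within /= => H1.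
    have H2 : \forall s \near t, s != t -> P ((s - t)^-1 * (f s - f t)).
      by apply: filterS2 tI H1 => s Is; move=> + st; apply.
    move/shift_nbhs : H2; apply: filterS => h /= Hh h0.
    have := Hh; rewrite addrK [h *: 1]mulr1 -subr_eq0 addrK; exact.
  have H1 : nbhs (0 : R) (fun h => h != 0 ->
     P (h^-1 *: ((f \o shift t) (h *: (1 : R)) - f t))) := H P dP.
  have : \forall s \near t, s != t -> P ((s - t)^-1 * (f s - f t)).
    apply/shift_nbhs; apply: filterS H1 => h /= Hh.
    rewrite addrK -subr_eq0 addrK => h0; have := Hh h0.
    by rewrite [h *: 1]mulr1.
  by apply: filterS => s Hs [_ st]; exact: Hs.
rewrite E; split=> [H|[/cvg_ex[l Hl] Dl]].
  by split; [apply/cvg_ex; eexists; exact: H|exact: cvg_lim H].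
by rewrite -Dl /derive (cvg_lim _ Hl).
Qed.

(** The function [w t * expR (- L * t)] is nonincreasing and
    [w t * expR (L * t)] is nondecreasing, so that a zero at one end of the
    interval forces a zero at the other end. The mean value theorem for
    [w t * expR (sg * t)], with [sg] equal to [- L] or [L], yields both. *)
Lemma gronwall (w dw : R -> R) (a b L : R) : a < b ->
  (forall x : R, a < x < b -> is_derive x 1 w (dw x)) ->
  {within `[a, b], continuous w} -> (forall x : R, a <= x <= b -> 0 <= w x) ->
  (forall x : R, a < x < b -> `|dw x| <= L * w x) ->
  (w a = 0 -> w b = 0) /\ (w b = 0 -> w a = 0).
Proof.
move=> ab Dw cw w0 wL.
have K sg : exists2 c : R, a < c < b &
    w b * expR (b * sg + 0) - w a * expR (a * sg + 0) =
    (dw c + sg * w c) * expR (c * sg + 0) * (b - a).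
  pose v := w * (fun x => expR (x * sg + 0)).
  have Dv (x : R) : x \in `]a, b[ ->
      is_derive x 1 v ((dw x + sg * w x) * expR (x * sg + 0)).
    rewrite in_itv /= => xab; have D1 := Dw x xab.
    have D2 := @is_derive1_comp R expR _ x _ _ (is_derive_expR _) (is_derive_affine sg 0 x).
    apply: (is_derive_eq (is_deriveM D1 D2)); rewrite /GRing.scale /=; ring.
  have cE : continuous (fun x : R => expR (x * sg + 0)).
    move=> x; apply: (@continuous_comp _ _ _ (fun x : R => x * sg + 0) expR).
      have [d _] := is_derive_affine sg 0 x.
      by apply: differentiable_continuous; apply/derivable1_diffP.
    exact: continuous_expR.
  have cv : {within `[a, b], continuous v}.
    by move=> x; apply: continuousM; [exact: cw|exact: continuous_subspaceT].
  have [c] := @MVT R v _ a b ab Dv cv.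
  by rewrite in_itv /= => cab E; exists c.
have ba : 0 < b - a by rewrite subr_gt0.
split=> [wa|wb].
  have [c cab E] := K (- L).
  have wb0 : 0 <= w b by apply: w0; rewrite lexx ltW.
  apply/eqP; rewrite eq_le wb0 andbT.
  rewrite -(pmulr_lle0 _ (expR_gt0 (b * - L + 0))).
  move: E; rewrite wa mul0r subr0 => ->.
  rewrite (pmulr_lle0 _ ba) (pmulr_lle0 _ (expR_gt0 _)) mulNr subr_le0.
  by apply: le_trans (wL c cab); exact: ler_norm.
have [c cab E] := K L.
have wa0 : 0 <= w a by apply: w0; rewrite lexx ltW.
apply/eqP; rewrite eq_le wa0 andbT.
rewrite -(pmulr_lle0 _ (expR_gt0 (a * L + 0))) -oppr_ge0.
move: E; rewrite wb mul0r sub0r => ->.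
rewrite (pmulr_lge0 _ ba) (pmulr_lge0 _ (expR_gt0 _)) -lerBlDr sub0r lerNl.
by apply: le_trans (wL c cab); rewrite -normrN ler_norm.
Qed.

End Quotient.

Section StrataInvariant.
Context {R : realType}.

(** The slice chart of the image of a stratum, together with the inverse of
    the straightening diffeomorphism: the points of the stratum are those whose
    straightened coordinates of index [d] and more vanish. *)
Lemma slice_data (S : stratified R) n (c : chart R S n) (i : sindex S) (x : S) :
  smooth_chart c -> cdom c x -> stratum i x ->
  exists d O O' (h K : 'rV[R]_n -> 'rV[R]_n),
  [/\ [/\ (d <= n)%N, open O, open O', smooth_on O h & smooth_on O' K],
      forall v, O v -> O' (h v) /\ K (h v) = v,
      forall v, O' v -> O (K v) /\ h (K v) = v,
      O (cmap c x) &
      (forall y, cdom c y -> stratum i y -> O (cmap c y) ->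
         forall l : 'I_n, (d <= l)%N -> h (cmap c y) 0 l = 0) /\
      (forall v, O v -> (forall l : 'I_n, (d <= l)%N -> h v 0 l = 0) ->
         exists y, [/\ cdom c y, stratum i y & cmap c y = v])].
Proof.
move=> [oc hc H] cx ix; have [d [dn sub] _] := H i.
have Pcx : (cmap c @` (cdom c `&` stratum i)) (cmap c x) by exists x.
have [b [V [V' [h [dh bd hb bP]]]] bx] := sub _ Pcx.
have [K [[oV' oV sK _] hK Kh]] := diffeo_sym dh.
have [_ _ sh _] := dh.
exists d, V, V', h, K; split=> //; first by move: bx; rewrite bd => -[].
split=> [y cy iy Vy l dl|v Vv hv].
  by rewrite hb // ?pad_ge //; exists y.
have [|y [cy iy] cyv] := bP v Vv; last by exists y.
by exists (pad d (h v)); rewrite pad_pad.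
Qed.

(** The functions [F j], [j] in [P], are the transverse coordinates of a
    slice chart, cut off away from [x]. Since [X] restricts to a derivation [Y]
    of the stratum and [F j] restricts to [0], [X (F j)] vanishes on the
    stratum; read in the slice coordinates it is a smooth function that vanishes
    where the transverse coordinates do, to which [vanish_lipschitz]
    applies. *)
Lemma tangent_bound (S : smooth_stratified R) (X : (S -> R) -> (S -> R))
    (i : sindex S) (x : S) :
  smooth_stratified_space S -> strongly_stratified S X -> stratum i x ->
  exists n (P : pred 'I_n) (F : 'I_n -> S -> R) (K : R),
  [/\ forall j, Cinf S (F j),
      forall j y, P j -> stratum i y -> F j y = 0,
      \forall y \near x, (forall j, P j -> F j y = 0) -> stratum i y &
      \forall y \near x, forall j, P j ->
        `|X (F j) y| <= K * \sum_(l | P l) `|F l y|].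
Proof.
move=> hS [[[XC _ _] _] Xs] ix.
have gS := smooth_structure_charts hS.
have [n [phi Cphi phix]] := exists_chart hS x.
have sphi := gS _ _ Cphi.
have [ophi hphi _] := sphi.
have [d [V [V' [h [K [[dn oV oV' sh sK] hK Kh Vx [hs hsi]]]]]]] := slice_data sphi phix ix.
have [W [N [Wx cN _ ext]]] := ext0_smooth hS Cphi phix (@filterT _ (nbhs x) _).
have [rho [rho1 rho0] Hrho] := smooth_cutoff (filterI Wx (open_nbhs_nbhs (conj oV Vx))).
pose g (j : 'I_n) (v : 'rV[R]_n) := rho v * h v 0 j.
pose F (j : 'I_n) := ext0 phi (g j).
have CF j : Cinf S (F j).
  have [||//] := ext (g j).
    by apply: (Hrho (fun v => h v 0 j) V) => // v [].
  by move=> v nWv; rewrite /g rho0 ?mul0r // => -[/nWv].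
have [Y dY XY] := Xs i.
have F0 (j : 'I_n) y : (d <= j)%N -> stratum i y -> F j y = 0.
  move=> dj iy; rewrite /F /ext0; case: pselect => // cy; rewrite /g.
  have [Vy|nVy] := pselect (V (cmap phi y)); first by rewrite hs // mulr0.
  by rewrite rho0 ?mul0r // => -[_ /nVy].
have C0 : @manifold_Cinf R S (stratum i) _ (satlas i) (fun=> 0).
  move=> z a Aa az; exists setT, (fun=> 0); split=> //; first exact: openT.
  exact: smooth_cst.
(* linearity gives [Y 0 = Y 0 + Y 0] *)
have Y0 : Y (fun=> 0) = fun=> 0.
  have [_ lin _] := dY; have := lin 1 _ _ C0 C0.
  have -> : (1 : R) *: (fun=> 0 : R) + (fun=> 0) = (fun=> 0) :> (stratum i -> R).
    by apply/funext => z; rewrite -[LHS]/(1 * 0 + 0 : R) mulr0 addr0.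
  move=> E; apply/funext => z.
  have : Y (fun=> 0) z = 1 * Y (fun=> 0) z + Y (fun=> 0) z := congr1 (fun f => f z) E.
  by rewrite mul1r => Ez; apply: (addrI (Y (fun=> 0) z)); rewrite -Ez addr0.
have XF0 (j : 'I_n) y : (d <= j)%N -> stratum i y -> X (F j) y = 0.
  move=> dj iy; have E := XY (F j) (CF j).
  have -> : X (F j) y = (X (F j) \o val) (SigSub (mem_set iy) : stratum i) by [].
  rewrite E.
  have -> : F j \o (val : stratum i -> S) = fun=> 0.
    by apply/funext => z /=; apply: F0 => //; exact: set_valP.
  by rewrite Y0.
(* [X (F j)] read in the chart, and then, as [G j \o K], in slice coordinates *)
have HG (j : 'I_n) : exists g, smooth_fun setT g /\
    \forall y \near x, X (F j) y = g (cmap phi y).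
  have [_ /(_ n phi Cphi phix)[G sG GE]] := (CinfP _).1 (XC _ (CF j)) x.
  by exists G; split => //; apply: filterS GE => y [].
have [G {}HG] := choice HG.
have HGn : \forall y \near x, forall j, X (F j) y = G j (cmap phi y).
  apply: (@filter_forall _ 'I_n (fun j y => X (F j) y = G j (cmap phi y)) (nbhs x)).
  by move=> j; have [] := HG j.
have [Q [oQ Qx] QE] := homeo_nbhs hphi phix HGn.
pose U := V' `&` K @^-1` Q.
have oU : open U by apply: open_preim => // v V'v; exact: (smooth_on_cont sK).
have [V'h Khx] := hK _ Vx.
have Uh : U (h (cmap phi x)) by split => //; rewrite /= Khx.
have sGK j : smooth_fun U (G j \o K).
  apply: (@smooth_comp _ _ _ _ setT) => //; first exact: openT.
    by apply: smooth_on_sub sK => v [].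
  by have [] := HG j.
have Lip (j : 'I_n) : (d <= j)%N -> exists eK : R * R, [/\ 0 < eK.1, 0 <= eK.2 &
    forall u : 'rV[R]_n, (forall l, `|u 0 l - h (cmap phi x) 0 l| < eK.1) ->
    `|(G j \o K) u| <= eK.2 * \sum_(l < n | (d <= l)%N) `|u 0 l|].
  move=> dj; have [||e e0 [k k0 H]] := @vanish_lipschitz R n
    (fun l => (d <= l)%N) U (G j \o K) _ oU (sGK j) Uh.
  - by move=> l dl; apply: hs.
  - move=> u [V'u Qu] u0; have [Vu hu] := Kh u V'u.
    have [|y [cy iy yE]] := hsi (K u) Vu; first by move=> l dl; rewrite hu u0.
    by rewrite /= -yE -QE // ?yE // XF0.
  by exists (e, k).
have HL (j : 'I_n) : exists eK : R * R, (d <= j)%N -> [/\ 0 < eK.1, 0 <= eK.2 &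
    forall u : 'rV[R]_n, (forall l, `|u 0 l - h (cmap phi x) 0 l| < eK.1) ->
    `|(G j \o K) u| <= eK.2 * \sum_(l < n | (d <= l)%N) `|u 0 l|].
  have [dj|dj] := boolP (d <= j)%N; last by exists (0, 0).
  by have [eK H] := Lip j dj; exists eK.
have [eK {}HL] := choice HL.
exists n, (fun j : 'I_n => (d <= j)%N), F, (\sum_(l < n | (d <= l)%N) (eK l).2).
have cphi := homeo_open_cont hphi ophi phix.
have near1 : \forall y \near x, [/\ cdom phi y, V (cmap phi y),
     rho (cmap phi y) = 1 & forall j, X (F j) y = G j (cmap phi y)].
  have H := nbhsI (nbhsI (open_nbhs_nbhs (conj ophi phix)) HGn)
     (cphi _ (nbhsI (open_nbhs_nbhs (conj oV Vx)) rho1)).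
  by apply: filterS H => y [[? ?] [? ?]].
have FE y (j : 'I_n) : cdom phi y -> rho (cmap phi y) = 1 -> F j y = h (cmap phi y) 0 j.
  by move=> cy r1; rewrite /F ext0E // /g r1 mul1r.
split=> //.
- apply: filterS near1 => y [cy Vy r1 _] Fy.
  have [|z [cz iz zy]] := hsi _ Vy; first by move=> l dl; rewrite -FE // Fy.
  by have [_ phiI _] := hphi; rewrite -(phiI z y) // inE.
- have near2 : \forall y \near x, forall (j : 'I_n), (d <= j)%N ->
      forall l, `|h (cmap phi y) 0 l - h (cmap phi x) 0 l| < (eK j).1.
    have H (j : 'I_n) : \forall y \near x, (d <= j)%N ->
        forall l, `|h (cmap phi y) 0 l - h (cmap phi x) 0 l| < (eK j).1.
      have [dj|dj] := boolP (d <= j)%N; last by apply: nearW.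
      have [e0 _ _] := HL j dj.
      have ch : {for cmap phi x, continuous h} by exact: smooth_on_cont sh _ Vx.
      have B : nbhs (h (cmap phi x)) [set u | forall l,
          `|u 0 l - h (cmap phi x) 0 l| < (eK j).1].
        by apply/nbhs_rVP; exists (eK j).1.
      have HB : \forall y \near x, forall l,
        `|h (cmap phi y) 0 l - h (cmap phi x) 0 l| < (eK j).1 := cphi _ (ch _ B).
      by apply: filterS HB => y Hy _.
    exact: (@filter_forall _ 'I_n _ (nbhs x) _ H).
  apply: filterS2 near1 near2 => y [cy Vy r1 XG] Hy j dj.
  have [_ k0 kL] := HL j dj.
  have [_ KhE] := hK _ Vy.
  rewrite XG -[in leLHS]KhE; apply: le_trans (kL _ (Hy j dj)) _.
  under [X in _ <= _ * X]eq_bigr => l dl do rewrite FE //.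
  apply: ler_wpM2r; first by apply: sumr_ge0.
  rewrite (bigD1 j) //= lerDl; apply: sumr_ge0 => l /andP[dl _].
  by have [] := HL l dl.
Qed.

Lemma derive_sumsq n (P : pred 'I_n) (f : 'I_n -> R -> R) (df : 'I_n -> R) (s : R) :
  (forall j, P j -> is_derive s 1 (f j) (df j)) ->
  is_derive s 1 (fun t => \sum_(j | P j) f j t ^+ 2) (\sum_(j | P j) 2 * f j s * df j).
Proof.
move=> H; elim: (index_enum _) => [|j r IH].
  rewrite big_nil; under eq_fun do rewrite big_nil; exact: is_derive_cst.
rewrite big_cons; under eq_fun do rewrite big_cons.
case: (P j) (H j) => // /(_ isT) Hj.
have D := is_deriveD (is_deriveM Hj Hj) IH.
have E : (fun t => f j t ^+ 2 + \sum_(i <- r | P i) f i t ^+ 2) =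
   f j * f j + (fun t => \sum_(i <- r | P i) f i t ^+ 2) by [].
rewrite E; apply: (is_derive_eq D); rewrite /GRing.scale /=; ring.
Qed.

(** By [a b <= (a ^+ 2 + b ^+ 2) / 2]; the constant [n] bounds the number of
    indices in [P]. *)
Lemma sum_cross_le n (P : pred 'I_n) (a : 'I_n -> R) :
  \sum_(j | P j) `|a j| * (\sum_(l | P l) `|a l|) <= n%:R * \sum_(j | P j) a j ^+ 2.
Proof.
have H (j l : 'I_n) : `|a j| * `|a l| <= (a j ^+ 2 + a l ^+ 2) / 2.
  rewrite ler_pdivlMr // -subr_ge0.
  rewrite -(real_normK (num_real (a j))) -(real_normK (num_real (a l))).
  by rewrite (_ : _ - _ = (`|a j| - `|a l|) ^+ 2) ?sqr_ge0 //; ring.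
set s := \sum_(j | P j) a j ^+ 2.
have cardP : (#|P|%:R : R) <= n%:R by rewrite ler_nat -[X in (_ <= X)%N]card_ord max_card.
have s0 : 0 <= s by apply: sumr_ge0 => j _; exact: sqr_ge0.
apply: (@le_trans _ _ (#|P|%:R * s)); last exact: ler_wpM2r.
apply: (@le_trans _ _ (\sum_(j | P j) \sum_(l | P l) (a j ^+ 2 + a l ^+ 2) / 2)).
  by apply: ler_sum => j _; rewrite mulr_sumr; apply: ler_sum => l _; exact: H.
under eq_bigr do rewrite -mulr_suml big_split /= sumr_const.
rewrite -mulr_suml big_split /= sumr_const sumrMnl -/s.
have E (k : nat) (z : R) : (z *+ k + z *+ k) / 2 = k%:R * z.
  by rewrite -mulr_natl; field.
by rewrite E.
Qed.

(** The sum of the squares of the functions [F j] of [tangent_bound] vanishes at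
    [t], and [gronwall] propagates this zero in both directions as long as the
    curve remains in the neighbourhood where the bound holds. *)
Lemma integral_curve_stays (S : smooth_stratified R) (X : (S -> R) -> (S -> R))
    (x : S) (I : set R) (c : R -> S) (i : sindex S) (t : R) :
  smooth_stratified_space S -> strongly_stratified S X ->
  integral_curve (Cinf S) X x I c -> I t -> stratum i (c t) ->
  exists2 e : R, 0 < e & forall s, I s -> `|s - t| < e -> stratum i (c s).
Proof.
move=> hS sX [itvI _ _ [/within_contP cc _] cD] It ict.
have [n [P [F [K [CF F0 Fi XFb]]]]] := tangent_bound hS sX ict.
have N : nbhs t [set r | I r -> ((forall j, P j -> F j (c r) = 0) -> stratum i (c r)) /\
    forall j, P j -> `|X (F j) (c r)| <= K * \sum_(l | P l) `|F l (c r)|].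
  by have H := cc t _ It (nbhsI Fi XFb); exact: H.
move/nbhs_ballP : N => [e /= e0 eH]; exists e => // s Is se.
have ballP (r : R) : I r -> `|r - t| < e -> ((forall j, P j -> F j (c r) = 0) -> stratum i (c r)) /\
    forall j, P j -> `|X (F j) (c r)| <= K * \sum_(l | P l) `|F l (c r)|.
  by move=> Ir re; apply: eH => //; rewrite /ball /= distrC.
apply: (ballP s Is se).1.
pose w r := \sum_(j | P j) F j (c r) ^+ 2.
pose dw r := \sum_(j | P j) 2 * F j (c r) * X (F j) (c r).
have w0 r : 0 <= w r by apply: sumr_ge0 => j _; exact: sqr_ge0.
suff ws : w s = 0.
  move=> j Pj; apply/eqP; rewrite -sqrf_eq0; apply/eqP.
  exact: (psumr_eq0P (fun j _ => sqr_ge0 _) ws).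
have wt : w t = 0 by rewrite /w big1 // => j Pj; rewrite F0 // expr0n.
have seg a b : I a -> I b -> a < b -> `|a - t| < e -> `|b - t| < e ->
    (w a = 0 -> w b = 0) /\ (w b = 0 -> w a = 0).
  move=> Ia Ib ab ae be.
  have Iab r : a <= r <= b -> I r by move=> rab; exact: itvI Ia Ib _ rab.
  have eab r : a <= r <= b -> `|r - t| < e.
    move: ae be; rewrite !ltr_norml => /andP[? ?] /andP[? ?] /andP[? ?].
    by apply/andP; split; lra.
  apply: (@gronwall _ w dw a b (2 * `|K| * n%:R) ab).
  - move=> r /andP[ar rb].
    have rI : nbhs r I.
      apply: filterS (filterI (lt_nbhsr ar) (lt_nbhsl rb)) => z [az zb].
      by apply: Iab; rewrite !ltW.
    apply: derive_sumsq => j Pj.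
    apply/(quotient_is_derive _ _ rI); apply: cD => //.
    exact: nbhs_singleton rI.
  - apply: (@continuous_subspaceW _ _ _ I); first by move=> r /=; rewrite in_itv; exact: Iab.
    apply/within_contP => r W Ir Wr.
    have cw : {for c r, continuous (fun y => \sum_(j | P j) F j y ^+ 2)}.
      have -> : (fun y => \sum_(j | P j) F j y ^+ 2) =
         (fun v : 'rV[R]_n => \sum_(j | P j) (v 0 j - (0 : 'rV[R]_n) 0 j) ^+ 2) \o (fun y => \row_j F j y).
        by apply/funext => y /=; apply: eq_bigr => j _; rewrite !mxE subr0.
      apply: continuous_comp.
        apply/continuous_rVP => j.
        have -> : (fun y => (\row_j F j y : 'rV[R]_n) 0 j) = F j.
          by apply/funext => y; rewrite mxE.
        by have [cF _] := CF j; exact: cF.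
      by apply: (smooth_cont (O := setT)) => //; apply: smooth_sqdist; exact: openT.
    by have := cc r _ Ir (cw _ Wr); apply: filterS => z.
  - by move=> r _.
  - move=> r /andP[ar rb].
    have rab : a <= r <= b by rewrite !ltW.
    have [_ Xb] := ballP r (Iab r rab) (eab r rab).
    apply: le_trans (ler_norm_sum _ _ _) _.
    apply: (@le_trans _ _ (\sum_(j | P j) (2 * `|K|) * (`|F j (c r)| * \sum_(l | P l) `|F l (c r)|))).
      apply: ler_sum => j Pj; rewrite 2!normrM ger0_norm //.
      rewrite -!mulrA ler_pM2l // mulrCA; apply: ler_wpM2l => //.
      apply: le_trans (Xb j Pj) _; apply: ler_wpM2r; last exact: ler_norm.
      exact: sumr_ge0.
    rewrite -mulr_sumr -[leRHS]mulrA; apply: ler_wpM2l; first by rewrite mulr_ge0.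
    exact: sum_cross_le.
have te : `|t - t| < e by rewrite subrr normr0.
have [st|ts|-> //] := ltgtP s t.
  exact: (seg s t Is It st se te).2 wt.
exact: (seg t s It Is ts te se).1 wt.
Qed.

Lemma strata_disjoint (S : smooth_stratified R) (i j : sindex S) (x : S) :
  smooth_stratified_space S -> stratum i x -> stratum j x -> i = j.
Proof.
move=> [[_ _ _ [[[_ tI _] _] _ _ _]] _] ix jx.
by apply: tI => //; exists x.
Qed.

Lemma strata_cover (S : smooth_stratified R) (x : S) :
  smooth_stratified_space S -> exists i, stratum i x.
Proof.
move=> [[_ _ _ [[[cov _ _] _] _ _ _]] _].
have : [set: S] x by [].
by rewrite -cov => -[i _ ix]; exists i.
Qed.

(** By [integral_curve_stays] the times spent in the stratum form an open
    subset of [I]; the remaining times are spent in other strata, and form an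
    open subset for the same reason. *)
Lemma integral_curve_stratum (S : smooth_stratified R) (X : (S -> R) -> (S -> R))
    (x : S) (I : set R) (c : R -> S) (i : sindex S) :
  smooth_stratified_space S -> strongly_stratified S X -> stratum i x ->
  integral_curve (Cinf S) X x I c -> forall t, I t -> stratum i (c t).
Proof.
move=> hS sX ix Ic; have [itvI I0 c0 _ _] := Ic.
have cI : connected I by apply/connected_intervalP.
have stays j t : I t -> stratum j (c t) ->
  exists2 e : R, 0 < e & forall s, I s -> `|s - t| < e -> stratum j (c s).
  by move=> It; exact: integral_curve_stays hS sX Ic It.
have opens (Q : set R) : (forall t, I t -> Q t -> exists2 e : R, 0 < e &
     forall s, I s -> `|s - t| < e -> Q s) ->
    exists2 C : set R, open C & I `&` Q = I `&` C.
  move=> HQ; exists (\bigcup_(B in [set B : set R | open B /\ I `&` B `<=` Q]) B).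
    by apply: bigcup_open => B [].
  apply/seteqP; split=> t [It]; last by move=> [B [oB BQ] Bt]; split => //; exact: BQ.
  move=> Qt; split => //; have [e e0 He] := HQ t It Qt.
  exists (ball t e); last exact: ballxx.
  split; first exact: ball_open.
  by move=> s [Is st]; apply: He => //; rewrite distrC.
pose Q := [set t | stratum i (c t)].
have : I `&` Q = I.
  apply: cI.
  - by exists 0; split => //; rewrite /Q /= c0.
  - by apply: opens => t It; exact: stays.
  - have [|C oC CE] := opens (~` Q).
      move=> t It Qt; have [j jt] := strata_cover (c t) hS.
      have [e e0 He] := stays j t It jt; exists e => // s Is se si.
      have ij := strata_disjoint hS si (He s Is se).
      by apply: Qt; rewrite /Q /= ij.
    exists (~` C); first exact: open_closedC.
    apply/seteqP; split=> t [It Qt]; split=> //.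
      by move=> Ct; have : (I `&` C) t by []; rewrite -CE => -[].
    apply: contrapT => nQ; apply: Qt.
    by have : (I `&` ~` Q) t by []; rewrite CE => -[].
by move=> E t It; have : I t by []; rewrite -{1}E => -[].
Qed.

End StrataInvariant.

(** * Restriction of smooth functions to strata *)
Section Restrict.
Context {R : realType}.

(** By definition the chart [c] restricts to a smooth map from the stratum to
    its image, as read in slice charts; undoing the straightening
    diffeomorphism turns this into a smooth map into R^n. *)
Lemma chart_on_stratum (S : stratified R) n (c : chart R S n) (i : sindex S) x
    (a : chart R S (sdim i)) :
  smooth_chart c -> manifold_chart (stratum i) a -> satlas i a ->
  cdom c x -> cdom a x ->
  exists W (G : 'rV[R]_(sdim i) -> 'rV[R]_n), [/\ open W, W (cmap a x), smooth_on W G &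
    forall y, cdom a y -> W (cmap a y) -> cdom c y /\ cmap c y = G (cmap a y)].
Proof.
move=> [oc hc H] [[Va oVa aM] ha oa] Aa cx ax.
have aS y : cdom a y -> stratum i y by rewrite aM => -[].
have [d [dn sub] msm] := H i.
have Pcx : (cmap c @` (cdom c `&` stratum i)) (cmap c x) by exists x => //; split => //; exact: aS.
have [b sb bx] := sub _ Pcx.
have [V [V' [h [dh bd hb bP]]]] := sb.
have [K [[oV' oV sK _] hK Kh]] := diffeo_sym dh.
have Dx : (cdom c `&` stratum i) x by split => //; exact: aS.
have [Q [g [oQ Qx sg gE]]] := msm x a b Dx Aa sb ax bx.
have [W1 [oW1 W1x] W1c] := homeo_nbhs ha ax (open_nbhs_nbhs (conj oc cx)).
pose Q1 := Q `&` (fun v => pad n (g v)) @^-1` V'.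
have sQ : smooth_on Q (fun v => pad n (g v)).
  by apply: (@smooth_on_comp _ _ _ _ Q setT) => //; [exact: openT|exact: smooth_pad].
have oQ1 : open Q1 by apply: open_preim => // v Qv; exact: smooth_on_cont sQ _ Qv.
exists (Q1 `&` W1), (K \o (fun v => pad n (g v))); split.
- exact: openI.
- have [_ gx] := gE x Dx ax Qx.
  split; last exact: W1x.
  split; first exact: Qx.
  move: bx; rewrite bd => -[Px Vx]; rewrite /preimage /= -gx -hb //.
  by have [] := hK _ Vx.
- apply: smooth_on_comp sK => //; first exact: openI.
    by apply: smooth_on_sub sQ => v [[]].
  by move=> v [[]].
- move=> y ay [[Qy _] Wy]; have cy : cdom c y by exact: W1c.
  split => //; have Dy : (cdom c `&` stratum i) y by split => //; exact: aS.
  have [by' gy] := gE y Dy ay Qy.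
  move: by'; rewrite bd => -[Py Vy]; rewrite /= -gy -hb //.
  by have [_ ->] := hK _ Vy.
Qed.

(** The part of the manifold condition that concerns the existence of charts.
    It passes to open subsets of a stratum by restriction. *)
Definition charted (S : stratified R) : Prop := forall i : sindex S,
  satlas i `<=` @manifold_chart R S (stratum i) (sdim i) /\
  forall x, stratum i x -> exists2 a, satlas i a & cdom a x.

Lemma stratification_charted (S : stratified R) : stratification S -> charted S.
Proof.
move=> [_ _ _ [_ _ mS _]] i; have [Am cov _ _] := mS i.
by split => // x; rewrite {1}cov => -[a Aa ax]; exists a.
Qed.

Lemma Cinf_restrict (S : smooth_stratified R) (u : S -> R) (i : sindex S) :
  smooth_stratified_space S -> Cinf S u ->
  manifold_Cinf (satlas i) ((u \o val) : stratum i -> R).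
Proof.
move=> hS Cu x a Aa ax; have gS := smooth_structure_charts hS.
have [mi _] := stratification_charted hS.1 i.
have [n [c Cc cx]] := exists_chart hS (val x).
have [_ /(_ n c Cc cx)[g sg ug]] := (CinfP u).1 Cu (val x).
have [W [G [oW Wx sG GE]]] := chart_on_stratum (gS _ _ Cc) (mi _ Aa) Aa cx ax.
have [_ ha _] := mi _ Aa.
have [W1 [oW1 W1x] W1u] := homeo_nbhs ha ax ug.
exists (W `&` W1), (g \o G); split; [exact: openI|by []| |].
  apply: (@smooth_comp _ _ _ _ setT) => //; [exact: openI|exact: openT|].
  by apply: smooth_on_sub sG => v [].
move=> y ay [Wy W1y] /=; have [_ ->] := W1u _ ay W1y.
by have [_ ->] := GE _ ay Wy.
Qed.

End Restrict.

(** * Products of charts *)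
Section RowMx.
Context {R : realType}.

(** Coordinates indexed by natural numbers, with default value [0], so that
    identities between padded and concatenated vectors need no casts between
    ordinal types. *)
Definition coordn n (w : 'rV[R]_n) (k : nat) : R := oapp (w 0) 0 (insub k).

Lemma coordnE n (w : 'rV[R]_n) (j : 'I_n) : coordn w j = w 0 j.
Proof.
rewrite /coordn (insubT (fun k => (k < n)%N) (ltn_ord j)) /=.
by congr (w 0 _); exact: val_inj.
Qed.

Lemma coordn_ge n (w : 'rV[R]_n) k : (n <= k)%N -> coordn w k = 0.
Proof. by move=> nk; rewrite /coordn insubF // ltnNge nk. Qed.

Lemma coordn_ext n (w w' : 'rV[R]_n) :
  (forall k, (k < n)%N -> coordn w k = coordn w' k) -> w = w'.
Proof. by move=> H; apply/rowP => j; rewrite -!coordnE; exact: H. Qed.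

Lemma coordn_pad n N (v : 'rV[R]_n) k : (n <= N)%N -> coordn (pad N v) k = coordn v k.
Proof.
move=> nN; have [kN|Nk] := ltnP k N.
  by rewrite -[k]/(val (Ordinal kN)) coordnE mxE.
by rewrite !coordn_ge // (leq_trans nN).
Qed.

Lemma coordn_row_mx n m (v : 'rV[R]_n) (u : 'rV[R]_m) k :
  coordn (row_mx v u) k = if (k < n)%N then coordn v k else coordn u (k - n).
Proof.
case: ifPn => [kn|]; last rewrite -leqNgt => nk.
  by rewrite -[LHS]/(coordn _ (val (lshift m (Ordinal kn)))) coordnE row_mxEl -coordnE.
have [km|mk] := ltnP k (n + m); last by rewrite !coordn_ge // leq_subRL.
have kn : (k - n < m)%N by rewrite ltn_subLR.
have {1}-> : k = rshift n (Ordinal kn) by rewrite /= subnKC.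
by rewrite coordnE row_mxEr -coordnE.
Qed.

Definition reindex N (s : nat -> nat) (w : 'rV[R]_N) : 'rV[R]_N := \row_j coordn w (s j).

Lemma coordn_reindex N s (w : 'rV[R]_N) k : (k < N)%N ->
  coordn (reindex s w) k = coordn w (s k).
Proof. by move=> kN; rewrite -[k]/(val (Ordinal kN)) coordnE mxE. Qed.

Lemma smooth_reindex N s (O : set 'rV[R]_N) : smooth_on O (@reindex N s).
Proof.
move=> j; have [sN|Ns] := ltnP (s j) N.
  have -> : (fun w : 'rV[R]_N => reindex s w 0 j) = fun w => w 0 (Ordinal sN).
    by apply/funext => w; rewrite mxE -coordnE.
  exact: smooth_coord.
have -> : (fun w : 'rV[R]_N => reindex s w 0 j) = fun=> 0.
  by apply/funext => w; rewrite mxE coordn_ge.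
exact: smooth_cst.
Qed.

Lemma reindex_cancel N s t : (forall k, (k < N)%N -> (s k < N)%N /\ t (s k) = k) ->
  cancel (@reindex N t) (@reindex N s).
Proof.
move=> H w; apply: coordn_ext => k kN; have [sk tk] := H k kN.
by rewrite !coordn_reindex // tk.
Qed.

Lemma smooth_row_mx n m p (O : set 'rV[R]_n) (f : 'rV[R]_n -> 'rV[R]_m)
    (g : 'rV[R]_n -> 'rV[R]_p) : smooth_on O f -> smooth_on O g ->
  smooth_on O (fun v => row_mx (f v) (g v)).
Proof.
move=> sf sg j.
have -> : (fun v : 'rV[R]_n => (row_mx (f v) (g v) : 'rV[R]_(m + p)) 0 j) = fun v =>
   match fintype.split j with inl k => f v 0 k | inr k => g v 0 k end.
  by apply/funext => v; rewrite mxE.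
by case: (fintype.split j) => k; [exact: sf|exact: sg].
Qed.

Lemma smooth_lsub n m (O : set 'rV[R]_(n + m)) : smooth_on O (@lsubmx R 1 n m).
Proof.
by move=> j; under eq_fun do rewrite mxE; exact: smooth_coord.
Qed.

Lemma smooth_rsub n m (O : set 'rV[R]_(n + m)) : smooth_on O (@rsubmx R 1 n m).
Proof.
by move=> j; under eq_fun do rewrite mxE; exact: smooth_coord.
Qed.

Definition setXrow n m (P : set 'rV[R]_n) (Q : set 'rV[R]_m) : set 'rV[R]_(n + m) :=
  [set w | P (lsubmx w) /\ Q (rsubmx w)].

Lemma open_setXrow n m (P : set 'rV[R]_n) (Q : set 'rV[R]_m) :
  open P -> open Q -> open (setXrow P Q).
Proof.
move=> oP oQ.
have -> : setXrow P Q = ([set: 'rV[R]_(n + m)] `&` lsubmx @^-1` P) `&`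
     ([set: 'rV[R]_(n + m)] `&` rsubmx @^-1` Q).
  by apply/seteqP; split=> w /=; [move=> []|move=> [[_ ?] [_ ?]]].
apply: openI.
  by apply: (open_preim openT oP) => w _; exact: smooth_on_cont (@smooth_lsub n m setT) _ I.
by apply: (open_preim openT oQ) => w _; exact: smooth_on_cont (@smooth_rsub n m setT) _ I.
Qed.

Lemma diffeo_comp n m p (O : set 'rV[R]_n) (O' : set 'rV[R]_m) (O'' : set 'rV[R]_p)
    (H : 'rV[R]_n -> 'rV[R]_m) (H' : 'rV[R]_m -> 'rV[R]_p) :
  diffeo_on O O' H -> diffeo_on O' O'' H' -> diffeo_on O O'' (H' \o H).
Proof.
move=> [oO oO' sH [K [sK HK KH]]] [_ oO'' sH' [K' [sK' HK' KH']]].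
split=> //; first by apply: smooth_on_comp sH' => // x /HK[].
exists (K \o K'); split.
- by apply: smooth_on_comp sK => // x /KH'[].
- move=> x /HK[Hx Kx]; have [? K'x] := HK' _ Hx; split=> //=.
  by rewrite K'x.
- move=> y /KH'[Ky Hy]; have [? Hy'] := KH _ Ky; split=> //=.
  by rewrite Hy'.
Qed.

Lemma diffeo_prod n m n' m' (O1 : set 'rV[R]_n) (V1 : set 'rV[R]_m)
    (O2 : set 'rV[R]_n') (V2 : set 'rV[R]_m') H1 H2 :
  diffeo_on O1 V1 H1 -> diffeo_on O2 V2 H2 ->
  diffeo_on (setXrow O1 O2) (setXrow V1 V2)
    (fun w => row_mx (H1 (lsubmx w)) (H2 (rsubmx w))).
Proof.
have aux p q p' q' (P1 : set 'rV[R]_p) (P2 : set 'rV[R]_q)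
    (h1 : 'rV[R]_p -> 'rV[R]_p') (h2 : 'rV[R]_q -> 'rV[R]_q') :
    open P1 -> open P2 -> smooth_on P1 h1 -> smooth_on P2 h2 ->
    smooth_on (setXrow P1 P2) (fun w => row_mx (h1 (lsubmx w)) (h2 (rsubmx w))).
  move=> oP1 oP2 s1 s2; have oP := open_setXrow oP1 oP2; apply: smooth_row_mx.
    apply: smooth_on_comp s1 => //; first exact: smooth_lsub.
    by move=> w [].
  apply: smooth_on_comp s2 => //; first exact: smooth_rsub.
  by move=> w [].
move=> [oO1 oV1 sH1 [K1 [sK1 HK1 KH1]]] [oO2 oV2 sH2 [K2 [sK2 HK2 KH2]]].
split; [exact: open_setXrow|exact: open_setXrow|exact: aux|].
exists (fun w => row_mx (K1 (lsubmx w)) (K2 (rsubmx w))); split; first exact: aux.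
- move=> w [w1 w2]; rewrite /setXrow /= !row_mxKl !row_mxKr.
  have [? ->] := HK1 _ w1; have [? ->] := HK2 _ w2.
  by rewrite hsubmxK.
- move=> w [w1 w2]; rewrite /setXrow /= !row_mxKl !row_mxKr.
  have [? ->] := KH1 _ w1; have [? ->] := KH2 _ w2.
  by rewrite hsubmxK.
Qed.

Lemma diffeo_reindex N s t (O : set 'rV[R]_N) :
  (forall k, (k < N)%N -> (s k < N)%N /\ t (s k) = k) ->
  (forall k, (k < N)%N -> (t k < N)%N /\ s (t k) = k) -> open O ->
  diffeo_on (reindex s @^-1` O) O (reindex s).
Proof.
move=> st ts oO; split=> //.
- rewrite -[X in open X]setTI; apply: open_preim => //; first exact: openT.
  by move=> w _; apply: smooth_on_cont (@smooth_reindex N s setT) _ I.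
- exact: smooth_reindex.
exists (reindex t); split; first exact: smooth_reindex.
- by move=> w Ow; split => //; rewrite reindex_cancel.
- by move=> w Ow; rewrite /= reindex_cancel.
Qed.

Lemma diffeo_reindex_img N s t (O : set 'rV[R]_N) :
  (forall k, (k < N)%N -> (s k < N)%N /\ t (s k) = k) ->
  (forall k, (k < N)%N -> (t k < N)%N /\ s (t k) = k) -> open O ->
  diffeo_on O (reindex t @^-1` O) (reindex s).
Proof.
move=> st ts oO; have [oP _ _ _] := diffeo_reindex ts st oO.
split=> //; first exact: smooth_reindex.
exists (reindex t); split; first exact: smooth_reindex.
- by move=> w Ow; rewrite /preimage /= reindex_cancel.
- by move=> w Ow; rewrite reindex_cancel.
Qed.

(** Concatenation does not commute with padding: the zeros that pad the first
    vector end up in the middle. [shuf n m N1 k] is the index in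
    [row_mx (pad N1 v) (pad N2 u)] of the entry of index [k] of
    [pad (N1 + N2) (row_mx v u)], where [v] and [u] have sizes [n] and [m]. *)
Definition shuf n m N1 k := if (k < n)%N then k else if (k < n + m)%N then (N1 + (k - n))%N
  else if (k < N1 + m)%N then (k - m)%N else k.
Definition unshuf n m N1 k := if (k < n)%N then k else if (k < N1)%N then (k + m)%N
  else if (k < N1 + m)%N then (k - N1 + n)%N else k.

Lemma shufK n m N1 N2 k : (n <= N1)%N -> (m <= N2)%N -> (k < N1 + N2)%N ->
  (shuf n m N1 k < N1 + N2)%N /\ unshuf n m N1 (shuf n m N1 k) = k.
Proof. by move=> nN mN kN; rewrite /shuf /unshuf; repeat case: ifPn => ?; lia. Qed.

Lemma unshufK n m N1 N2 k : (n <= N1)%N -> (m <= N2)%N -> (k < N1 + N2)%N ->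
  (unshuf n m N1 k < N1 + N2)%N /\ shuf n m N1 (unshuf n m N1 k) = k.
Proof. by move=> nN mN kN; rewrite /shuf /unshuf; repeat case: ifPn => ?; lia. Qed.

Lemma reindex_shuf n m N1 N2 (v : 'rV[R]_n) (u : 'rV[R]_m) :
  (n <= N1)%N -> (m <= N2)%N ->
  reindex (shuf n m N1) (row_mx (pad N1 v) (pad N2 u)) = pad (N1 + N2) (row_mx v u).
Proof.
move=> nN mN; apply: coordn_ext => k kN.
rewrite coordn_reindex // coordn_pad; last exact: leq_add.
rewrite !coordn_row_mx !coordn_pad // /shuf.
case: (ltnP k n) => [kn|nk]; first by rewrite (leq_trans kn).
case: (ltnP k (n + m)) => [knm|nmk].
  by rewrite ltnNge leq_addr /= addKn.
have -> : coordn u (k - n) = 0 by rewrite coordn_ge //; lia.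
case: (ltnP k (N1 + m)) => [kN1|N1k].
  have -> : (k - m < N1)%N by lia.
  by rewrite coordn_ge //; lia.
have -> : (k < N1)%N = false by lia.
by rewrite coordn_ge //; lia.
Qed.

(** The product of the two comparison diffeomorphisms, conjugated by the
    permutation of coordinates that moves all the padding to the end. *)
Lemma compatible_prod (T T' : topologicalType) n m n' m'
    (a : chart R T n) (b : chart R T' m) (a' : chart R T n') (b' : chart R T' m') :
  compatible a a' -> compatible b b' -> compatible (chart_prod a b) (chart_prod a' b').
Proof.
move=> ca cb [x y] /= [ax by_] [a'x b'y].
have [U [oU Ux] [UU [N1 [V1 [V1' [H1 [nm1 dh1 hU1]]]]]]] := ca x ax a'x.
have [U' [oU' U'y] [UU' [N2 [V2 [V2' [H2 [nm2 dh2 hU2]]]]]]] := cb y by_ b'y.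
have [l1 l2 l3 l4] : [/\ (n <= N1)%N, (n' <= N1)%N, (m <= N2)%N & (m' <= N2)%N] by split; lia.
exists (U `*` U').
  split; last by [].
  rewrite openE => -[z w] [/= Uz U'w]; exists (U, U') => //=.
  by split; apply: open_nbhs_nbhs.
split; first by move=> [z w] [/= /UU[? ?] /UU'[? ?]].
have [oV1 oV1' _ _] := dh1; have [oV2 oV2' _ _] := dh2.
have D1 := @diffeo_reindex (N1 + N2) (unshuf n m N1) (shuf n m N1) _
  (fun k => @unshufK n m N1 N2 k l1 l3) (fun k => @shufK n m N1 N2 k l1 l3)
  (open_setXrow oV1 oV2).
have D3 := @diffeo_reindex_img (N1 + N2) (shuf n' m' N1) (unshuf n' m' N1) _
  (fun k => @shufK n' m' N1 N2 k l2 l4) (fun k => @unshufK n' m' N1 N2 k l2 l4)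
  (open_setXrow oV1' oV2').
have D := diffeo_comp (diffeo_comp D1 (diffeo_prod dh1 dh2)) D3.
have unsh p q (v : 'rV[R]_p) (u : 'rV[R]_q) : (p <= N1)%N -> (q <= N2)%N ->
    reindex (unshuf p q N1) (pad (N1 + N2) (row_mx v u)) = row_mx (pad N1 v) (pad N2 u).
  move=> pN qN; rewrite -reindex_shuf //; apply: reindex_cancel => k kN.
  exact: unshufK.
exists (N1 + N2)%N; do 3!eexists; split; [lia|exact: D|].
move=> [z w] [/= Uz U'w]; have [h1 h1' h1E] := hU1 z Uz; have [h2 h2' h2E] := hU2 w U'w.
split.
- by rewrite /preimage /= unsh // /setXrow /= row_mxKl row_mxKr.
- by rewrite /preimage /= unsh // /setXrow /= row_mxKl row_mxKr.
- by rewrite /= unsh // row_mxKl row_mxKr h1E h2E reindex_shuf.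
Qed.

End RowMx.

Section ProdCharts.
Context {R : realType}.

Lemma prod_nbhs (T T' : topologicalType) (p : T * T') (V : set (T * T')) :
  nbhs p V <-> exists A B, [/\ open_nbhs p.1 A, open_nbhs p.2 B & A `*` B `<=` V].
Proof.
split=> [[[P Q] /= [pP qQ] PQV]|[A [B [[oA Ap] [oB Bp] ABV]]]]; last first.
  by exists (A, B) => //=; split; apply: open_nbhs_nbhs.
move: pP qQ; rewrite !nbhsE => -[A oA AP] [B oB BQ].
exists A, B; split=> // -[x y] [/= Ax By]; apply: PQV; split=> /=.
  exact: AP.
exact: BQ.
Qed.

Lemma homeo_prod (T T' : topologicalType) n m (a : chart R T n) (b : chart R T' m) :
  homeo_onto_image (cdom a) (cmap a) -> homeo_onto_image (cdom b) (cmap b) ->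
  homeo_onto_image (cdom (chart_prod a b)) (cmap (chart_prod a b)).
Proof.
move=> ha hb; have [/within_contP ca aI _] := ha; have [/within_contP cb bI _] := hb.
apply: homeo_intro.
- move=> [x y] W [/= ax by_] /nbhs_rVP[e e0 eW].
  have na : \forall x' \near x, cdom a x' -> forall j, `|cmap a x' 0 j - cmap a x 0 j| < e.
    by apply: (ca x [set v | forall j, `|v 0 j - cmap a x 0 j| < e]) => //; apply/nbhs_rVP; exists e.
  have nb : \forall y' \near y, cdom b y' -> forall j, `|cmap b y' 0 j - cmap b y 0 j| < e.
    by apply: (cb y [set v | forall j, `|v 0 j - cmap b y 0 j| < e]) => //; apply/nbhs_rVP; exists e.
  exists ([set x' | cdom a x' -> forall j, `|cmap a x' 0 j - cmap a x 0 j| < e],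
     [set y' | cdom b y' -> forall j, `|cmap b y' 0 j - cmap b y 0 j| < e]); first by split.
  move=> [x' y'] [/= ax' by'] [/= cx' cy']; apply: eW => j; rewrite !mxE.
  by case: (fintype.split j) => k; [exact: ax'|exact: by'].
- move=> [x y] [x' y'] [/= ax by_] [/= ax' by'] /eq_row_mx[E1 E2].
  by rewrite (aI x x') ?inE // (bI y y') ?inE.
- move=> [x y] V [/= ax by_] /prod_nbhs[A [B [oA oB ABV]]].
  have [W [oW Wx] WA] := homeo_nbhs ha ax (open_nbhs_nbhs oA).
  have [W' [oW' Wy] WB] := homeo_nbhs hb by_ (open_nbhs_nbhs oB).
  exists (setXrow W W').
    split; first exact: open_setXrow.
    by rewrite /setXrow /= row_mxKl row_mxKr.
  move=> [x' y'] [/= ax' by']; rewrite /setXrow /= row_mxKl row_mxKr => -[Wx' Wy'].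
  by apply: ABV; split; [exact: WA|exact: WB].
Qed.

Lemma submanifold_prod n m (P : set 'rV[R]_n) (Q : set 'rV[R]_m) d e :
  submanifold P d -> submanifold Q e -> submanifold (setXrow P Q) (d + e).
Proof.
move=> [dn sP] [em sQ]; split; first exact: leq_add.
move=> w [Pw Qw]; have [c [V [V' [h [dh cd hc cP]]]] cw] := sP _ Pw.
have [c' [W [W' [k [dk c'd kc cQ]]]] c'w] := sQ _ Qw.
have [oV oV' _ _] := dh; have [oW oW' _ _] := dk.
have D2 := @diffeo_reindex_img R (n + m) (shuf d e n) (unshuf d e n) _
  (fun l => @shufK d e n m l dn em) (fun l => @unshufK d e n m l dn em)
  (open_setXrow oV' oW').
have D := diffeo_comp (diffeo_prod dh dk) D2.
exists (@Chart R _ (d + e) (setXrow P Q `&` setXrow V W)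
   (fun z => row_mx (cmap c (lsubmx z)) (cmap c' (rsubmx z)))).
  do 3!eexists; split; [exact: D|by []| |].
    move=> z [Pz Qz] [Vz Wz] /=.
    by rewrite hc // kc // reindex_shuf.
  move=> z [Vz Wz] [v /= hv].
  have E : row_mx (h (lsubmx z)) (k (rsubmx z)) = row_mx (pad n (lsubmx v)) (pad m (rsubmx v)).
    have C : cancel (@reindex R (n + m) (shuf d e n)) (reindex (unshuf d e n)).
      by apply: reindex_cancel => l; exact: unshufK.
    by apply: (can_inj C); rewrite hv reindex_shuf // hsubmxK.
  have [E1 E2] := eq_row_mx E.
  split; [apply: cP => //; by exists (lsubmx v)|apply: cQ => //; by exists (rsubmx v)].
split=> //; move: cw c'w; rewrite cd c'd => -[_ ?] [_ ?].
by split.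
Qed.

Lemma slice_smooth n (P : set 'rV[R]_n) d (b : chart R 'rV[R]_n d) p :
  slice_chart P d b -> cdom b p -> exists2 W, open_nbhs p W &
    exists2 g : 'rV[R]_n -> 'rV[R]_d, smooth_on W g &
      forall q, P q -> W q -> cdom b q /\ ((d <= n)%N -> cmap b q = g q).
Proof.
move=> [V [V' [h [[oV _ sh _] bd hb _]]]]; rewrite bd => -[Pp Vp].
exists V; first by split.
exists (fun q => pad d (h q)).
  by apply: (@smooth_on_comp _ _ _ _ V setT) => //; [exact: openT|exact: smooth_pad].
by move=> q Pq Vq; split => // dn; rewrite hb // padK.
Qed.

(** The atlas of a product stratum consists of all the charts [al] compatible
    with products [chart_prod a1 b1] of charts of the factors. So [al] is first
    compared with such a product, in which the smoothness of the factors of the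
    chart is known, and the result is then read in an arbitrary slice chart by
    [slice_smooth]. *)
Lemma smooth_chart_prod (S S' : stratified R) n m (a : chart R S n) (b : chart R S' m) :
  charted S -> charted S' -> smooth_chart a -> smooth_chart b ->
  @smooth_chart R (prod_strat S S') (n + m) (chart_prod a b).
Proof.
move=> cS cS' sa sb; have [oa ha Ha] := sa; have [ob hb Hb] := sb.
split; last move=> [i j] P.
- rewrite openE => -[x y] [/= ax by_].
  by apply/prod_nbhs; exists (cdom a), (cdom b); split => // -[].
- exact: homeo_prod.
have [d [dn sub1] msm1] := Ha i; have [e [em sub2] msm2] := Hb j.
have PE : P = setXrow (cmap a @` (cdom a `&` stratum i)) (cmap b @` (cdom b `&` stratum j)).
  apply/seteqP; split=> [_ [[x y] [[/= ax by_] [/= ix jy]] <-]|w [[x [ax ix] xw] [y [by_ jy] yw]]].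
    by rewrite /setXrow /= row_mxKl row_mxKr; split; [exists x|exists y].
  by exists (x, y) => //=; rewrite xw yw hsubmxK.
have subP : submanifold P (d + e) by rewrite PE; exact: submanifold_prod.
exists (d + e)%N => //.
move=> [x y] al be [[/= ax by_] [/= ix jy]] [mal comp] sbe alp bep.
have [mi covi] := cS i; have [mj covj] := cS' j.
have [a1 Aa1 a1x] := covi x ix; have [b1 Bb1 b1y] := covj y jy.
have [W1 [G1 [oW1 W1x sG1 GE1]]] := chart_on_stratum sa (mi _ Aa1) Aa1 ax a1x.
have [W2 [G2 [oW2 W2y sG2 GE2]]] := chart_on_stratum sb (mj _ Bb1) Bb1 by_ b1y.
have [[g sg gE] _] := comp a1 b1 Aa1 Bb1.
have [[Val oVal alV] hal oal] := mal.
have [W [oW Wp] [G sG GE]] := slice_smooth sbe bep.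
have [[Va1 oVa1 a1V] _ _] := mi _ Aa1; have [[Vb1 oVb1 b1V] _ _] := mj _ Bb1.
(* stay within the charts [a1] and [b1], between which and [al] the map [g] is
   the transition *)
have nV : nbhs (x, y) (Va1 `*` Vb1).
  apply/prod_nbhs; exists Va1, Vb1; split=> //; split => //.
    by move: a1x; rewrite a1V => -[].
  by move: b1y; rewrite b1V => -[].
have [Q [oQ Qp] QE] := homeo_nbhs hal alp nV.
pose O1 := cmap al @` cdom al `&` Q.
have oO1 : open O1 by exact: openI.
have O1E v : O1 v -> exists z w, [/\ cdom al (z, w), v = cmap al (z, w), cdom a1 z & cdom b1 w].
  move=> [[[z w] alz <-] Qv]; exists z, w; have [/= Vz Vw] := QE _ alz Qv.
  have [iz jw] : stratum i z /\ stratum j w by move: (alz); rewrite alV => -[[]].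
  by rewrite a1V b1V.
have sg1 : smooth_on O1 g.
  apply: smooth_on_sub sg => v /O1E[z [w [alz -> a1z b1w]]].
  by exists (z, w).
pose GG := fun v => row_mx (G1 (lsubmx (g v))) (G2 (rsubmx (g v))).
pose O2 := O1 `&` g @^-1` setXrow W1 W2.
have oO2 : open O2.
  apply: open_preim => //; first exact: open_setXrow.
  by move=> v O1v; exact: smooth_on_cont sg1 _ O1v.
have sGG : smooth_on O2 GG.
  apply: smooth_row_mx.
    apply: (@smooth_on_comp _ _ _ _ O2 W1 (lsubmx \o g)) => //; last by move=> v [_ []].
    apply: (@smooth_on_comp _ _ _ _ O2 setT) => //; [exact: openT| |exact: smooth_lsub].
    by apply: smooth_on_sub sg1 => v [].
  apply: (@smooth_on_comp _ _ _ _ O2 W2 (rsubmx \o g)) => //; last by move=> v [_ []].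
  apply: (@smooth_on_comp _ _ _ _ O2 setT) => //; [exact: openT| |exact: smooth_rsub].
  by apply: smooth_on_sub sg1 => v [].
pose O3 := O2 `&` GG @^-1` W.
have oO3 : open O3.
  by apply: open_preim => // v O2v; exact: smooth_on_cont sGG _ O2v.
have key z w : cdom al (z, w) -> O2 (cmap al (z, w)) ->
    [/\ cdom a z, cdom b w, stratum i z, stratum j w &
      GG (cmap al (z, w)) = row_mx (cmap a z) (cmap b w)].
  move=> alz [[_ Qv] gW].
  have [/= Vz Vw] := QE _ alz Qv.
  move: (alz); rewrite alV => -[[/= iz jw] _].
  have a1z : cdom a1 z by rewrite a1V.
  have b1w : cdom b1 w by rewrite b1V.
  have gz : g (cmap al (z, w)) = row_mx (cmap a1 z) (cmap b1 w) by rewrite gE.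
  move: gW; rewrite /GG /preimage /= gz /setXrow /= row_mxKl row_mxKr => -[Wz Ww].
  have [? <-] := GE1 z a1z Wz; have [? <-] := GE2 w b1w Ww.
  by [].
have O1p : O1 (cmap al (x, y)) by split => //; exists (x, y).
have gp : g (cmap al (x, y)) = row_mx (cmap a1 x) (cmap b1 y) by rewrite gE.
have O2p : O2 (cmap al (x, y)).
  by split => //; rewrite /preimage /= gp /setXrow /= row_mxKl row_mxKr.
exists O3, (G \o GG); split=> //.
- split => //; have [_ _ _ _ E] := key x y alp O2p.
  by rewrite /preimage /= E.
- apply: smooth_on_comp sG => //; last by move=> v [].
  by apply: smooth_on_sub sGG => v [].
- move=> [z w] Dzw alz [Vz Wz]; have [az bw iz jw E] := key z w alz Vz.
  have Pz : P (row_mx (cmap a z) (cmap b w)) by exists (z, w).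
  rewrite /preimage /= E in Wz.
  have [bq bE] := GE _ Pz Wz; split=> //=.
  by rewrite bE ?E // leq_add.
Qed.

End ProdCharts.

(** * Open subsets of a stratum and their product with a fibre *)
Section OpenStratum.
Context {R : realType}.

Lemma nbhs_subtype (T : topologicalType) (A : set T) (x : A) (V : set A) :
  nbhs x V <-> exists2 W, open_nbhs (val x) W & forall y : A, W (val y) -> V y.
Proof.
split=> [[_ [[W oW <-]] Wx] WV|[W [oW Wx] WV]].
  by exists W => // y; exact: WV.
exists (val @^-1` W); split=> //; first by exists W.
Qed.

Lemma val_cont (T : topologicalType) (A : set T) : continuous (val : A -> T).
Proof. exact: initial_continuous. Qed.

Lemma open_image (T : topologicalType) d (M V : set T) (c : chart R T d) :
  manifold_chart M c -> open V -> open (cmap c @` (cdom c `&` V)).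
Proof.
move=> [_ [_ _ ho] oc] oV; have [W oW ->] := ho V oV; exact: openI.
Qed.

Lemma sub_chart_manifold (T : topologicalType) d (M U : set T) (c : chart R T d) :
  manifold_chart M c -> open U ->
  manifold_chart [set: (M `&` U : set T)] (chart_comp (fun y : (M `&` U : set T) => val y) c).
Proof.
move=> mc oU; have [[V oV cV] hc oc] := mc.
have imE : cmap c @` (cdom c `&` U) =
  cmap (chart_comp (fun y : (M `&` U : set T) => val y) c) @`
    cdom (chart_comp (fun y : (M `&` U : set T) => val y) c).
  apply/seteqP; split=> [_ [x [cx Ux] <-]|_ [x cx <-]]; last first.
    by exists (val x) => //; split => //; have [] := set_valP x.
  have MUx : x \in M `&` U by rewrite inE; split => //; move: cx; rewrite cV => -[].
  by exists (SigSub MUx).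
split.
- exists (val @^-1` V).
    by apply: (@open_comp _ _ (val : (M `&` U : set T) -> T)) => // x _; exact: val_cont.
  apply/seteqP; split=> x /=; rewrite /preimage cV; first by move=> [].
  by move=> [_ Vx]; split => //; have [] := set_valP x.
- have [/within_contP cc cI _] := hc; apply: homeo_intro.
  + move=> x W cx Wx.
    by have := val_cont (cc (val x) W cx Wx).
  + by move=> x y cx cy E; apply: val_inj; apply: cI; rewrite ?inE.
  + move=> x V' cx /nbhs_subtype[W Wx WV].
    have [Q Qx QW] := homeo_nbhs hc cx (open_nbhs_nbhs Wx).
    by exists Q => // y cy Qy; apply: WV; exact: QW.
- by rewrite -imE; exact: open_image mc oU.
Qed.

(** Charts of a manifold are studied through this space, of which
    [open_stratum_strat] is an instance. *)
Definition one_stratum (T : topologicalType) d (A : set (chart R T d)) : stratified R :=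
  @Stratified R T unit (fun=> setT) (fun=> d) (fun=> A).

Lemma one_stratum_compatible (T : topologicalType) d (c c' : chart R T d) :
  manifold_chart setT c -> manifold_chart setT c' ->
  manifold_compatible c c' -> compatible c c'.
Proof.
move=> mc mc' [[g sg gE] [g' sg' gE']] x cx c'x.
have [[V oV cV] _ _] := mc; have [[V' oV' cV'] _ _] := mc'.
rewrite setTI in cV; rewrite setTI in cV'.
exists (cdom c `&` cdom c').
  by split => //; rewrite cV cV'; exact: openI.
split=> //; exists d, (cmap c @` (cdom c `&` cdom c')), (cmap c' @` (cdom c' `&` cdom c)), g.
split; first by rewrite maxnn.
- split=> //.
  + by apply: (open_image mc); rewrite cV'.
  + by apply: (open_image mc'); rewrite cV.
  + exists g'; split => //.
      by move=> _ [y [cy c'y] <-]; rewrite gE // gE' //; split => //; exists y.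
    by move=> _ [y [cy c'y] <-]; rewrite gE' // gE //; split => //; exists y.
- move=> y [cy c'y]; rewrite !pad_id gE //; split => //; by exists y.
Qed.

Lemma submanifold_open n (P : set 'rV[R]_n) : open P -> submanifold P n.
Proof.
move=> oP; split=> // p Pp.
exists (@Chart R _ n P id) => //; exists P, P, id; split.
- by split => //; [exact: smooth_on_id|exists id; split => //; exact: smooth_on_id].
- by rewrite /= setIid.
- by move=> y Py _; rewrite pad_id.
- by move=> y Py _.
Qed.

(** The image of a chart is open in R^d, hence a submanifold for which the
    identity is a slice chart. *)
Lemma one_stratum_smooth_chart (T : topologicalType) d (A : set (chart R T d)) c :
  A `<=` @manifold_chart R T setT d ->
  (forall c c', A c -> A c' -> manifold_compatible c c') -> A c ->
  @smooth_chart R (one_stratum A) d c.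
Proof.
move=> Am Ac cA; have mc := Am c cA; have [[V oV cV] hc oc] := mc.
split=> //; first by rewrite cV setTI.
move=> u P; have PE : P = cmap c @` cdom c by rewrite /P /= setIT.
have oP : open P by rewrite PE.
exists d; first exact: submanifold_open.
move=> x a b [cx _] aA sb ax bx.
have [W [oW Wx] [g sg gE]] := slice_smooth sb bx.
have [[h sh hE] _] := Ac a c aA cA.
have ma := Am a aA.
have oC : open (cdom c) by rewrite cV setTI.
have oI : open (cmap a @` (cdom a `&` cdom c)) := open_image ma oC.
exists (cmap a @` (cdom a `&` cdom c) `&` h @^-1` W), (g \o h); split.
- by apply: open_preim => // v Iv; exact: smooth_on_cont sh _ Iv.
- by split; [exists x|rewrite /preimage /= hE].
- apply: smooth_on_comp sg => //; last by move=> v [].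
    by apply: open_preim => // v Iv; exact: smooth_on_cont sh _ Iv.
  by apply: smooth_on_sub sh => v [].
- move=> y [cy _] ay [Iy hy].
  rewrite /preimage /= hE // in hy.
  have Py : P (cmap c y) by rewrite PE; exists y.
  have [by_ bE] := gE _ Py hy; split => //=.
  by rewrite bE // hE.
Qed.

Section Local.
Variables (S : smooth_stratified R) (i : sindex S) (U : set S).
Hypotheses (hS : smooth_stratified_space S) (oU : open U).

Let manS : manifold (stratum i) (satlas i).
Proof. by have [[_ _ _ [_ _ H _]] _] := hS. Qed.

Lemma sub_atlas_manifold : sub_atlas (satlas i) `<=`
  @manifold_chart R (stratum i `&` U : set S) setT (sdim i).
Proof.
move=> _ [c Ac <-]; apply: sub_chart_manifold => //.
by have [H _ _ _] := manS; exact: H.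
Qed.

Lemma sub_atlas_compatible (c c' : chart R (stratum i `&` U : set S) (sdim i)) :
  sub_atlas (satlas i) c -> sub_atlas (satlas i) c' -> manifold_compatible c c'.
Proof.
move=> [a Aa <-] [a' Aa' <-]; have [_ _ comp _] := manS.
have [[g sg gE] [g' sg' gE']] := comp _ _ Aa Aa'.
split; [exists g|exists g'].
- by apply: smooth_on_sub sg => v [y [ay a'y] <-]; exists (val y).
- by move=> y ay a'y; exact: gE.
- by apply: smooth_on_sub sg' => v [y [ay a'y] <-]; exists (val y).
- by move=> y ay a'y; exact: gE'.
Qed.

Lemma open_stratum_smooth_chart (c : chart R (open_stratum i U) (sdim i)) :
  sub_atlas (satlas i) c -> smooth_chart c.
Proof.
move=> Ac; apply: (@one_stratum_smooth_chart _ _ (sub_atlas (satlas i))) => //.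
  exact: sub_atlas_manifold.
exact: sub_atlas_compatible.
Qed.

Lemma open_stratum_compatible (c c' : chart R (open_stratum i U) (sdim i)) :
  sub_atlas (satlas i) c -> sub_atlas (satlas i) c' -> compatible c c'.
Proof.
move=> Ac Ac'; apply: one_stratum_compatible.
- exact: sub_atlas_manifold.
- exact: sub_atlas_manifold.
- exact: sub_atlas_compatible.
Qed.

Lemma open_stratum_charts (c : chart R (open_stratum i U) (sdim i)) :
  sub_atlas (satlas i) c -> charts (open_stratum i U) (sdim i) c.
Proof.
move=> Ac; split; first exact: open_stratum_smooth_chart.
by move=> c' Ac'; exact: open_stratum_compatible.
Qed.

Lemma open_stratum_charted : charted (open_stratum i U).
Proof.
move=> []; split; first exact: sub_atlas_manifold.
move=> x _; have [_ cov _ _] := manS.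
have [ix _] := set_valP x.
have : (\bigcup_(c in satlas i) cdom c) (val x) by rewrite -cov.
by move=> [c Ac cx]; exists (chart_comp (fun y : (stratum i `&` U : set S) => val y) c) => //; exists c.
Qed.

(** The second part makes the coordinates of a product chart smooth on the
    product, by [smooth_at_chart]. *)
Lemma prod_charts (F : smooth_stratified R) n (a : chart R (open_stratum i U) (sdim i))
    (b : chart R F n) :
  smooth_stratified_space F -> sub_atlas (satlas i) a -> charts F n b ->
  charts (prod_stratified (open_stratum i U) F) (sdim i + n) (chart_prod a b) /\
  forall m (c : chart R (prod_stratified (open_stratum i U) F) m),
    charts (prod_stratified (open_stratum i U) F) m c -> compatible (chart_prod a b) c.
Proof.
move=> hF Aa Fb; split.
  split.
    apply: smooth_chart_prod.
    - exact: open_stratum_charted.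
    - exact: stratification_charted hF.1.
    - exact: open_stratum_smooth_chart.
    - exact: smooth_structure_charts hF _ _ Fb.
  move=> m m' a' b' [_ comp'] Fb'; apply: compatible_prod.
    by apply: compatible_sym; apply: comp'.
  exact: chart_compatible hF _ _ _ _ Fb Fb'.
move=> m c [_ comp]; apply: compatible_sym; apply: comp => //.
exact: open_stratum_charts.
Qed.

Lemma prod_charts_smooth (F : smooth_stratified R) :
  charts_smooth (prod_stratified (open_stratum i U) F).
Proof. by move=> n c []. Qed.

End Local.
End OpenStratum.

(** * Local trivializations *)
Lemma nbhs_all (T : topologicalType) (x : T) (A : set T) : (forall y, A y) -> nbhs x A.
Proof. by move=> HA; apply: filterS (@filterT _ (nbhs x) _) => y _. Qed.

Section Trivialization.
Context {R : realType}.
Variables (S : smooth_stratified R) (hS : smooth_stratified_space S).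
Variables (i : sindex S) (U : set S) (oU : open U).
Variables (F : smooth_stratified R) (hF : smooth_stratified_space F).
Notation P := (prod_stratified (open_stratum i U) F).
Variables (f : U -> P) (g : P -> U).
Hypothesis diffeo_fg : diffeomorphism (@sub_Cinf R S (Cinf S) U) (Cinf P) f g.

Lemma triv_fK : cancel f g. Proof. by case: diffeo_fg. Qed.
Lemma triv_gK : cancel g f. Proof. by case: diffeo_fg. Qed.
Lemma triv_f_cont : continuous f. Proof. by case: diffeo_fg => -[]. Qed.
Lemma triv_g_cont : continuous g. Proof. by case: diffeo_fg => _ []. Qed.

Lemma triv_Cinf (u : S -> R) : Cinf S u -> Cinf P (u \o val \o g).
Proof.
move=> Cu; case: diffeo_fg => _ [_ H] _ _; apply: (H (u \o val)) => x.
by exists setT, u; split => //; split => //; exact: openT.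
Qed.

Lemma val_g_cont (z : P) : {for z, continuous (val \o g)}.
Proof. by apply: (@continuous_comp _ _ _ g val); [exact: triv_g_cont|exact: val_cont]. Qed.

(** Multiply [u] by a bump function of the space, pulled back to the product:
    the result is globally smooth on the product, hence its pull-back by the
    trivialization is smooth on [U], which by definition of the induced
    structure means that it is locally the restriction of a smooth
    function. *)
Lemma triv_germ (u : P -> R) (p : U) (V : set S) : open_nbhs (val p) V ->
  (forall q : U, V (val q) -> smooth_at u (f q)) ->
  exists2 w, Cinf S w & exists2 W, open_nbhs (val p) W &
    forall q : U, W (val q) -> w (val q) = u (f q).
Proof.
move=> Vp su; have gP := @prod_charts_smooth R S i U F.
have [chi [N [Cchi chi1 cN NV chi0]]] := smooth_bump hS (open_nbhs_nbhs Vp).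
have Cv : Cinf P (fun z => (chi \o val \o g) z * u z).
  apply/CinfP => z; have [Vz|nVz] := pselect (V (val (g z))).
    apply: smooth_atM => //; first by apply: (CinfP _).1; exact: triv_Cinf.
    by rewrite -(triv_gK z); exact: su.
  apply: (@smooth_at_eq _ _ (fun=> 0)); last exact: smooth_at_cst.
  have nNz : (~` N) (val (g z)) by move=> /NV.
  have oN : open (~` N) by rewrite openC.
  have : \forall y \near z, (~` N) (val (g y)) := val_g_cont (open_nbhs_nbhs (conj oN nNz)).
  by apply: filterS => y /chi0 /= ->; rewrite mul0r.
case: diffeo_fg => -[_ H] _ _ _; have [V' [w [V'p Cw wE]]] := H _ Cv p.
exists w => //.
have [W [oW Wp] W1] := nbhs_open chi1.
exists (V' `&` W); first by split; [apply: openI => //; case: V'p|split => //; case: V'p].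
by move=> q [V'q Wq]; rewrite -wE //= triv_fK W1 // mul1r.
Qed.

Section Charts.
Variables (a : chart R S (sdim i)) (Aa : satlas i a).
Variables (m : nat) (b : chart R F m) (Fb : charts F m b).

Definition base_chart : chart R (open_stratum i U) (sdim i) :=
  chart_comp (fun y : (stratum i `&` U : set S) => val y) a.
Definition triv_chart : chart R P (sdim i + m) := chart_prod base_chart b.

Lemma base_chart_atlas : sub_atlas (satlas i) base_chart.
Proof. by exists a. Qed.

Lemma triv_chart_charts : charts P (sdim i + m) triv_chart.
Proof. by have [] := prod_charts hS oU hF base_chart_atlas Fb. Qed.

Lemma triv_chart_smooth : smooth_chart triv_chart.
Proof. by case: triv_chart_charts. Qed.

Lemma triv_chart_cont z : cdom triv_chart z -> {for z, continuous (cmap triv_chart)}.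
Proof. exact: smooth_chart_cont triv_chart_smooth. Qed.

Lemma triv_coord_smooth (z : P) l : cdom triv_chart z ->
  smooth_at (fun y => cmap triv_chart y 0 l) z.
Proof.
move=> dz; have [_ comp] := prod_charts hS oU hF base_chart_atlas Fb.
apply: (@smooth_at_chart _ P _ triv_chart z setT (fun v => v 0 l)) => //.
- exact: prod_charts_smooth.
- exact: triv_chart_cont.
- exact: openT.
- exact: smooth_coord.
- exact: nbhs_all.
Qed.

Lemma triv_chart_rep (u : P -> R) (z : P) : Cinf P u -> cdom triv_chart z ->
  exists2 q, smooth_fun setT q & \forall y \near z, cdom triv_chart y /\ u y = q (cmap triv_chart y).
Proof.
by move=> Cu dz; have [_ /(_ _ _ triv_chart_charts dz)] := (CinfP u).1 Cu z.
Qed.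

(** [triv_germ] for each coordinate of the product chart. The trivialization
    is thereby described near [p] by a vector of functions that are smooth on
    the whole space, as needed to exhibit a lifted flow as smooth. *)
Lemma triv_coords (p : U) : cdom triv_chart (f p) ->
  exists2 e : S -> 'rV[R]_(sdim i + m), forall l, Cinf S (fun y => e y 0 l) &
    exists2 W, open_nbhs (val p) W & W `<=` U /\ forall q : U, W (val q) ->
      cdom triv_chart (f q) /\ e (val q) = cmap triv_chart (f q).
Proof.
move=> dp; have [od _ _] := triv_chart_smooth.
have /nbhs_subtype[V0 [oV0 V0p] V0d] := triv_f_cont (open_nbhs_nbhs (conj od dp)).
pose V := V0 `&` U.
have Vp : open_nbhs (val p) V.
  by split; [exact: openI|split => //; exact: set_valP].
have Vd (q : U) : V (val q) -> cdom triv_chart (f q) by move=> [V0q _]; exact: V0d.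
have H l : exists w, Cinf S w /\ \forall y \near val p, forall q : U, val q = y ->
     w y = cmap triv_chart (f q) 0 l.
  have [q Vq|w Cw [W Wp wE]] := @triv_germ (fun z => cmap triv_chart z 0 l) p V Vp.
    by apply: triv_coord_smooth; exact: Vd.
  exists w; split=> //; apply: filterS (open_nbhs_nbhs Wp) => y Wy q qy.
  by rewrite -qy wE // qy.
have [w Hw] := choice H.
exists (fun y => \row_l w l y).
  move=> l; have -> : (fun y => (\row_l w l y : 'rV[R]_(sdim i + m)) 0 l) = w l.
    by apply/funext => y; rewrite mxE.
  by have [] := Hw l.
have Hn : \forall y \near val p, V y /\ forall l (q : U), val q = y ->
     w l y = cmap triv_chart (f q) 0 l.
  apply: nbhsI; first exact: open_nbhs_nbhs.
  apply: (@filter_forall _ 'I_(sdim i + m) _ (nbhs (val p)) _ (fun l => (Hw l).2)).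
have [W Wp WE] := nbhs_open Hn; exists W => //; split; first by move=> y /WE[[]].
move=> q /WE[Vq Eq]; split; first exact: Vd.
by apply/rowP => l; rewrite mxE (Eq l q).
Qed.

End Charts.
End Trivialization.

Section Extension.
Context {R : realType}.

(** In a product chart at [p] the stratum is the set of points whose second
    component is the distinguished point, and [h] is a smooth function [G] of
    the coordinates of the first component. These coordinates are restrictions
    of smooth functions by [triv_coords], and [G] of them extends [h]. *)
Lemma manifold_extend (S : smooth_stratified R) (i : sindex S) (h : stratum i -> R)
    (p : stratum i) :
  smooth_stratified_space S -> locally_trivial S -> manifold_Cinf (satlas i) h ->
  exists2 u, Cinf S u & exists2 W, open_nbhs (val p) W &
    forall y : stratum i, W (val y) -> h y = u (val y).
Proof.
move=> hS htriv hh.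
have ip : stratum i (val p) := set_valP p.
have [U [F [pt [f [g [[oU Up] [hF _] dfg _ fo]]]]]] := htriv (val p) i ip.
have [mi covi] := stratification_charted hS.1 i.
have [a Aa ap] := covi _ ip.
have [m [b Fb bo]] := exists_chart hF pt.
have UpI : val p \in U by rewrite inE.
have base_of (y : stratum i) (yU : val y \in U) : exists z : (stratum i `&` U : set S),
    val z = val y.
  have yI : val y \in stratum i `&` U by move: yU; rewrite !inE; split => //; exact: set_valP.
  by exists (SigSub yI).
have fE (q : U) (y : stratum i) : val q = val y ->
    exists2 z, val z = val y & f q = (z, pt).
  move=> qy; have yU : val y \in U by rewrite -qy inE; exact: set_valP.
  have [z zy] := base_of y yU; exists z => //; apply: fo; by rewrite zy.
have dp : cdom (triv_chart U a b) (f (SigSub UpI)).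
  have [z zp ->] := fE (SigSub UpI) p erefl.
  by split => //=; rewrite /preimage /= zp.
have [e Ce [W [oW Wp] [WU WE]]] := triv_coords hS oU hF dfg Aa Fb dp.
have [Q [gq [oQ Qp sg hE]]] := hh p a Aa ap.
have [G sG GE] := smooth_extend oQ sg Qp.
have ce : continuous (fun y => lsubmx (e y)).
  move=> y; apply: (@continuous_comp _ _ _ e (@lsubmx R 1 _ _)).
    by apply/continuous_rVP => l; have [c _] := Ce l; exact: c.
  exact: smooth_on_cont (@smooth_lsub R _ _ setT) _ I.
have lE (q : U) (y : stratum i) : val q = val y -> W (val y) ->
    cdom a (val y) /\ lsubmx (e (val y)) = cmap a (val y).
  move=> qy Wy; have [] := WE q; first by rewrite qy.
  have [z zy ->] := fE q y qy; rewrite qy => -[/= az _] ->.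
  move: az; rewrite /preimage /= zy => az; split=> //.
  by rewrite /= row_mxKl.
have [ap' ep] := lE (SigSub UpI) p erefl Wp.
exists (fun y => G (lsubmx (e y))).
  apply/CinfP => y.
  apply: (@smooth_at_comp _ _ _ e setT (G \o lsubmx)) => //.
  - exact: smooth_structure_charts hS.
  - by move=> l; exact: (CinfP _).1.
  - exact: openT.
  - apply: (@smooth_comp _ _ _ _ setT) => //; [exact: openT|exact: openT|exact: smooth_lsub].
  - exact: nearW.
have Hn : \forall y \near val p, W y /\ (Q (lsubmx (e y)) /\ G (lsubmx (e y)) = gq (lsubmx (e y))).
  apply: nbhsI; first exact: open_nbhs_nbhs.
  apply: (ce (val p) (fun v => Q v /\ G v = gq v)).
  rewrite ep; apply: nbhsI => //; exact: open_nbhs_nbhs.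
have [W' W'p W'E] := nbhs_open Hn; exists W' => // y /W'E[Wy [Qy Gy]].
have yU : val y \in U by rewrite inE; exact: WU.
have [ay ey] := lE (SigSub yU) y erefl Wy.
by rewrite Gy ey; apply: hE => //; rewrite -ey.
Qed.

End Extension.

(** * Smooth actions of the line and their generators *)
Section Action.
Context {R : realType}.
Variables (S : smooth_stratified R) (hS : smooth_stratified_space S).

Definition time_row k (t : R) (v : 'rV[R]_k) : 'rV[R]_(1 + k) := row_mx (t%:M : 'rV[R]_1) v.

Lemma time_row_line k t (v : 'rV[R]_k) :
  time_row t v = t *: delta_mx 0 (lshift k 0) + time_row 0 v.
Proof.
apply/rowP => j; rewrite !mxE eqxx /=; case: fintype.splitP => l jl.
  have -> : j = lshift k 0 by apply: val_inj; rewrite /= jl (ord1 l).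
  by rewrite (ord1 l) !mxE !eqxx !mulr1n mulr1 addr0.
have -> : (j == lshift k 0) = false by rewrite -val_eqE /= jl.
by rewrite mulr0 add0r.
Qed.

Lemma smooth_time_row n k (O : set 'rV[R]_n) (t : 'rV[R]_n -> R) (v : 'rV[R]_n -> 'rV[R]_k) :
  smooth_fun O t -> smooth_on O v -> smooth_on O (fun z => time_row (t z) (v z)).
Proof.
move=> st sv; apply: smooth_row_mx sv => j.
have -> : (fun z => ((t z)%:M : 'rV[R]_1) 0 j) = t by apply/funext => z; rewrite mxE (ord1 j) eqxx.
exact: st.
Qed.

(** Joint smoothness in time and space is tested on functions: near each point
    of the product of the line with the space, [u (Theta t p)] is a smooth
    function of [t] and of finitely many smooth functions of [p]. *)
Definition smooth_action (Theta : R -> S -> S) : Prop :=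
  [/\ forall p, Theta 0 p = p,
      forall s t p, Theta (s + t) p = Theta s (Theta t p),
      forall u, Cinf S u -> forall (t0 : R) (p0 : S), exists k (e : S -> 'rV[R]_k) (G : 'rV[R]_(1 + k) -> R),
        [/\ forall l, Cinf S (fun y => e y 0 l), smooth_fun setT G &
            \forall z \near (t0, p0), u (Theta z.1 z.2) = G (time_row z.1 (e z.2))] &
      forall j t p, stratum j p -> stratum j (Theta t p)].

Definition generator (Theta : R -> S -> S) (u : S -> R) (p : S) : R :=
  'D_1 (fun t : R => u (Theta t p)) 0.

Variable Theta : R -> S -> S.
Hypothesis act : smooth_action Theta.

Let gS := smooth_structure_charts hS.
Let Theta0 p : Theta 0 p = p. Proof. by case: act. Qed.
Let ThetaD s t p : Theta (s + t) p = Theta s (Theta t p). Proof. by case: act. Qed.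

Lemma near_pair (T T' : topologicalType) (x : T) (y : T') (Q : set (T * T')) :
  nbhs (x, y) Q -> (\forall z \near y, Q (x, z)) /\ (\forall z \near x, Q (z, y)).
Proof.
move=> [[V W] /= [Vx Wy] VW]; split.
  by apply: filterS Wy => z Wz; apply: VW; split => //=; exact: nbhs_singleton Vx.
by apply: filterS Vx => z Vz; apply: VW; split => //=; exact: nbhs_singleton Wy.
Qed.

Lemma act_time (u : S -> R) (t0 : R) p : Cinf S u ->
  exists2 g, smooth1 g & \forall t \near t0, u (Theta t p) = g t.
Proof.
move=> Cu; have [_ _ sm _] := act; have [k [e [G [Ce sG /near_pair[_ GE]]]]] := sm u Cu t0 p.
exists (fun t => G (t *: delta_mx 0 (lshift k 0) + time_row 0 (e p))).
  exact: smooth1_line.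
by apply: filterS GE => t /= ->; rewrite time_row_line.
Qed.

Lemma smooth1_derivable (g : R -> R) t : smooth1 g -> derivable g t 1.
Proof. by move=> H; exact: (H 0%N). Qed.

Lemma act_derivable (u : S -> R) (t : R) p : Cinf S u -> derivable (fun t => u (Theta t p)) t 1.
Proof.
move=> Cu; have [g sg gE] := act_time t p Cu.
apply: (near_eq_derivable (f := g)); last exact: smooth1_derivable.
by apply: filterS gE => s ->.
Qed.

Lemma act_is_derive (u : S -> R) (t : R) p : Cinf S u ->
  is_derive t 1 (fun t => u (Theta t p)) (generator Theta u (Theta t p)).
Proof.
move=> Cu; have d := @act_derivable u t p Cu.
suff E : 'D_1 (fun t : R => u (Theta t p)) t = generator Theta u (Theta t p).
  exact: DeriveDef d E.
rewrite /generator /derive.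
have -> // : (fun h : R => h^-1 *: (((fun s : R => u (Theta s p)) \o shift t) (h *: (1 : R)) -
    u (Theta t p))) =
  (fun h : R => h^-1 *: (((fun s : R => u (Theta s (Theta t p))) \o shift 0) (h *: (1 : R)) -
    u (Theta 0 (Theta t p)))).
by apply/funext => h /=; rewrite [h *: 1]mulr1 addr0 Theta0 ThetaD.
Qed.

Lemma act_generator_Cinf u : Cinf S u -> Cinf S (generator Theta u).
Proof.
move=> Cu; apply/CinfP => p; have [_ _ sm _] := act.
have [k [e [G [Ce sG [[V W] /= [V0 Wp] VW]]]]] := sm u Cu 0 p.
apply: (@smooth_at_comp _ _ k e setT
  (fun v => 'D_(delta_mx 0 (lshift k 0)) G (time_row 0 v))) => //.
- by move=> l; exact: (CinfP _).1.
- exact: openT.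
- apply: (@smooth_comp R k (1 + k) setT setT (time_row 0) openT openT _ _
    (fun w => 'D_(delta_mx 0 (lshift k 0)) G w)) => //; last exact: smooth_derive.
  by apply: smooth_time_row; [exact: smooth_cst|exact: smooth_on_id].
- apply: filterS Wp => q Wq; rewrite /generator.
  have [_ ->] := derivable_line G (time_row 0 (e q)) (delta_mx 0 (lshift k 0)).
  apply: near_eq_derive; apply: filterS V0 => t Vt.
  by rewrite (VW (t, q)) //= time_row_line.
Qed.

Lemma act_Cinf u t : Cinf S u -> Cinf S (u \o Theta t).
Proof.
move=> Cu; apply/CinfP => p; have [_ _ sm _] := act.
have [k [e [G [Ce sG /near_pair[GE _]]]]] := sm u Cu t p.
apply: (@smooth_at_comp _ _ k e setT (fun v => G (time_row t v))) => //.
- by move=> l; exact: (CinfP _).1.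
- exact: openT.
- apply: (@smooth_comp R k (1 + k) setT setT (time_row t) openT openT _ _ G) => //.
  by apply: smooth_time_row; [exact: smooth_cst|exact: smooth_on_id].
Qed.

Lemma act_continuous t : continuous (Theta t).
Proof.
move=> p; apply: (continuous_Cinf hS) => u Cu.
by have [c _] := act_Cinf t Cu; exact: c.
Qed.

Lemma act_curve_continuous p : continuous (fun t => Theta t p).
Proof.
move=> t; apply: (continuous_Cinf hS) => u Cu.
apply: differentiable_continuous; apply/derivable1_diffP.
exact: act_derivable.
Qed.

(** [u (Theta t p)] being jointly smooth, its derivative at time [0] is again a
    smooth function of finitely many smooth functions of [p]; the remaining
    properties are those of the derivative with respect to [t]. *)
Lemma generator_derivation : derivation (Cinf S) (generator Theta).
Proof.
split; first exact: act_generator_Cinf.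
- move=> a u w Cu Cw; apply/funext => p.
  have du := @act_derivable u 0 p Cu; have dw := @act_derivable w 0 p Cw.
  have dz : derivable (a *: (fun t : R => u (Theta t p))) 0 1 by exact: derivableZ.
  have E : generator Theta (a *: u + w) p = 'D_1 (a *: (fun t : R => u (Theta t p))) 0 +
     'D_1 (fun t : R => w (Theta t p)) 0 := deriveD dz dw.
  by rewrite E deriveZ.
- move=> u w Cu Cw; apply/funext => p.
  have du := @act_derivable u 0 p Cu; have dw := @act_derivable w 0 p Cw.
  have E : generator Theta (u * w) p = u (Theta 0 p) * generator Theta w p +
     w (Theta 0 p) * generator Theta u p := deriveM du dw.
  by rewrite E Theta0 addrC [X in X + _]mulrC.
Qed.

Lemma act_integral_curve p :
  integral_curve (Cinf S) (generator Theta) p setT (fun t => Theta t p).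
Proof.
split=> //.
- split.
    by move=> t; apply: continuous_subspaceT; exact: act_curve_continuous.
  move=> u Cu t _; have [g sg gE] := act_time t p Cu.
  by exists [set s | u (Theta s p) = g s] => //; exists g.
- move=> u Cu t _.
  by apply/(quotient_is_derive _ _ (@filterT _ (nbhs t) _)); exact: act_is_derive.
Qed.

(** The orbit is an integral curve by the group law, and it is maximal because
    it is defined for all times. *)
Lemma act_flow t p : flow (Cinf S) (generator Theta) t p (Theta t p).
Proof.
exists setT, (fun t => Theta t p); split=> //; split; first exact: act_integral_curve.
by move=> I' c' _ TI _; apply/seteqP; split.
Qed.

Lemma generator_vector_field : vector_field (Cinf S) (generator Theta).
Proof.
split; first exact: generator_derivation.
move=> p; exists setT; first by split => //; exact: openT.
exists 1 => // t _; exists setT; first exact: openT.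
have mT (q : S) : q \in [set: S] by rewrite inE.
pose lift s (q : [set: S]) : [set: S] := SigSub (mT (Theta s (val q))).
exists (lift t), (lift (- t)); split; last by move=> q; exact: act_flow.
have half s : smooth_map (@sub_Cinf R S (Cinf S) setT) (@sub_Cinf R S (Cinf S) setT) (lift s).
  split.
    move=> q V /nbhs_subtype[W Wq WV].
    have : \forall y \near q, W (Theta s (val y)).
      apply: (@continuous_comp _ _ _ (val : [set: S] -> S) (Theta s) q) (open_nbhs_nbhs Wq).
        exact: val_cont.
      exact: act_continuous.
    by apply: filterS => y Wy; exact: WV.
  move=> h Ch q; have [V [u [[oV Vq] Cu uE]]] := Ch (lift s q).
  exists (Theta s @^-1` V), (u \o Theta s); split.
  - split => //; apply: open_comp => // z _; exact: act_continuous.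
  - exact: act_Cinf.
  - by move=> y Vy; rewrite /= uE.
split=> //.
- by move=> q; apply: val_inj; rewrite /= -ThetaD addNr Theta0.
- by move=> q; apply: val_inj; rewrite /= -ThetaD subrr Theta0.
Qed.

(** The restriction to a stratum is differentiation of [h (Theta t p)] at time
    [0], which makes sense since the action preserves the stratum. That it has
    the required properties follows from the corresponding facts for functions
    of the space, because [h] is near [p] the restriction of such a function
    ([manifold_extend]). *)
Lemma generator_strongly_stratified : locally_trivial S ->
  strongly_stratified S (generator Theta).
Proof.
move=> htriv; split; first exact: generator_vector_field.
move=> i; have [_ _ _ pres] := act.
have pI t (p : stratum i) : Theta t (val p) \in stratum i.
  by rewrite inE; apply: pres; exact: set_valP.
pose lift t (p : stratum i) : stratum i := SigSub (pI t p).
pose Y (h : stratum i -> R) (p : stratum i) := 'D_1 (fun t : R => h (lift t p)) 0.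
have curve (h : stratum i -> R) (u : S -> R) (W : set S) (p : stratum i) : open W -> W (val p) ->
    (forall y : stratum i, W (val y) -> h y = u (val y)) ->
    \forall t \near (0 : R), h (lift t p) = u (Theta t (val p)).
  move=> oW Wp hu.
  have : \forall t \near (0 : R), W (Theta t (val p)).
    apply: (act_curve_continuous (p := val p)); rewrite Theta0.
    exact: open_nbhs_nbhs.
  by apply: filterS => t Wt; rewrite hu.
have dh (h : stratum i -> R) (p : stratum i) : manifold_Cinf (satlas i) h ->
    derivable (fun t => h (lift t p)) 0 1.
  move=> Ch; have [u Cu [W [oW Wp] hu]] := manifold_extend p hS htriv Ch.
  apply: (near_eq_derivable (f := fun t => u (Theta t (val p)))).
    by apply: filterS (curve h u W p oW Wp hu) => t ->.
  exact: act_derivable.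
have l0 p : lift 0 p = p by apply: val_inj; rewrite /= Theta0.
exists Y => //; split.
- move=> h Ch p a Aa ap.
  have [u Cu [W [oW Wp] hu]] := manifold_extend p hS htriv Ch.
  have [V [g [oV Vp sg gE]]] := Cinf_restrict (i := i) hS (act_generator_Cinf Cu) Aa ap.
  have [mi _] := stratification_charted hS.1 i.
  have [_ ha _] := mi _ Aa.
  have [Q [oQ Qp] QW] := homeo_nbhs ha ap (open_nbhs_nbhs (conj oW Wp)).
  exists (V `&` Q), g; split; [exact: openI|by []| |].
    by apply: smooth_fun_sub sg => v [].
  move=> y ay [Vy Qy]; rewrite -gE //= /Y /generator.
  apply: near_eq_derive; exact: curve h u W y oW (QW _ ay Qy) hu.
- move=> c h k Ch Ck'; apply/funext => p.
  have d1 := dh h p Ch; have d2 := dh k p Ck'.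
  have dz : derivable (c *: (fun t : R => h (lift t p))) 0 1 by exact: derivableZ.
  have E : Y (c *: h + k) p = 'D_1 (c *: (fun t : R => h (lift t p))) 0 +
     'D_1 (fun t : R => k (lift t p)) 0 := deriveD dz d2.
  by rewrite E deriveZ.
- move=> h k Ch Ck'; apply/funext => p.
  have d1 := dh h p Ch; have d2 := dh k p Ck'.
  have E : Y (h * k) p = h (lift 0 p) * Y k p + k (lift 0 p) * Y h p := deriveM d1 d2.
  by rewrite E l0 addrC [X in X + _]mulrC.
Qed.

End Action.

(** * Moving one coordinate in a box *)
Section Shift.
Context {R : realType}.
Variables (d : nat) (v0 : 'rV[R]_d) (r : R).
Hypothesis r0 : 0 < r.

(** Coordinates in which the box of centre [v0] and half-width [r] is
    [[-1, 1]^d]. *)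
Definition box_coord (v : 'rV[R]_d) (j : 'I_d) : R := (v 0 j - v0 0 j) / r.

Lemma box_coord_inj v w : (forall j, box_coord v j = box_coord w j) -> v = w.
Proof.
move=> H; apply/rowP => j; have := H j; rewrite /box_coord => /mulIf.
by move=> /(_ _)/addIr; apply; rewrite invr_eq0 gt_eqF.
Qed.

Lemma box_coord_onto (z : 'I_d -> R) : exists v, forall j, box_coord v j = z j.
Proof.
exists (\row_j (r * z j + v0 0 j)) => j; rewrite /box_coord mxE addrK.
by rewrite mulrC mulKf // gt_eqF.
Qed.

Section Direction.
Variable k : 'I_d.

Definition off_axis_sq (v : 'rV[R]_d) : R := \sum_(j | j != k) box_coord v j ^+ 2.
(** The speed of the motion along the coordinate [k]. It is [1] when the sum of
    the squares of the other coordinates is at most [1/2], and [0] when it is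
    at least [1], in particular when one of them has absolute value at least
    [1]. *)
Definition damp (v : 'rV[R]_d) : R := step (2 - 2 * off_axis_sq v).
Definition shift (t : R) (v : 'rV[R]_d) : 'rV[R]_d :=
  v + (r * (interval_flow (t * damp v) (box_coord v k) - box_coord v k)) *: delta_mx 0 k.

Lemma box_coord_shift t v j :
  box_coord (shift t v) j = if j == k then interval_flow (t * damp v) (box_coord v k) else box_coord v j.
Proof.
rewrite {1}/box_coord !mxE eqxx /=; case: eqP => [->|_]; last by rewrite mulr0 addr0.
rewrite mulr1 addrAC mulrDl -/(box_coord v k) [r * _]mulrC mulfK ?gt_eqF //.
by rewrite addrCA subrr addr0.
Qed.

Lemma damp_shift t v : damp (shift t v) = damp v.
Proof.
rewrite /damp /off_axis_sq; congr (step (_ - _ * _)); apply: eq_bigr => j /negbTE jk.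
by rewrite box_coord_shift jk.
Qed.

Lemma shift0 v : shift 0 v = v.
Proof. by apply: box_coord_inj => j; rewrite box_coord_shift mul0r interval_flow_0; case: eqP => // ->. Qed.

Lemma shiftD s t v : shift (s + t) v = shift s (shift t v).
Proof.
apply: box_coord_inj => j; rewrite !box_coord_shift; case: eqP => // _.
by rewrite damp_shift eqxx mulrDl interval_flowD.
Qed.

(** If the coordinate out of the box is [k], then [interval_flow] fixes it;
    otherwise the speed is [0]. *)
Lemma shift_out t v j : 1 < `|box_coord v j| -> shift t v = v.
Proof.
move=> vj; apply: box_coord_inj => l; rewrite box_coord_shift; case: eqP => // ->.
have [jk|jk] := eqVneq j k; first by rewrite interval_flow_ge1 // -jk ltW.
rewrite /damp step0 ?mulr0 ?interval_flow_0 // subr_le0 ler_pMr // /off_axis_sq (bigD1 j) //=.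
have : 1 <= box_coord v j ^+ 2.
  by rewrite -(real_normK (num_real (box_coord v j))) expr_ge1 // ltW.
by move=> /le_trans; apply; rewrite lerDl; apply: sumr_ge0 => i _; exact: sqr_ge0.
Qed.

Lemma shift_in t v : (forall j, `|box_coord v j| <= 1) -> forall j, `|box_coord (shift t v) j| <= 1.
Proof.
move=> v1 j; rewrite box_coord_shift; case: eqP => // _; exact: interval_flow_le1.
Qed.

Lemma shift_reach v w : (forall j, j != k -> box_coord v j = box_coord w j) -> off_axis_sq v <= 2^-1 ->
  `|box_coord v k| < 1 -> `|box_coord w k| < 1 -> exists t, shift t v = w.
Proof.
move=> vw v2 vk wk; have [t tE] := interval_flow_trans vk wk; exists t.
apply: box_coord_inj => j; rewrite box_coord_shift; case: eqP => [->|/eqP]; last exact: vw.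
rewrite /damp step1 ?mulr1 // lerBrDr -lerBrDl (_ : 2 - 1 = 2 * 2^-1); last by field.
by rewrite ler_pM2l.
Qed.

Lemma smooth_box_coord n (O : set 'rV[R]_n) (V : 'rV[R]_n -> 'rV[R]_d) j : open O ->
  smooth_on O V -> smooth_fun O (fun z => box_coord (V z) j).
Proof.
move=> oO sV; apply: smoothM => //; last exact: smooth_cst.
by apply: smoothB => //; exact: smooth_cst.
Qed.

Lemma smooth_shift n (O : set 'rV[R]_n) (t : 'rV[R]_n -> R) (V : 'rV[R]_n -> 'rV[R]_d) :
  open O -> smooth_fun O t -> smooth_on O V -> smooth_on O (fun z => shift (t z) (V z)).
Proof.
move=> oO st sV j.
have sd : smooth_fun O (fun z => damp (V z)).
  apply: smooth_step => //; apply: smoothB => //; first exact: smooth_cst.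
  apply: smoothM => //; first exact: smooth_cst.
  apply: smooth_sum => // l _; have s1 := smooth_box_coord l oO sV; exact: smoothM.
have -> : (fun z => shift (t z) (V z) 0 j) = fun z => V z 0 j +
    (r * (interval_flow (t z * damp (V z)) (box_coord (V z) k) - box_coord (V z) k)) * (delta_mx 0 k : 'rV[R]_d) 0 j.
  by apply/funext => z; rewrite !mxE.
apply: smoothD => //; apply: smoothM => //; last exact: smooth_cst.
apply: smoothM => //; first exact: smooth_cst.
apply: smoothB => //; last exact: smooth_box_coord.
by apply: smooth_interval_flow => //; [exact: smoothM|exact: smooth_box_coord].
Qed.

End Direction.
End Shift.

Section ChartFlow.
Context {R : realType}.
Variables (T : topologicalType) (d : nat) (c : chart R T d) (v0 : 'rV[R]_d) (r : R).
Hypothesis r0 : 0 < r.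
Hypothesis cI : forall y z, cdom c y -> cdom c z -> cmap c y = cmap c z -> y = z.
Hypothesis box : forall v, (forall j, `|box_coord v0 r v j| <= 1) ->
  exists2 y, cdom c y & cmap c y = v.

(** [shift] read in the chart [c], and the identity off the domain of [c]. The
    two agree off the box, where [shift] is the identity. *)
Lemma chart_flow (k : 'I_d) : exists mv : R -> T -> T,
  [/\ forall t y, cdom c y -> cdom c (mv t y) /\ cmap c (mv t y) = shift v0 r k t (cmap c y),
      forall t y, ~ (cdom c y /\ forall j, `|box_coord v0 r (cmap c y) j| <= 1) -> mv t y = y,
      forall y, mv 0 y = y &
      forall s t y, mv (s + t) y = mv s (mv t y)].
Proof.
have H (p : R * T) : exists z, (cdom c p.2 -> cdom c z /\ cmap c z = shift v0 r k p.1 (cmap c p.2)) /\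
     (~ cdom c p.2 -> z = p.2).
  have [cp|ncp] := pselect (cdom c p.2); last by exists p.2.
  have [H|] := pselect (forall j, `|box_coord v0 r (cmap c p.2) j| <= 1).
    have [z cz zE] := box (@shift_in R d v0 r r0 k p.1 _ H).
    by exists z; split.
  move=> /existsNP[j /negP]; rewrite -ltNge => jo.
  by exists p.2; split => // _; rewrite (shift_out r0 _ _ jo).
have [m Hm] := choice H.
have H1 t y : cdom c y -> cdom c (m (t, y)) /\ cmap c (m (t, y)) = shift v0 r k t (cmap c y).
  by have [H1 _] := Hm (t, y).
have H2 t y : ~ (cdom c y /\ forall j, `|box_coord v0 r (cmap c y) j| <= 1) -> m (t, y) = y.
  have [cy|ncy] := pselect (cdom c y); last by have [_ H2] := Hm (t, y); rewrite H2.
  move=> /not_andP[//|/existsNP[j /negP]]; rewrite -ltNge => jo.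
  have [cm mE] := H1 t y cy; apply: cI => //.
  by rewrite mE (shift_out r0 _ _ jo).
exists (fun t y => m (t, y)); split=> // [y|s t y].
  have [cy|ncy] := pselect (cdom c y); last by apply: H2 => -[].
  by have [cm mE] := H1 0 y cy; apply: cI => //; rewrite mE shift0.
have [cy|ncy] := pselect (cdom c y); last by rewrite !H2 // => -[].
have [ct tE] := H1 t y cy; have [cst stE] := H1 s _ ct; have [cs' sE'] := H1 (s + t) y cy.
by apply: cI => //; rewrite sE' stE tE shiftD.
Qed.

End ChartFlow.

(** * Lifting a flow through a trivialization *)

(** The smoothness clause of [smooth_action] holds trivially where nothing
    moves. *)
Lemma stationary_smooth (R : realType) (S : smooth_stratified R) (Theta : R -> S -> S)
    (u : S -> R) (t0 : R) (p0 : S) :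
  Cinf S u -> (\forall z \near (t0, p0), Theta z.1 z.2 = z.2) ->
  exists n (e : S -> 'rV[R]_n) (G : 'rV[R]_(1 + n) -> R),
    [/\ forall l, Cinf S (fun y => e y 0 l), smooth_fun setT G &
        \forall z \near (t0, p0), u (Theta z.1 z.2) = G (time_row z.1 (e z.2))].
Proof.
move=> Cu E; exists 1%N, (fun y => \row_(_ < 1) u y), (fun v => v 0 (rshift 1 0)); split.
- move=> l; have -> // : (fun y => (\row_(_ < 1) u y : 'rV[R]_1) 0 l) = u.
  by apply/funext => y; rewrite mxE.
- exact: smooth_coord.
- by apply: filterS E => z ->; rewrite /time_row row_mxEr mxE.
Qed.

Section LocalFlow.
Context {R : realType}.
Variables (S : smooth_stratified R) (hS : smooth_stratified_space S).
Variables (i : sindex S) (U : set S) (oU : open U).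
Variables (F : smooth_stratified R) (hF : smooth_stratified_space F).
Notation P := (prod_stratified (open_stratum i U) F).
Notation Omega := (stratum i `&` U : set S).
Variables (f : U -> P) (g : P -> U).
Hypothesis dfg : diffeomorphism (@sub_Cinf R S (Cinf S) U) (Cinf P) f g.
Hypothesis strata_fg : forall j : sindex S, stratum j `&` U !=set0 ->
  exists k : sindex P, f @` [set y : U | stratum j (val y)] = stratum k.
Variables (a : chart R S (sdim i)) (Aa : satlas i a).
Notation a' := (base_chart U a).
Variables (v0 : 'rV[R]_(sdim i)) (r : R).
Hypothesis r0 : 0 < r.
Hypothesis box : forall v, (forall j, `|box_coord v0 r v j| <= 1) ->
  exists2 y, cdom a' y & cmap a' y = v.
Variables (chi : F -> R) (N : set F) (C : set S).
Hypotheses (Cchi : Cinf F chi) (cN : closed N) (chi0 : forall w, ~ N w -> chi w = 0).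
Hypotheses (cC : closed C) (CU : C `<=` U).
Let K := [set y : Omega | cdom a' y /\ forall j, `|box_coord v0 r (cmap a' y) j| <= 1].
Hypothesis cK : closed K.
Hypothesis KC : forall z : P, K z.1 -> N z.2 -> C (val (g z)).
Variable k : 'I_(sdim i).
Variable mv : R -> Omega -> Omega.
Hypothesis mv_chart : forall t y, cdom a' y ->
  cdom a' (mv t y) /\ cmap a' (mv t y) = shift v0 r k t (cmap a' y).
Hypothesis mv_out : forall t y, ~ K y -> mv t y = y.
Hypothesis mv0 : forall y, mv 0 y = y.
Hypothesis mvD : forall s t y, mv (s + t) y = mv s (mv t y).

Definition prod_flow (t : R) (z : P) : P := (mv (t * chi z.2) z.1, z.2).

Definition lift_flow (t : R) (p : S) : S :=
  match pselect (U p) with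
  | left Up => val (g (prod_flow t (f (SigSub (mem_set Up)))))
  | right _ => p
  end.

Lemma lift_flowE t (q : U) : lift_flow t (val q) = val (g (prod_flow t (f q))).
Proof.
rewrite /lift_flow; case: pselect => [Uq|]; last by case; exact: set_valP.
by congr (val (g (prod_flow t (f _)))); exact: val_inj.
Qed.

Lemma lift_flow_id t p : ~ U p -> lift_flow t p = p.
Proof. by rewrite /lift_flow; case: pselect. Qed.

Lemma prod_flow0 z : prod_flow 0 z = z.
Proof. by case: z => y w; rewrite /prod_flow /= mul0r mv0. Qed.

Lemma prod_flowD s t z : prod_flow (s + t) z = prod_flow s (prod_flow t z).
Proof. by case: z => y w; rewrite /prod_flow /= mulrDl mvD. Qed.

Let Z := [set p : S | exists2 q : U, val q = p & K (f q).1 /\ N (f q).2].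

(** [Z] contains all the points that move. It is closed in [U] as a preimage of
    a product of closed sets, and in the whole space because it is contained in
    the closed subset [C] of [U]. *)
Lemma closed_support : closed Z.
Proof.
rewrite -[Z]setCK; apply: open_closedC; rewrite openE => p nZp; rewrite /interior.
have ZC : Z `<=` C.
  move=> _ [q <- [Kq Nq]]; rewrite -(triv_fK dfg q); exact: KC.
have [Cp|nCp] := pselect (C p); last first.
  have oC : open (~` C) by rewrite openC.
  by apply: filterS (open_nbhs_nbhs (conj oC nCp)) => y nCy /ZC.
have Up : p \in U by rewrite inE; exact: CU.
pose q : U := SigSub Up.
have oKN : open (~` (K `*` N : set (Omega * F))).
  rewrite openE => z nz; rewrite /interior; have [Kz|nKz] := pselect (K z.1).
    have Nz : (~` N) z.2 by move=> Nz; apply: nz.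
    have oN : open (~` N) by rewrite openC.
    have H : \forall y \near z, (~` N) y.2.
      by apply: (@cvg_snd _ _ _ _); exact: open_nbhs_nbhs.
    by apply: filterS H => y Hy [_ /Hy].
  have oK : open (~` K) by rewrite openC.
  have H : \forall y \near z, (~` K) y.1.
    by apply: (@cvg_fst _ _ _ _); exact: open_nbhs_nbhs.
  by apply: filterS H => y Hy [/Hy].
have nKN : (~` (K `*` N : set (Omega * F))) (f q) by move=> [Kq Nq]; apply: nZp; exists q.
have /nbhs_subtype[W Wp WE] := triv_f_cont dfg (open_nbhs_nbhs (conj oKN nKN)).
apply: filterS (nbhsI (open_nbhs_nbhs (conj oU (CU Cp))) (open_nbhs_nbhs Wp)) => y [Uy Wy] [q' q'y [Kq Nq]].
by apply: (WE q') => //; rewrite q'y.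
Qed.

Lemma lift_flow_out t p : ~ Z p -> lift_flow t p = p.
Proof.
move=> nZp; have [Up|nUp] := pselect (U p); last exact: lift_flow_id.
have Up' : p \in U by rewrite inE.
rewrite -[p]/(val (SigSub Up' : U)) lift_flowE; set q : U := SigSub Up'.
rewrite -[in RHS](triv_fK dfg q); congr (val (g _)).
rewrite /prod_flow; case E : (f q) => [y w] /=; congr (_, _).
have [Nw|nNw] := pselect (N w); last by rewrite chi0 // mulr0 mv0.
by apply: mv_out => Ky; apply: nZp; exists q => //; rewrite E.
Qed.

(** Near a point of the chart domain, the smooth functions [e] extending the
    product coordinates and the representation [Q] of [u] in these coordinates
    reduce the claim to the smoothness of [sh], the motion read in product
    coordinates. *)
Lemma lift_flow_smooth_in (u : S -> R) (t0 : R) (q0 : U) : Cinf S u -> cdom a' (f q0).1 ->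
  exists n (e : S -> 'rV[R]_n) (G : 'rV[R]_(1 + n) -> R),
        [/\ forall l, Cinf S (fun y => e y 0 l), smooth_fun setT G &
            \forall z \near (t0, val q0), u (lift_flow z.1 z.2) = G (time_row z.1 (e z.2))].
Proof.
move=> Cu ay0; set z0 := f q0.
have [m [b Fb bw0]] := exists_chart hF z0.2.
have dz0 : cdom (triv_chart U a b) z0 by split.
have [e Ce [W [oW Wq0] [WU WE]]] := triv_coords hS oU hF dfg Aa Fb dz0.
pose z1 := prod_flow t0 z0.
have [az1 az1E] := mv_chart (t0 * chi z0.2) ay0.
have dz1 : cdom (triv_chart U a b) z1 by split.
have Cug := triv_Cinf dfg Cu.
have [Q sQ QE] := triv_chart_rep hS oU hF Aa Fb Cug dz1.
have [_ /(_ m b Fb bw0)[chb schb chbE]] := (CinfP chi).1 Cchi z0.2.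
pose sh (v : 'rV[R]_(1 + (sdim i + m))) : 'rV[R]_(sdim i + m) :=
  row_mx (shift v0 r k (lsubmx v 0 0 * chb (rsubmx (rsubmx v))) (lsubmx (rsubmx v)))
    (rsubmx (rsubmx v)).
have oT n : open [set: 'rV[R]_n] by exact: openT.
have s1 : smooth_on setT (fun v : 'rV[R]_(1 + (sdim i + m)) => rsubmx (rsubmx v)).
  apply: (@smooth_on_comp _ _ _ _ setT setT rsubmx rsubmx) => //; exact: smooth_rsub.
have s2 : smooth_on setT (fun v : 'rV[R]_(1 + (sdim i + m)) => lsubmx (rsubmx v)).
  apply: (@smooth_on_comp _ _ _ _ setT setT rsubmx lsubmx) => //.
    exact: smooth_rsub.
  exact: smooth_lsub.
have ssh : smooth_on setT sh.
  apply: smooth_row_mx => //; apply: smooth_shift => //.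
  apply: smoothM => //; first exact: (@smooth_lsub R 1 (sdim i + m) setT 0).
  exact: (@smooth_comp _ _ _ setT setT _ (oT _) (oT _) s1).
have shE t q : W (val q) -> chi (f q).2 = chb (cmap b (f q).2) ->
    sh (time_row t (e (val q))) = cmap (triv_chart U a b) (prod_flow t (f q)).
  move=> Wq cq; have [[aq bq] ->] := WE q Wq.
  have -> : cmap (triv_chart U a b) (f q) = row_mx (cmap a' (f q).1) (cmap b (f q).2) by [].
  have t1 : (t%:M : 'rV[R]_1) 0 0 = t by rewrite mxE eqxx.
  rewrite /sh /time_row !row_mxKr !row_mxKl t1.
  by rewrite -cq; have [_ <-] := mv_chart (t * chi (f q).2) aq.
exists (sdim i + m)%N, e, (Q \o sh); split=> //.
  by apply: (@smooth_comp _ _ _ setT setT _ (oT _) (oT _) ssh).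
have [odc hdc _] := triv_chart_smooth hS oU hF Aa Fb.
(* [V] is a neighbourhood of the coordinates of [z1] on which [Q] represents [u] *)
have [V [oV Vz1] VE] := homeo_nbhs hdc dz1 QE.
have ce : continuous e by move=> y; apply/continuous_rVP => l; have [c _] := Ce l; exact: c.
have cst : {for (t0, val q0), continuous (fun z : R * S => sh (time_row z.1 (e z.2)))}.
  apply: (@continuous_comp _ _ _ (fun z : R * S => time_row z.1 (e z.2)) sh); last first.
    by apply: (smooth_on_cont ssh).
  apply/continuous_rVP => j; rewrite /time_row.
  case: (fintype.splitP j) => l jl.
    have -> : (fun z : R * S => (row_mx (z.1%:M : 'rV[R]_1) (e z.2) : 'rV[R]_(1 + (sdim i + m))) 0 j) = fst.
      apply/funext => z; have -> : j = lshift _ l by exact: val_inj.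
      by rewrite row_mxEl mxE (ord1 l) eqxx.
    exact: cvg_fst.
  have -> : (fun z : R * S => (row_mx (z.1%:M : 'rV[R]_1) (e z.2) : 'rV[R]_(1 + (sdim i + m))) 0 j) =
     (fun y => e y 0 l) \o snd.
    apply/funext => z; have -> : j = rshift _ l by exact: val_inj.
    by rewrite row_mxEr.
  apply: continuous_comp; first exact: cvg_snd.
  by have [c _] := Ce l; exact: c.
have near_chi : \forall w \near z0.2, chi w = chb (cmap b w).
  by apply: filterS chbE => w [].
have [W' W'q0 W'E] : exists2 W', open_nbhs (val q0) W' &
    forall q : U, W' (val q) -> chi (f q).2 = chb (cmap b (f q).2).
  have : \forall q \near q0, chi (f q).2 = chb (cmap b (f q).2).
    have c2 : {for q0, continuous (snd \o f)}.
      by apply: continuous_comp; [exact: triv_f_cont dfg q0|exact: cvg_snd].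
    exact: c2 near_chi.
  by move=> /nbhs_subtype[W' W'q W'E]; exists W'.
have V1 : V (sh (time_row t0 (e (val q0)))).
  by rewrite shE //; apply: W'E; case: W'q0.
have nV : \forall z \near (t0, val q0), V (sh (time_row z.1 (e z.2))).
  exact: cst (open_nbhs_nbhs (conj oV V1)).
have nW : \forall z \near (t0, val q0), (W `&` W') z.2.
  apply: (@cvg_snd _ _ _ _); apply: nbhsI; exact: open_nbhs_nbhs.
apply: filterS2 nV nW => -[t p] /= Vz [Wp W'p].
have Up : p \in U by rewrite inE; exact: WU.
pose q : U := SigSub Up.
rewrite -[p]/(val q) lift_flowE.
have E := shE t q Wp (W'E q W'p).
have dq : cdom (triv_chart U a b) (prod_flow t (f q)).
  have [[aq bq] _] := WE q Wp; split => //=.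
  by have [] := mv_chart (t * chi (f q).2) aq.
have [_ ug] := VE _ dq (eq_ind _ (fun v => V v) Vz _ E).
by rewrite /= -[LHS]/((u \o val \o g) (prod_flow t (f q))) ug -E.
Qed.

(** The points that move belong to [Z], around which the flow is read in the
    product chart; around the other points it is the identity since [Z] is
    closed. Strata are preserved because in the trivialization they are
    products with all of [Omega] as first factor. *)
Lemma lift_flow_action : smooth_action lift_flow.
Proof.
split.
- move=> p; have [Up|nUp] := pselect (U p); last exact: lift_flow_id.
  have Up' : p \in U by rewrite inE.
  rewrite -[p]/(val (SigSub Up' : U)) lift_flowE prod_flow0.
  by rewrite (triv_fK dfg).
- move=> s t p; have [Up|nUp] := pselect (U p); last by rewrite !lift_flow_id.
  have Up' : p \in U by rewrite inE.
  rewrite -[p]/(val (SigSub Up' : U)) !lift_flowE (triv_gK dfg).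
  by rewrite prod_flowD.
- move=> u Cu t0 p0; have [Zp|nZp] := pselect (Z p0).
    have [q qp [[aq _] _]] := Zp; rewrite -qp.
    exact: lift_flow_smooth_in.
  apply: stationary_smooth => //.
  have oZ : open (~` Z) by rewrite openC; exact: closed_support.
  have nZ : \forall z \near (t0, p0), (~` Z) z.2.
    apply: (@cvg_snd _ _ _ _); exact: open_nbhs_nbhs.
  by apply: filterS nZ => -[t p] /= nZp'; exact: lift_flow_out.
- move=> j t p jp; have [Up|nUp] := pselect (U p); last by rewrite lift_flow_id.
  have Up' : p \in U by rewrite inE.
  rewrite -[p]/(val (SigSub Up' : U)) lift_flowE; set q : U := SigSub Up'.
  have [|[u l] kE] := @strata_fg j; first by exists p.
  have : (f @` [set y : U | stratum j (val y)]) (f q) by exists q.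
  rewrite kE.
  move=> [_ fl].
  have : @stratum R P (u, l) (prod_flow t (f q)) by split.
  by rewrite -kE => -[q' jq' <-]; rewrite (triv_fK dfg).
Qed.

End LocalFlow.

(** * Strongly stratified fields moving a given coordinate *)
Section LocalAction.
Context {R : realType}.

Lemma box_coord_center d (v0 : 'rV[R]_d) r j : box_coord v0 r v0 j = 0.
Proof. by rewrite /box_coord subrr mul0r. Qed.

(** The half-width is taken smaller than the radius of a ball because the box
    is closed and the ball is open. *)
Lemma box_nbhs d (v0 : 'rV[R]_d) (W : set 'rV[R]_d) : nbhs v0 W ->
  exists2 r : R, 0 < r & forall v, (forall j, `|box_coord v0 r v j| <= 1) -> W v.
Proof.
move=> /nbhs_ballP[e /= e0 eW]; exists (e / 2); first by rewrite divr_gt0.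
move=> v H; apply: eW; split=> // i j; rewrite (ord1 i) /ball /= distrC.
have e2 : 0 < e / 2 by rewrite divr_gt0.
apply: le_lt_trans (_ : e / 2 < e); last by rewrite ltr_pdivrMr // ltr_pMr // ltr1n.
have := H j; rewrite /box_coord normrM (gtr0_norm (_ : 0 < (e / 2)^-1)) ?invr_gt0 //.
by rewrite ler_pdivrMr // mul1r.
Qed.

Lemma near_box d (v0 : 'rV[R]_d) (r : R) : 0 < r ->
  \forall v \near v0, \sum_j box_coord v0 r v j ^+ 2 < 2^-1.
Proof.
move=> r0; have s : smooth_fun setT (fun v => \sum_j box_coord v0 r v j ^+ 2).
  apply: smooth_sum => [|j _]; first exact: openT.
  have s1 := smooth_box_coord v0 r j openT (@smooth_on_id R d setT).
  by apply: smoothM => //; exact: openT.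
have c : {for v0, continuous (fun v => \sum_j box_coord v0 r v j ^+ 2)} := s 0%N v0 I.
have : \forall y \near \sum_j box_coord v0 r v0 j ^+ 2, y < 2^-1.
  apply: lt_nbhsl; rewrite big1 ?invr_gt0 // => j _; by rewrite box_coord_center expr0n.
exact: c.
Qed.

Variables (S : smooth_stratified R) (hS : smooth_stratified_space S).
Hypothesis htriv : locally_trivial S.

(** The sets to be chosen are nested as follows: [C] is a closed neighbourhood of
    [x] contained in [U]; [A] and [B] are neighbourhoods in the base and in the
    fibre whose product is mapped into [C]; the box is so small that its
    preimage [K] under the chart lies in [A] and is closed in the base; the bump
    function [chi] of the fibre is supported in [B]. On the stratum of [x] the
    second component is the distinguished point, where [chi] is [1], so there
    the lifted flow is the flow of the chart at full speed. *)
Lemma local_action (i : sindex S) (x : S) : stratum i x ->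
  exists (a : chart R S (sdim i)) (U : set S) (r : R),
  [/\ satlas i a, cdom a x, open_nbhs x U, 0 < r &
  (forall v, (forall j, `|box_coord (cmap a x) r v j| <= 1) ->
     exists2 y, cdom a y /\ U y & cmap a y = v) /\
  forall k, exists2 Theta, smooth_action Theta & forall t y, cdom a y -> U y ->
     [/\ cdom a (Theta t y), U (Theta t y) &
         cmap a (Theta t y) = shift (cmap a x) r k t (cmap a y)]].
Proof.
move=> ix; have [U [F [pt [f [g [[oU Ux] [hF _] dfg strat fo]]]]]] := htriv ix.
have strata_fg j : stratum j `&` U !=set0 ->
    exists k, f @` [set y : U | stratum j (val y)] = stratum k.
  by move=> /strat[k [kE _ _]]; exists k.
have [mi covi] := stratification_charted hS.1 i.
have [a Aa ax] := covi _ ix; have ma := mi _ Aa.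
have [[V' oV' aV'] _ _] := ma.
pose a' := base_chart (i := i) U a.
have [[V'' oV'' aV''] ha' oa'] := sub_chart_manifold ma oU.
have iUx : x \in stratum i `&` U by rewrite inE.
pose x' : (stratum i `&` U : set S) := SigSub iUx.
have xU : x \in U by rewrite inE.
have ax' : cdom a' x' by [].
have od : open (cdom a') by rewrite /a' /base_chart aV'' setTI.
have a'I (y z : (stratum i `&` U : set S)) : cdom a' y -> cdom a' z -> cmap a' y = cmap a' z -> y = z.
  by move=> ay az; have [_ aI _] := ha'; apply: aI; rewrite inE.
have fx : f (SigSub xU) = (x', pt) by exact: fo.
have [C [cC nC CU]] := space_regular hS (open_nbhs_nbhs (conj oU Ux)).
have : \forall z \near (x', pt), C (val (g z)).
  apply: (@val_g_cont _ _ _ _ _ _ _ dfg (x', pt)) => /=.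
  by rewrite -fx (triv_fK dfg).
move=> /prod_nbhs[A [B [Ax Bpt ABC]]].
have /nbhs_subtype[W [oW Wx] WA] := open_nbhs_nbhs Ax.
have V'x : V' x by move: ax; rewrite aV' => -[].
have [N2 [cN2 nN2 N2W]] := space_regular hS (open_nbhs_nbhs (conj (openI oW oV') (conj Wx V'x))).
have nN2' : nbhs x' [set y : (stratum i `&` U : set S) | N2 (val y)].
  exact: (@val_cont _ _ x').
have [Q [oQ Qx] QN2] := homeo_nbhs ha' ax' nN2'.
have imx : (cmap a' @` cdom a') (cmap a' x') by exists x'.
have nQ : nbhs (cmap a x) (Q `&` (cmap a' @` cdom a')).
  apply: open_nbhs_nbhs; split=> //; exact: openI.
have [r r0 rQ] := box_nbhs nQ; have rQ' := rQ.
have box v : (forall j, `|box_coord (cmap a x) r v j| <= 1) -> exists2 y, cdom a' y & cmap a' y = v.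
  by move=> /rQ[].
pose K := [set y : (stratum i `&` U : set S) | cdom a' y /\ forall j, `|box_coord (cmap a x) r (cmap a' y) j| <= 1].
have KN2 y : K y -> N2 (val y).
  by move=> [ay /rQ[Qy _]]; exact: QN2.
have cK : closed K.
  rewrite -[K]setCK; apply: open_closedC; rewrite openE => y nKy; rewrite /interior.
  have [N2y|nN2y] := pselect (N2 (val y)); last first.
    have oN : open (~` N2) by rewrite openC.
    have H : \forall z \near y, (~` N2) (val z).
      exact: (@val_cont _ _ y) (open_nbhs_nbhs (conj oN nN2y)).
    by apply: filterS H => z nN2z /KN2.
  have ay : cdom a' y.
    rewrite /a' /base_chart /= /preimage /= aV'; split; last by have [] := N2W _ N2y.
    by have [] := set_valP y.
  have [j jo] : exists j, 1 < `|box_coord (cmap a x) r (cmap a' y) j|.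
    apply: contrapT => /forallNP H; apply: nKy; split => // j.
    by rewrite leNgt; apply/negP; exact: H.
  have s1 := smooth_box_coord (cmap a x) r j openT (@smooth_on_id R (sdim i) setT).
  have c1 : {for cmap a' y, continuous (fun v => box_coord (cmap a x) r v j)} := s1 0%N _ I.
  have ca : {for y, continuous (cmap a')} := homeo_open_cont ha' od ay.
  have c2 : {for y, continuous (fun z => `|box_coord (cmap a x) r (cmap a' z) j|)}.
    apply: (@continuous_comp _ _ _ (fun z => box_coord (cmap a x) r (cmap a' z) j) Num.norm).
      exact: (@continuous_comp _ _ _ (cmap a') _ y ca c1).
    exact: norm_continuous.
  have H : \forall z \near y, 1 < `|box_coord (cmap a x) r (cmap a' z) j|.
    have H1 : \forall v \near `|box_coord (cmap a x) r (cmap a' y) j|, 1 < v := lt_nbhsr jo.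
    exact: c2 H1.
  by apply: filterS H => z zo [_ /(_ j)]; rewrite leNgt zo.
have [chi [N [Cchi chi1 cN NB chi0]]] := smooth_bump hF (open_nbhs_nbhs Bpt).
have KC (z : prod_stratified (open_stratum i U) F) : K z.1 -> N z.2 -> C (val (g z)).
  move=> Kz Nz; apply: ABC; split; last exact: NB.
  by apply: WA; have [] := N2W _ (KN2 _ Kz).
exists a, U, r; split=> //; split.
  move=> v /box[y ay yE]; exists (val y) => //; split => //.
  by have [] := set_valP y.
move=> k; have [mv [mv_chart mv_out mv0 mvD]] := chart_flow r0 a'I box k.
exists (lift_flow f g chi mv).
  exact: (lift_flow_action hS oU hF dfg strata_fg Aa Cchi cN chi0 cC CU cK KC mv_chart mv_out mv0 mvD).
have fibre (z : (stratum i `&` U : set S)) (zU : val z \in U) : f (SigSub zU) = (z, pt).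
  exact: fo.
move=> t y ay Uy.
have iUy : y \in stratum i `&` U by rewrite inE; split => //; move: ay; rewrite aV' => -[].
pose y' : (stratum i `&` U : set S) := SigSub iUy.
have Uy' : y \in U by rewrite inE.
have [aty tyE] := mv_chart t y' ay.
have Uty : val (mv t y') \in U by rewrite inE; have [] := set_valP (mv t y').
have -> : lift_flow f g chi mv t y = val (mv t y').
  rewrite -[y in LHS]/(val (SigSub Uy' : U)) lift_flowE (fibre y') /prod_flow /=.
  rewrite (nbhs_singleton chi1) mulr1 -[in LHS](fibre (mv t y') Uty) (triv_fK dfg) //.
by split => //; move: Uty; rewrite inE.
Qed.

End LocalAction.

(** * Orbits *)
Section Orbits.
Context {R : realType}.
Variables (S : smooth_stratified R) (hS : smooth_stratified_space S).
Hypothesis htriv : locally_trivial S.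
Notation X := (strongly_stratified S).

Definition linked (x y : S) : Prop := exists m, reach (Cinf S) X m x y.

Lemma reach_trans m n x y z :
  reach (Cinf S) X m x y -> reach (Cinf S) X n y z -> reach (Cinf S) X (m + n) x z.
Proof.
elim: m x => [|m IH] x /= => [->//|[Y [t [w [XY fl wy]]]] yz].
by exists Y, t, w; split => //; exact: IH.
Qed.

Lemma linked_trans x y z : linked x y -> linked y z -> linked x z.
Proof. by move=> [m Hm] [n Hn]; exists (m + n)%N; exact: reach_trans Hn. Qed.

Lemma reach_act Theta t x : smooth_action Theta -> reach (Cinf S) X 1 x (Theta t x).
Proof.
move=> act; exists (generator Theta), t, (Theta t x); split=> //.
  exact: generator_strongly_stratified.
exact: act_flow.
Qed.

(** An orbit asks for at least one step, which the identity action
    provides. *)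
Lemma linked_orbit x : vf_orbit (Cinf S) X x = [set y | linked x y].
Proof.
apply/seteqP; split=> [y [m H]|y [m H]]; first by exists m.+1.
exists m; apply: (@reach_trans 1 m x x y) => //.
have act : @smooth_action R S (fun=> id).
  split => // u Cu t0 p0; apply: (@stationary_smooth R S (fun=> id) u t0 p0 Cu).
  exact: nbhs_all.
exact: (reach_act 0 x act).
Qed.

Lemma reach_stratum m i x y : stratum i x -> reach (Cinf S) X m x y -> stratum i y.
Proof.
elim: m x => [|m IH] x ix /= => [<-//|[Y [t [w [XY [I [c [[ic _] It cw]]] wy]]]]].
by apply: IH wy; rewrite -cw; exact: integral_curve_stratum ic _ It.
Qed.

(** If the squares of the box coordinates of [y] add up to less than [1/2], then
    so do those of the vectors obtained by replacing some of them by [0]. Hence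
    along the chain that switches on the coordinates of [y] one by one the flows
    move at full speed, and by [shift_reach] each link can be covered in both
    directions. *)
Lemma local_linked (i : sindex S) (x : S) : stratum i x ->
  exists2 W, open_nbhs x W & forall y, stratum i y -> W y -> linked x y /\ linked y x.
Proof.
move=> ix; have [a [U [r [Aa ax [oU Ux] r0 [box mv]]]]] := local_action hS htriv ix.
have [mi _] := stratification_charted hS.1 i.
have [[V oV aV] ha _] := mi _ Aa.
have [/within_contP ca aI _] := ha.
have nb := ca x _ ax (near_box (cmap a x) r0).
have Vx : V x by move: ax; rewrite aV => -[].
have [W Wx WE] := nbhs_open (nbhsI nb (nbhsI (open_nbhs_nbhs (conj oU Ux)) (open_nbhs_nbhs (conj oV Vx)))).
exists W => // y iy /WE[ys [Uy Vy]].
have ay : cdom a y by rewrite aV.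
have {}ys := ys ay.
set z := box_coord (cmap a x) r in ys.
have zlt j : `|z (cmap a y) j| < 1.
  rewrite -(@ltr_pXn2r R 2) ?nnegrE // expr1n (real_normK (num_real _)).
  apply: le_lt_trans (_ : 2^-1 < 1); last by rewrite invf_lt1 // ltr1n.
  apply: le_trans (ltW ys); rewrite (bigD1 j) //= lerDl.
  by apply: sumr_ge0 => l _; exact: sqr_ge0.
pose D := [set w | cdom a w /\ U w].
have step (k : 'I_(sdim i)) w w' : D w -> D w' ->
    (forall j, j != k -> z (cmap a w) j = z (cmap a w') j) ->
    (forall j, z (cmap a w) j = 0 \/ z (cmap a w) j = z (cmap a y) j) ->
    (forall j, z (cmap a w') j = 0 \/ z (cmap a w') j = z (cmap a y) j) -> linked w w'.
  move=> [aw Uw] [aw' Uw'] ww' wz wz'.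
  have lt1 u : (forall j, z (cmap a u) j = 0 \/ z (cmap a u) j = z (cmap a y) j) ->
      `|z (cmap a u) k| < 1.
    by move=> /(_ k)[->|->//]; rewrite normr0.
  have pw : off_axis_sq (cmap a x) r k (cmap a w) <= 2^-1.
    apply: le_trans (ltW ys); rewrite /off_axis_sq [leRHS](bigID (fun j => j != k)) /=.
    apply: ler_wpDr; first by apply: sumr_ge0 => l _; exact: sqr_ge0.
    by apply: ler_sum => j _; have [zj|zj] := wz j; rewrite -/z zj // expr0n sqr_ge0.
  have [t tE] := shift_reach r0 ww' pw (lt1 w wz) (lt1 w' wz').
  have [Th Tact TE] := mv k.
  have [at_ _ atE] := TE t w aw Uw.
  exists 1%N; have -> : w' = Th t w.
    by apply: aI; rewrite ?inE // atE tE.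
  exact: reach_act.
have chain m : (m <= sdim i)%N -> forall w, D w ->
    (forall j, z (cmap a w) j = if (j < m)%N then z (cmap a y) j else 0) ->
    linked x w /\ linked w x.
  elim: m => [_|m IH md] w Dw wz.
    have -> : w = x.
      have [aw _] := Dw; apply: aI; rewrite ?inE //.
      by apply: (@box_coord_inj R _ (cmap a x) r r0) => j; rewrite box_coord_center; exact: wz.
    by split; exists 0%N.
  (* [u] is the last but one point of the chain, with coordinate [m] switched off *)
  have [v vE] := box_coord_onto (cmap a x) r0 (fun j => if (j < m)%N then z (cmap a y) j else 0).
  have [|u Du uE] := box v.
    by move=> j; rewrite vE; case: ifP => _; [exact: ltW|rewrite normr0].
  have uz j : z (cmap a u) j = if (j < m)%N then z (cmap a y) j else 0.
    by rewrite uE.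
  have [xu ux] := IH (ltnW md) u Du uz.
  have uw j : j != Ordinal md -> z (cmap a u) j = z (cmap a w) j.
    move=> jm; rewrite uz wz ltnS [in RHS]leq_eqVlt.
    by have -> : (nat_of_ord j == m) = false by apply/negbTE; move: jm; rewrite -val_eqE.
  have oru j : z (cmap a u) j = 0 \/ z (cmap a u) j = z (cmap a y) j.
    by rewrite uz; case: ifP; [right|left].
  have orw j : z (cmap a w) j = 0 \/ z (cmap a w) j = z (cmap a y) j.
    by rewrite wz; case: ifP; [right|left].
  split.
    by apply: linked_trans xu _; apply: (step (Ordinal md)).
  by apply: linked_trans ux; apply: (step (Ordinal md)) => // j /uw.
by apply: (chain (sdim i)) => // j; rewrite ltn_ord.
Qed.

(** The set of points to which [x] is linked is relatively open by
    [local_linked], and so is its complement: a point near [y] that could be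
    reached from [x] would allow one to reach [y]. *)
Lemma stratum_linked (i : sindex S) (x : S) : connected (stratum i) -> stratum i x ->
  stratum i = [set y | linked x y].
Proof.
move=> coni ix; apply/seteqP; split; last by move=> y [m]; exact: reach_stratum.
pose B := stratum i `&` [set y | linked x y].
suff BE : B = stratum i by move=> y; rewrite -BE => -[].
(* the largest open set whose trace on the stratum is contained in [P] *)
pose good (P : S -> Prop) := \bigcup_(W in [set W : set S | open W /\ stratum i `&` W `<=` P]) W.
have ogood P : open (good P) by apply: bigcup_open => W [].
have goodE (P : S -> Prop) : (forall y, stratum i y -> P y -> exists2 W, open_nbhs y W &
    forall w, stratum i w -> W w -> P w) -> forall y, stratum i y -> P y <-> good P y.
  move=> H y iy; split=> [Py|[W [_ WP] Wy]]; last exact: WP.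
  by have [W [oW Wy] WP] := H y iy Py; exists W => //; split => // w [iw Ww]; exact: WP.
apply: coni.
- by exists x; split => //; exists 0%N.
- exists (good (linked x)) => //; apply/seteqP; split => y [iy].
    move=> xy; split => //; apply: (goodE _ _ y iy).1 => // {y iy xy} y iy xy.
    have [W Wy WE] := local_linked iy; exists W => // w iw Ww.
    by apply: linked_trans xy _; have [] := WE w iw Ww.
  move=> [W [_ WP] Wy]; split=> //; exact: WP.
- exists (~` good (fun y => ~ linked x y)); first by rewrite closedC.
  apply/seteqP; split => y [iy].
    by move=> xy; split => // -[W [_ WP] Wy]; exact: WP xy.
  move=> ny; split => //; apply: contrapT => nxy; apply: ny.
  apply: (goodE _ _ y iy).1 => // {y iy nxy} y iy nxy.
  have [W Wy WE] := local_linked iy; exists W => // w iw Ww xw; apply: nxy.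
  by apply: linked_trans xw _; have [] := WE w iw Ww.
Qed.

End Orbits.

Theorem theorem7 (R : realType) (S : smooth_stratified R)
  (hS : smooth_stratified_space S)
  (hconn : forall i : sindex S, connected (stratum i))
  (htriv : locally_trivial S) :
  range (@stratum R S) =
    [set vf_orbit (Cinf S) (strongly_stratified S) x | x in [set: S]].
Proof.
have orbit i x : stratum i x -> vf_orbit (Cinf S) (strongly_stratified S) x = stratum i.
  by move=> ix; rewrite linked_orbit // -(stratum_linked hS htriv (hconn i) ix).
apply/seteqP; split=> [_ [i _ <-]|_ [x _ <-]].
  have [[_ _ _ [[[_ _ ne] _] _ _ _]] _] := hS; have [x ix] := ne i I.
  by exists x => //; exact: orbit.
by have [i ix] := strata_cover x hS; exists i => //; rewrite (orbit i).
Qed.
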